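(* Let $(M=G/H,g)$ be a geodesic orbit Riemannian space. Suppose that $\mathfrak{a}$ is an abelian ideal of $\mathfrak{g}=\operatorname{Lie}(G)$. Then any $X\in\mathfrak{a}$ (as a Killing vector field) has constant length on $(M,g)$. As a corollary, for every $X,Y\in\mathfrak{a}$ the function $g(X,Y)$ is constant on $M$.
   Context: Here $(M=G/H,g)$ is a connected homogeneous Riemannian space: $G$ is a Lie group, $H$ is a compact subgroup of $G$, $g$ is a $G$-invariant Riemannian metric on $G/H$, and $G$ acts effectively on $G/H$. It is called a geodesic orbit space if any geodesic of $M$ is an orbit of a $1$-parameter subgroup of $G$. Each $U\in\mathfrak{g}$ is identified with the Killing vector field $\widetilde{U}(x)=\frac{d}{dt}\exp(tU)(x)\big|_{t=0}$ on $M$ (this map is linear and injective). For $U,V\in\mathfrak g$, $g(U,V)$ denotes the function $x\mapsto g_x(U(x),V(x))$ on $M$; $X\in\mathfrak g$ has constant length if $g(X,X)$ is constant on $M$. *)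

(* Defs.v *)
From HB Require Import structures.
From mathcomp Require Import all_boot all_order all_algebra.
From mathcomp Require Import all_classical all_reals all_analysis.

Set Implicit Arguments.
Unset Strict Implicit.
Unset Printing Implicit Defensive.

Import Order.TTheory GRing.Theory Num.Theory.
Import numFieldNormedType.Exports.

Local Open Scope classical_set_scope.
Local Open Scope ring_scope.

(* Smoothness on an open set [A] of a finite-dimensional [V], through iterated
   directional derivatives (for such [V], the existence and continuity of all
   directional derivatives of order <= k is equivalent to being C^k). *)
Fixpoint Ck {R : realType} {V W : normedModType R} (k : nat) (A : set V)
    (f : V -> W) : Prop :=
  (forall x, A x -> {for x, continuous f}) /\
  if k is k'.+1 then
    forall v : V, (forall x, A x -> derivable f x v) /\
                  Ck k' A (fun x => 'D_v f x)
  else True.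

Definition smooth_on {R : realType} {V W : normedModType R} (A : set V)
    (f : V -> W) : Prop :=
  forall k, Ck k A f.

(* The atlas is indexed by the points of the manifold: [chart p] is a chart on
   the open neighbourhood [chart_dom p] of [p] (every atlas can be so indexed).
   This fixes a model of the tangent bundle: T_p M is 'rV[R]_n, a tangent
   vector at [p] being given by its coordinates in [chart p].
   The values of [chart p] outside [chart_dom p], and those of [chart_inv p]
   outside the image of [chart_dom p], are irrelevant. *)
HB.mixin Record isManifold (R : realType) (n : nat) M of Topological M := {
  chart_dom : M -> set M;
  chart : M -> M -> 'rV[R]_n;
  chart_inv : M -> 'rV[R]_n -> M;
  chart_dom_open : forall p, open (chart_dom p);
  chart_dom_mem : forall p, chart_dom p p;
  chart_img_open : forall p, open (chart p @` chart_dom p);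
  chartK : forall p x, chart_dom p x -> chart_inv p (chart p x) = x;
  chart_continuous :
    forall p x, chart_dom p x -> {for x, continuous (chart p)};
  chart_inv_continuous :
    forall p x, chart_dom p x -> {for chart p x, continuous (chart_inv p)};
  chart_smooth : forall p q,
    smooth_on (chart p @` (chart_dom p `&` chart_dom q))
              (chart q \o chart_inv p);
  manifold_hausdorff : hausdorff_space M;
  manifold_second_countable : @second_countable M
}.

#[short(type="manifoldType")]
HB.structure Definition Manifold (R : realType) (n : nat) :=
  {M of Topological M & isManifold R n M}.

Section Maps.
Context {R : realType}.

Definition smooth_map {m n : nat} {M : manifoldType R m} {N : manifoldType R n}
    (f : M -> N) : Prop :=
  continuous f /\
  forall p q, smooth_on (chart p @` (chart_dom p `&` f @^-1` chart_dom q))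
                        (chart q \o f \o chart_inv p).

(* Smoothness of [f] as a map from the product manifold M x N to P. *)
Definition smooth_map2 {m n k : nat} {M : manifoldType R m}
    {N : manifoldType R n} {P : manifoldType R k} (f : M -> N -> P) : Prop :=
  continuous (fun xy : M * N => f xy.1 xy.2) /\
  forall p q r,
    smooth_on
      [set uv : 'rV[R]_m * 'rV[R]_n |
         [/\ (chart p @` chart_dom p) uv.1, (chart q @` chart_dom q) uv.2
           & chart_dom r (f (chart_inv p uv.1) (chart_inv q uv.2))]]
      (fun uv => chart r (f (chart_inv p uv.1) (chart_inv q uv.2))).

(* The differential T_p M -> T_(f p) N. *)
Definition dmap {m n : nat} {M : manifoldType R m} {N : manifoldType R n}
    (f : M -> N) (p : M) (v : 'rV[R]_m) : 'rV[R]_n :=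
  'D_v (chart (f p) \o f \o chart_inv p) (chart p p).

Context {n : nat} {M : manifoldType R n}.

Definition smooth_curve (I : set R) (c : R -> M) : Prop :=
  (forall t, I t -> {for t, continuous c}) /\
  forall q, smooth_on (V := R^o) (I `&` c @^-1` chart_dom q) (chart q \o c).

(* c'(t), in T_(c t) M *)
Definition velocity (c : R -> M) (t : R) : 'rV[R]_n :=
  derive1 (fun s => chart (c t) (c s)) t.

(* A vector field is a function X : M -> 'rV[R]_n with X p in T_p M;
   [field_coord q X] gives its components in the single chart [chart q]. *)
Definition field_coord (q : M) (X : M -> 'rV[R]_n) (u : 'rV[R]_n) : 'rV[R]_n :=
  let p := chart_inv q u in 'D_(X p) (chart q \o chart_inv p) (chart p p).

(* [X, Y] = sum_k (X(Y^k) - Y(X^k)) d/dx^k *)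
Definition vbracket (X Y : M -> 'rV[R]_n) (p : M) : 'rV[R]_n :=
  'D_(X p) (field_coord p Y) (chart p p) -
  'D_(Y p) (field_coord p X) (chart p p).

(* The coordinate field d/dx^i of [chart q], as an element of T_p M. *)
Definition coord_field (q : M) (i : 'I_n) (p : M) : 'rV[R]_n :=
  'D_(delta_mx 0 i) (chart p \o chart_inv q) (chart q p).

(* The coefficients of the metric in [chart q], at the point with
   coordinates [u]. *)
Definition gram (g : M -> 'rV[R]_n -> 'rV[R]_n -> R) (q : M) (u : 'rV[R]_n) :
    'M[R]_n :=
  let p := chart_inv q u in
  \matrix_(i, j) g p (coord_field q i p) (coord_field q j p).

End Maps.

Record riemannian_metric {R : realType} {n : nat} (M : manifoldType R n) :=
  RiemannianMetric {
    metric :> M -> 'rV[R]_n -> 'rV[R]_n -> R;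
    metric_sym : forall p v w, metric p v w = metric p w v;
    metric_linear : forall p a u v w,
      metric p (a *: u + v) w = a * metric p u w + metric p v w;
    metric_pos : forall p v, v != 0 -> 0 < metric p v v;
    metric_smooth : forall q i j,
      smooth_on (W := R^o) (chart q @` chart_dom q)
                (fun u => gram metric q u i j)
  }.

Section Geodesics.
Context {R : realType} {n : nat} {M : manifoldType R n}.
Variable g : riemannian_metric M.

(* Gamma^k_ij of the Levi-Civita connection at [p], in [chart p]. *)
Definition christoffel (p : M) (k i j : 'I_n) : R :=
  let u := chart p p in
  let dg (a b c : 'I_n) : R :=
    'D_(delta_mx 0 a) (fun w => gram g p w b c : R^o) u in
  2^-1 * \sum_l invmx (gram g p u) k l * (dg i j l + dg j i l - dg l i j).

(* The covariant derivative of c' along c at time t, in T_(c t) M. *)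
Definition acceleration (c : R -> M) (t : R) : 'rV[R]_n :=
  let x := fun s => chart (c t) (c s) in
  let v := derive1 x t in
  derive1 (derive1 x) t +
  \row_k \sum_i \sum_j christoffel (c t) k i j * v 0 i * v 0 j.

Definition geodesic (I : set R) (c : R -> M) : Prop :=
  smooth_curve I c /\ forall t, I t -> acceleration c t = 0.

End Geodesics.

HB.mixin Record isLieGroup (R : realType) (n : nat) G
    of Manifold R n G & Group G := {
  mulg_smooth : @smooth_map2 R n n n G G G (fun x y => (x * y)%g);
  invg_smooth : @smooth_map R n n G G (fun x => (x^-1)%g)
}.

#[short(type="lieGroupType")]
HB.structure Definition LieGroup (R : realType) (n : nat) :=
  {G of Manifold R n G & Group G & isLieGroup R n G}.

(* Lie(G) is T_1 G, hence 'rV[R]_m, with the bracket of left-invariant vector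
   fields. *)
Section LieAlgebra.
Context {R : realType} {m : nat} {G : lieGroupType R m}.

Definition left_invariant (U : 'rV[R]_m) (a : G) : 'rV[R]_m :=
  dmap (fun b : G => (a * b)%g) 1%g U.

Definition lie (U V : 'rV[R]_m) : 'rV[R]_m :=
  vbracket (left_invariant U) (left_invariant V) 1%g.

Definition one_parameter_subgroup (c : R -> G) : Prop :=
  smooth_curve setT c /\ forall s t, c (s + t) = (c s * c t)%g.

(* [expt U t] is exp(tU): the one-parameter subgroup with velocity U at 0. *)
Definition expt (U : 'rV[R]_m) : R -> G :=
  xget (fun=> 1%g) [set c | one_parameter_subgroup c /\ velocity c 0 = U].

End LieAlgebra.

Definition abelian_ideal {R : realType} {m : nat} (G : lieGroupType R m)
    (a : {vspace 'rV[R]_m}) : Prop :=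
  (forall U X, X \in a -> lie (G := G) U X \in a) /\
  (forall X Y, X \in a -> Y \in a -> lie (G := G) X Y = 0).

(* M = G/H: the fibres of [proj] are the left cosets of the subgroup H, and
   the manifold structure of M is the quotient one, i.e. the only one making
   [proj] a smooth submersion. *)
Record homogeneous_space {R : realType} {m n : nat} (G : lieGroupType R m)
    (H : set G) (M : manifoldType R n) := HomogeneousSpace {
  proj : G -> M;
  action : G -> M -> M;
  isotropy1 : H 1%g;
  isotropyM : forall a b, H a -> H b -> H (a * b)%g;
  isotropyV : forall a, H a -> H (a^-1)%g;
  proj_surj : forall x, exists a, proj a = x;
  proj_fibre : forall a b, proj a = proj b <-> H (a^-1 * b)%g;
  proj_smooth : smooth_map proj;
  proj_submersion : forall a w, exists v, dmap proj a v = w;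
  action_proj : forall a b, action a (proj b) = proj (a * b)%g;
  action_smooth : smooth_map2 action
}.

Section HomogeneousSpaces.
Context {R : realType} {m n : nat} {G : lieGroupType R m} {H : set G}
  {M : manifoldType R n}.
Variable S : homogeneous_space H M.

Definition effective : Prop :=
  forall a : G, (forall x, action S a x = x) -> a = 1%g.

Definition invariant_metric (g : riemannian_metric M) : Prop :=
  forall (a : G) (x : M) (v w : 'rV[R]_n),
    g (action S a x) (dmap (action S a) x v) (dmap (action S a) x w) = g x v w.

(* A geodesic is a curve on an open interval, placed around 0 without loss of
   generality. *)
Definition geodesic_orbit (g : riemannian_metric M) : Prop :=
  forall (I : set R) (c : R -> M),
    open I -> is_interval I -> I 0 -> geodesic g I c ->
    exists U : 'rV[R]_m, forall t, I t -> c t = action S (expt U t) (c 0).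

Definition killing (U : 'rV[R]_m) (x : M) : 'rV[R]_n :=
  velocity (fun t => action S (expt U t) x) 0.

End HomogeneousSpaces.

Definition constant_on {T U : Type} (f : T -> U) : Prop :=
  exists k, forall x, f x = k.

(* Main.v *)
(* Work in charts. A Lie algebra element [U] acts on a chart of [M] as a Killing
   field [K_U], with [ [K_U, K_Y] = - K_[U, Y] ]. Hence [d |K_Y|^2 (K_U)] equals
   [- 2 g(K_[U, Y], K_Y)], and along an orbit of [U] which is a geodesic,
   [g(K_U, K_[U, Y]) = 0] for all [Y]. Let [Y] lie in the ideal [a], let [w] be
   orthogonal at [x] to [a(x)], the space of values at [x] of the Killing fields
   in [a], and let [U] generate the geodesic with initial velocity [w + Y(x)].
   As [[U, Y]] is in [a], [0 = g(w + Y, [U, Y]) = g(Y, [U, Y])] at [x], so the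
   derivative of [|Y|^2] in the direction [w + Y(x)] is 0; as it is 0 in the
   directions of [a(x)] because [a] is abelian, the differential of [|Y|^2]
   vanishes. The second claim follows by polarization.

   Existence of geodesics and of one-parameter subgroups comes from Picard
   iteration. Geodesics are obtained in a single chart, which suffices because
   the Euler-Lagrange expression of the energy is a covector. *)

(* The geodesic with initial velocity [w] is the orbit of some [U], but all that is known of [U] is
   its value [w] at the point. For [w] orthogonal to [a(x)] the relation [g(w, [U, Y]) = 0] is
   empty, as [[U, Y]] already takes its value in [a(x)]. Adding [Y(x)] to the velocity brings out
   the pairing with [Y] itself; the part along [Y] is removed afterwards by linearity of the
   differential. The orthogonality relation is the Euler-Lagrange equation of the orbit paired with
   [K_Y], from which the Killing equations of [U] and [Y] eliminate the derivatives of the metric.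
   The minus sign in the bracket formula is due to the left action: it carries right-invariant
   fields of [G] to Killing fields, whereas [lie] uses left-invariant ones. Two definitions shape
   the analysis. [acceleration] at time [t] is read in the chart attached to [c t], a chart that
   moves along the curve, whereas an ODE needs a fixed one. And [expt] is a choice with the constant
   curve as default, so one-parameter subgroups must be constructed before anything can be said of
   it. *)
From HB Require Import structures.
Require Import Defs.
From mathcomp Require Import all_boot all_order all_algebra.
From mathcomp Require Import all_classical all_reals all_analysis.
From mathcomp Require Import ring lra.

Set Implicit Arguments.
Unset Strict Implicit.
Unset Printing Implicit Defensive.

Import Order.TTheory GRing.Theory Num.Theory.
Import numFieldNormedType.Exports.

Local Open Scope classical_set_scope.
Local Open Scope ring_scope.


(** * Differential calculus on finite-dimensional spaces *)

(* A basis with continuous coordinates: the three kinds of domains of [smooth_on]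
   in the definitions of manifolds and curves are instances. *)
Class coords {R : realType} (V : normedModType R) := Coords {
  cdim : nat;
  cvec : 'I_cdim -> V;
  cfun : 'I_cdim -> {linear V -> R^o};
  cfun_cont : forall i, continuous (cfun i);
  cE : forall x, x = \sum_i cfun i x *: cvec i }.

Section Coords.
Context {R : realType}.

#[export] Program Instance reg_coords : coords R^o :=
  @Coords R R^o 1 (fun=> 1) (fun=> idfun) _ _.
Next Obligation. by move=> i x; exact: cvg_id. Qed.
Next Obligation. by move=> x; rewrite big_ord1 /= [_ *: _]mulr1. Qed.

Definition rV_coord n (i : 'I_n) (x : 'rV[R]_n) : R^o := x 0 i.
Lemma rV_coord_is_linear n (i : 'I_n) : linear (@rV_coord n i).
Proof. by move=> k x y; rewrite /rV_coord !mxE. Qed.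
HB.instance Definition _ n (i : 'I_n) :=
  GRing.isLinear.Build R 'rV[R]_n R^o *:%R (@rV_coord n i) (rV_coord_is_linear i).

#[export] Program Instance rV_coords n : coords 'rV[R]_n :=
  @Coords R 'rV[R]_n n (fun i => delta_mx 0 i) (fun i => @rV_coord n i) _ _.
Next Obligation. by move=> n i; exact: coord_continuous. Qed.
Next Obligation. by move=> n x; exact: row_sum_delta. Qed.

Section Prod.
Context {V W : normedModType R} {cV : coords V} {cW : coords W}.
Definition pair_cfun (i : 'I_(@cdim _ V _ + @cdim _ W _)) (x : V * W) : R^o :=
  match fintype.split i with inl a => cfun a x.1 | inr b => cfun b x.2 end.
Lemma pair_cfun_is_linear i : linear (pair_cfun i).
Proof. by move=> k x y; rewrite /pair_cfun; case: fintype.split => a; rewrite /= linearP. Qed.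
HB.instance Definition _ i :=
  GRing.isLinear.Build R (V * W)%type R^o *:%R (pair_cfun i) (pair_cfun_is_linear i).
Lemma pair_cfun_cont i : continuous (pair_cfun i).
Proof.
rewrite /pair_cfun; case: fintype.split => a x.
  by apply: continuous_comp; [exact: cvg_fst|exact: cfun_cont].
by apply: continuous_comp; [exact: cvg_snd|exact: cfun_cont].
Qed.
#[export] Program Instance prod_coords : coords (V * W)%type :=
  @Coords R _ (@cdim _ V _ + @cdim _ W _)
   (fun i => match fintype.split i with inl a => (cvec a, 0) | inr b => (0, cvec b) end)
   (fun i => pair_cfun i) pair_cfun_cont _.
Next Obligation.
move=> [x y]; rewrite big_split_ord /=.
under eq_bigr do rewrite /pair_cfun (unsplitK (inl _)) /=.
under [X in _ + X]eq_bigr do rewrite /pair_cfun (unsplitK (inr _)) /=.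
rewrite {1}(cE x) {1}(cE y).
apply/pair_equal_spec; rewrite !raddf_sum /=; split.
  by rewrite [X in _ + X]big1 ?addr0 // => i _; rewrite scaler0.
by rewrite [X in X + _]big1 ?add0r // => i _; rewrite scaler0.
Qed.
End Prod.
End Coords.

Section Directional.
Context {R : realType} {V W : normedModType R}.

Lemma is_derive_line (f : V -> W) y e (t : R) :
  derivable f (y + t *: e) e ->
  is_derive t (1 : R) (fun t : R => f (y + t *: e)) ('D_e f (y + t *: e)).
Proof.
move=> df.
have E : (fun h : R => h^-1 *: (((fun t : R => f (y + t *: e)) \o shift t) (h *: 1) - f (y + t *: e)))
  = (fun h => h^-1 *: ((f \o shift (y + t *: e)) (h *: e) - f (y + t *: e))).
  apply/funext => h /=; congr (_ *: (f _ - _)).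
  by rewrite [h *: 1]mulr1 scalerDl addrCA.
by split; [rewrite /derivable E|rewrite /derive E].
Qed.

(** Restricting to the line through [x] turns directional derivatives into derivatives in one real
    variable. *)
Lemma is_derive_lineP (f : V -> W) x v df :
  is_derive x v f df <-> is_derive (0 : R) (1 : R) (fun t : R => f (x + t *: v)) df.
Proof.
have E : (fun h : R => h^-1 *: (((fun t : R => f (x + t *: v)) \o shift 0) (h *: 1) - f (x + 0 *: v)))
  = (fun h => h^-1 *: ((f \o shift x) (h *: v) - f x)).
  apply/funext => h /=.
  by rewrite [h *: 1]mulr1 addr0 scale0r addr0 [x + _]addrC.
by split=> -[H1 H2]; split; move: H1 H2; rewrite /derivable /derive /= E.
Qed.

Lemma derivable_lin (W' : normedModType R) (L : {linear W -> W'}) (f : V -> W) x v :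
  continuous L -> derivable f x v -> is_derive x v (L \o f) (L ('D_v f x)).
Proof.
move=> cL /derivableP df.
have C : (fun h : R => h^-1 *: (((L \o f) \o shift x) (h *: v) - (L \o f) x)) @ 0^' --> L ('D_v f x).
  rewrite (_ : (fun h : R => _) = L \o (fun h : R => h^-1 *: ((f \o shift x) (h *: v) - f x))).
    apply: continuous_cvg; first exact: cL.
    exact: ex_derive.
  by apply/funext => h /=; rewrite linearZ_LR (raddfB L).
split; first by move/cvgP: C.
by rewrite /derive; apply: (@cvg_lim _ (@norm_hausdorff _ _)); exact: C.
Qed.

End Directional.

(** * Mean value theorem and strict differentiability *)

Section MeanValue.
Context {R : realType} {V : normedModType R}.

(** The condition is symmetric in the sign of [t], so that one statement serves for [s] of either
    sign. Derivability along [e] is all that [Ck] provides before differentiability is known. *)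
Lemma dir_MVT (f : V -> R^o) y e (s : R) :
  (forall t : R, `|t| <= `|s| -> derivable f (y + t *: e) e) ->
  exists2 c : R, `|c| <= `|s| & f (y + s *: e) - f y = s * 'D_e f (y + c *: e).
Proof.
move=> df; pose phi (t : R) : R := f (y + t *: e).
pose dphi (t : R) : R := 'D_e f (y + t *: e).
have dphiE (t : R) : `|t| <= `|s| -> is_derive t (1 : R) phi (dphi t).
  by move=> /df; exact: is_derive_line.
have cphi (t : R) : `|t| <= `|s| -> {for t, continuous phi}.
  by move=> /dphiE [] /derivable1_diffP/differentiable_continuous.
have [s0|s0|->] := ltgtP s 0; last first.
- by exists 0; rewrite ?normr0// scale0r addr0 subrr mul0r.
- have [||c] := @MVT R phi dphi 0 s s0.
  + move=> t; rewrite in_itv /= => /andP[t0 ts]; apply: dphiE.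
    by rewrite !gtr0_norm // ltW.
  + apply: continuous_in_subspaceT => t; rewrite inE /= in_itv /= => /andP[t0 ts]; apply: cphi.
    by rewrite !ger0_norm // ltW.
  rewrite in_itv /= => /andP[c0 cs]; rewrite /phi scale0r addr0 subr0 mulrC => E.
  by exists c => //; rewrite !gtr0_norm // ltW.
- have [||c] := @MVT R phi dphi s 0 s0.
  + move=> t; rewrite in_itv /= => /andP[t0 ts]; apply: dphiE.
    by rewrite !ltr0_norm // lerN2 ltW.
  + apply: continuous_in_subspaceT => t; rewrite inE /= in_itv /= => /andP[t0 ts]; apply: cphi.
    by rewrite !ler0_norm // ?lerN2 // ltW.
  rewrite in_itv /= => /andP[c0 cs]; rewrite /phi scale0r addr0 sub0r => E.
  exists c; first by rewrite !ltr0_norm // lerN2 ltW.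
  by rewrite -opprB E /dphi; ring.
Qed.

(** By the mean value theorem the increment is [s] times a value of ['D_e f] near [x]. The bound is
    uniform in the base point [y], which lets [seq_strict] add increments in several directions. *)
Lemma dir_strict (f : V -> R^o) x e :
  (\forall y \near x, derivable f y e) -> {for x, continuous (fun y => 'D_e f y)} ->
  forall eps : R, 0 < eps -> exists2 d : R, 0 < d & forall y (s : R),
    `|y - x| < d -> `|s| < d -> `|f (y + s *: e) - f y - s * 'D_e f x| <= eps * `|s|.
Proof.
move=> dn cn eps eps0.
have /nbhs_ballP[r /= r0 rP] : \forall y \near x, derivable f y e /\ `|'D_e f x - 'D_e f y| < eps.
  by near=> y; split; [near: y|near: y; move/cvgrPdist_lt: cn; apply].
(* Chosen so that [d + d |e| = r]: then [y + t e] stays in the ball of radius [r] when [|y - x|] and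
   [|t|] are below [d]. *)
pose d := r / (1 + `|e|).
have e1 : 0 < 1 + `|e| by rewrite ltr_pwDl.
have d0 : 0 < d by rewrite divr_gt0.
have close y (t : R) : `|y - x| < d -> `|t| < d -> ball x r (y + t *: e).
  move=> yd td; rewrite -ball_normE /= distrC addrAC.
  apply: (le_lt_trans (ler_normD _ _)); rewrite normrZ.
  have -> : r = d + d * `|e| by rewrite -[X in X + _](mulr1 d) -mulrDr /d mulfVK ?gt_eqF.
  by apply: ltr_leD => //; rewrite ler_wpM2r // ltW.
exists d => // y s yd sd.
have [|c cs ->] := @dir_MVT f y e s.
  by move=> t ts; have [] := rP _ (close y t yd (le_lt_trans ts sd)).
rewrite -mulrBr normrM mulrC ler_wpM2r //.
have [_ /ltW] := rP _ (close y c yd (le_lt_trans cs sd)).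
by rewrite distrC.
Unshelve. all: by end_near. Qed.

(** The increment is made one direction at a time: after the step along [e i], the induction
    hypothesis is used at the shifted base point, which is why [y] ranges over a neighbourhood of
    [x]. *)
Lemma seq_strict (I : eqType) (e : I -> V) (f : V -> R^o) x (s : seq I) :
  (forall i, i \in s -> \forall y \near x, derivable f y (e i)) ->
  (forall i, i \in s -> {for x, continuous (fun y => 'D_(e i) f y)}) ->
  forall eps : R, 0 < eps -> exists2 d : R, 0 < d & forall y (a : I -> R),
    `|y - x| < d -> (forall i, `|a i| < d) ->
    `|f (y + \sum_(i <- s) a i *: e i) - f y - \sum_(i <- s) a i * 'D_(e i) f x|
     <= eps * \sum_(i <- s) `|a i|.
Proof.
elim: s => [|i s IH] dn cn eps eps0.
  exists 1 => // y a _ _; rewrite !big_nil addr0 subrr subr0 normr0 mulr0 //.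
have [d d0 dP] := IH (fun j js => dn j (mem_behead (s := i :: s) js))
  (fun j js => cn j (mem_behead (s := i :: s) js)) eps eps0.
have [d' d'0 dP'] := dir_strict (dn i (mem_head _ _)) (cn i (mem_head _ _)) eps0.
have e1 : 0 < 1 + `|e i| by rewrite ltr_pwDl.
pose d2 := d / (1 + `|e i|).
have d20 : 0 < d2 by rewrite divr_gt0.
have d2d : d2 <= d by rewrite ler_pdivrMr // ler_peMr ?lerDl // ltW.
exists (Num.min d2 d'); first by rewrite lt_min d20.
move=> y a; rewrite lt_min => /andP[y1 y2] al.
have a1 j : `|a j| < d2 by have := al j; rewrite lt_min => /andP[].
have a2 j : `|a j| < d' by have := al j; rewrite lt_min => /andP[].
have H1 := dP' y (a i) y2 (a2 i).
have H2 := dP (y + a i *: e i) a _ (fun j => lt_le_trans (a1 j) d2d).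
rewrite !big_cons addrA mulrDr.
have -> : f (y + a i *: e i + \sum_(j <- s) a j *: e j) - f y -
  (a i * 'D_(e i) f x + \sum_(j <- s) a j * 'D_(e j) f x)
 = (f (y + a i *: e i) - f y - a i * 'D_(e i) f x) +
  (f (y + a i *: e i + \sum_(j <- s) a j *: e j) - f (y + a i *: e i) -
    \sum_(j <- s) a j * 'D_(e j) f x).
  set X := f _; set Y := f _; set Z := f _; set A := a i * _; set B := \sum_(j <- s) _.
  by rewrite opprD; lra.
apply: (le_trans (ler_normD _ _)); apply: lerD => //; apply: H2.
rewrite addrAC; apply: (le_lt_trans (ler_normD _ _)); rewrite normrZ.
have -> : d = d2 + d2 * `|e i| by rewrite -[X in X + _](mulr1 d2) -mulrDr /d2 mulfVK ?gt_eqF.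
by apply: ltr_leD => //; rewrite ler_wpM2r // ltW.
Qed.

End MeanValue.

Section Coords2.
Context {R : realType} {V : normedModType R} {cV : coords V}.

Lemma coords_ext (x y : V) : (forall i, cfun i x = cfun i y) -> x = y.
Proof. by move=> xy; rewrite (cE x) (cE y); apply: eq_bigr => i _; rewrite xy. Qed.

Lemma coords_bounded : exists2 C : R, 0 < C & forall i (x : V), `|cfun i x| <= C * `|x|.
Proof.
have B i : exists2 C : R, 0 < C & forall x : V, `|cfun i x| <= C * `|x|.
  have := @linear_lipschitz R V R^o (cfun i) (@cfun_cont _ _ cV i).
  by case=> C C0 H; exists C.
pose C i := s2val (cid2 (B i)).
have C0 i : 0 < C i by rewrite /C; case: cid2.
exists (1 + \sum_i C i).
  by rewrite ltr_pwDl // sumr_ge0 // => i _; exact: ltW.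
move=> i x; have : `|cfun i x| <= C i * `|x| by rewrite /C; case: cid2.
move/le_trans; apply; rewrite ler_wpM2r //.
rewrite (bigD1 i) //= addrCA lerDl addr_ge0 // sumr_ge0 // => j _.
exact: ltW.
Qed.

(** [seq_strict] applied to the coordinates of [z - y]. With both end points free it yields
    differentiability (for [y = x]) and also the local Lipschitz bound needed by Picard
    iteration. *)
Lemma strict_diff (f : V -> R^o) x :
  (forall v, \forall y \near x, derivable f y v) ->
  (forall v, {for x, continuous (fun y => 'D_v f y)}) ->
  forall eps : R, 0 < eps -> exists2 d : R, 0 < d & forall y z,
    `|y - x| < d -> `|z - x| < d ->
    `|f z - f y - \sum_i cfun i (z - y) * 'D_(cvec i) f x| <= eps * `|z - y|.
Proof.
move=> dn cn eps eps0; have [C C0 CP] := coords_bounded.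
pose N := (@cdim _ V cV)%:R : R.
have NC0 : 0 < 1 + N * C by rewrite ltr_pwDl // mulr_ge0 ?ler0n // ltW.
(* The absolute values of the [N] coordinates of [z - y] sum to at most [N C |z - y|], hence this
   share of [eps]. *)
have e0 : 0 < eps / (1 + N * C) by rewrite divr_gt0.
have [d d0 dP] := @seq_strict R V _ (fun i => cvec i) f x (index_enum 'I_(@cdim _ V cV))
  (fun i _ => dn _) (fun i _ => cn _) _ e0.
pose d2 := d / (1 + C + C).
have C2 : 0 < 1 + C + C by rewrite !addr_gt0.
have d20 : 0 < d2 by rewrite divr_gt0.
have d2d : d2 <= d by rewrite ler_pdivrMr // ler_peMr -?addrA ?lerDl ?addr_ge0 // ltW.
exists d2 => // y z yx zx.
have := dP y (fun i => cfun i (z - y)) (lt_le_trans yx d2d).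
rewrite -cE (addrC y) subrK => H; apply: (le_trans (H _)).
  move=> i; apply: (le_lt_trans (CP _ _)).
  have zy : `|z - y| < d2 + d2.
    rewrite -(subrKA x) -[x - y]opprB; apply: (le_lt_trans (ler_normB _ _)).
    by rewrite ltrD.
  have -> : d = (1 + C + C) * d2 by rewrite /d2 mulrC mulfVK ?gt_eqF.
  apply: (@lt_trans _ _ (C * (d2 + d2))); first by rewrite ltr_pM2l.
  by rewrite -subr_gt0 (_ : _ - _ = d2) //; ring.
have S : \sum_i `|cfun i (z - y)| <= N * (C * `|z - y|).
  apply: (@le_trans _ _ (\sum_(i < @cdim _ V cV) (C * `|z - y|))).
    by apply: ler_sum => i _; exact: CP.
  by rewrite sumr_const card_ord -mulr_natl.
apply: (le_trans (ler_wpM2l (ltW e0) S)).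
rewrite -mulrA ler_pM2l // mulrC ler_pdivrMr // mulrA mulrC ler_wpM2l //.
by rewrite lerDr.
Qed.
End Coords2.

Section LinComb.
Context {R : realType} {V : normedModType R} {cV : coords V}.
(** The candidate differential, bundled as a linear map: [c] will be the partial derivatives along
    the basis. *)
Definition lincomb (c : 'I_(@cdim _ V cV) -> R) (v : V) : R^o :=
  \sum_i cfun i v * c i.
Lemma lincomb_is_linear c : linear (lincomb c).
Proof.
move=> k x y; rewrite /lincomb scaler_sumr -big_split /=.
by apply: eq_bigr => i _; rewrite linearP mulrDl -mulrA.
Qed.
HB.instance Definition _ c :=
  GRing.isLinear.Build R V R^o *:%R (lincomb c) (lincomb_is_linear c).

Lemma lincomb_cont c : continuous (lincomb c).
Proof.
apply: continuous_big => // [|i _ x]; first exact: add_continuous.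
apply: cvgM; last exact: cvg_cst.
exact: cfun_cont.
Qed.

Lemma C1_differentiable_real (f : V -> R^o) x :
  (forall v, \forall y \near x, derivable f y v) ->
  (forall v, {for x, continuous (fun y => 'D_v f y)}) ->
  differentiable f x.
Proof.
move=> dn cn.
pose df : {linear V -> R^o} := lincomb (fun i => 'D_(cvec i) f x).
have E : f \o shift x = cst (f x) + df +o_ 0 id.
  apply/eqaddoP => _/posnumP[e].
  have [d d0 dP] := strict_diff dn cn (gt0 e).
  near=> h.
  have := dP x (h + x); rewrite subrr normr0 addrK => H.
  rewrite -![(_ + _ : _ -> _) _]/(_ + _) -![(- _ : _ -> _) _]/(- _) /= opprD addrA.
  apply: H => //; near: h; exact: nbhs0_lt.
have cdf : continuous df by exact: lincomb_cont.
have dfE := diff_unique cdf E.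
by apply/diff_locallyP; rewrite dfE.
Unshelve. all: by end_near. Qed.

Lemma C1_differentiable {W : normedModType R} {cW : coords W} (f : V -> W) x :
  (forall v, \forall y \near x, derivable f y v) ->
  (forall v, {for x, continuous (fun y => 'D_v f y)}) ->
  differentiable f x.
Proof.
move=> dn cn.
have -> : f = \sum_(i < @cdim _ W cW) (fun y => cfun i (f y) *: cvec i).
  by apply/funext => y; rewrite fct_sumE -cE.
apply: differentiable_sum => i; apply: differentiableZl.
apply: C1_differentiable_real.
  move=> v; near=> y.
  have dfy : derivable f y v by near: y; exact: dn.
  by have [] := derivable_lin (@cfun_cont _ _ cW i) dfy.
move=> v; pose F y := 'D_v (cfun i \o f) y; change (F @ x --> F x).
have near_eq : \forall y \near x, cfun i ('D_v f y) = F y.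
  near=> y; have dfy : derivable f y v by near: y; exact: dn.
  by have [_ <-] := derivable_lin (@cfun_cont _ _ cW i) dfy.
rewrite -(nbhs_singleton near_eq).
apply: cvg_trans; first by apply: near_eq_cvg; exact: near_eq.
exact: (continuous_comp (cn v) (@cfun_cont _ _ cW i _)).
Unshelve. all: by end_near. Qed.

End LinComb.

Section Chain.
Context {R : realType} {U V W : normedModType R}.

(** Along the line through [x] in the direction [u], [g] is a curve in one real variable, and the
    usual chain rule applies at time 0. *)
Lemma is_derive_chain (f : V -> W) (g : U -> V) x u :
  differentiable f (g x) -> derivable g x u ->
  is_derive x u (f \o g) ('D_('D_u g x) f (g x)).
Proof.
move=> df dg; apply/is_derive_lineP.
have /derivableP/is_derive_lineP dg' := dg.
have dgd : differentiable (fun t : R => g (x + t *: u)) 0.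
  by apply/derivable1_diffP; case: dg'.
have df' : differentiable f ((fun t : R => g (x + t *: u)) 0).
  by rewrite /= scale0r addr0.
have dc : differentiable (f \o (fun t : R => g (x + t *: u))) 0.
  exact: differentiable_comp.
split; first exact/derivable1_diffP.
rewrite deriveE //.
have -> : 'd (fun t : R => (f \o g) (x + t *: u)) 0 = 'd (f \o (fun t : R => g (x + t *: u))) 0 :> (_ -> _) by [].
rewrite diff_comp //= -(deriveE (1 : R^o) dgd) (@derive_val _ _ _ _ _ _ _ dg').
by rewrite scale0r addr0 (deriveE _ df).
Qed.

Lemma derive_linear (f : V -> W) x : differentiable f x -> linear (fun v => 'D_v f x).
Proof. by move=> df k u v; rewrite !deriveE // linearP. Qed.

End Chain.

Section DCoords.
Context {R : realType} {V W : normedModType R} {cV : coords V}.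
Lemma derive_coords (f : V -> W) x v : differentiable f x ->
  'D_v f x = \sum_i cfun i v *: 'D_(cvec i) f x.
Proof.
move=> df; rewrite deriveE // {1}(cE v) raddf_sum.
by apply: eq_bigr => i _; rewrite deriveE // [LHS]linearZ_LR.
Qed.
End DCoords.

(** * Closure properties of [Ck] *)

Section CkBasic.
Context {R : realType} {V W : normedModType R}.
Implicit Types (A B : set V) (f g : V -> W).

Lemma Ck_continuous k A f x : Ck k A f -> A x -> {for x, continuous f}.
Proof. by case: k => [|k] [H _] Ax; exact: H. Qed.

Lemma Ck_derivable k A f x v : Ck k.+1 A f -> A x -> derivable f x v.
Proof. by move=> [_ /(_ v)[H _]]; exact: H. Qed.

Lemma Ck_D k A f v : Ck k.+1 A f -> Ck k A (fun x => 'D_v f x).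
Proof. by move=> [_ /(_ v)[_]]. Qed.

Lemma Ck_sub k A B f : A `<=` B -> Ck k B f -> Ck k A f.
Proof.
elim: k f => [|k IH] f AB [H1 H2]; split=> //; first by move=> x /AB/H1.
  by move=> x /AB/H1.
by move=> v; have [H3 H4] := H2 v; split; [move=> x /AB/H3|exact: IH].
Qed.

Lemma Ck_pred k A f : Ck k.+1 A f -> Ck k A f.
Proof.
elim: k f => [|k IH] f [H1 H2]; split=> // v.
by have [H3 H4] := H2 v; split=> //; exact: IH.
Qed.

(** Openness of [A] makes [f] and [g] agree near each point, so their iterated derivatives agree
    too. This is the means of rewriting inside [Ck]. *)
Lemma Ck_eq k A f g : open A -> (forall x, A x -> f x = g x) -> Ck k A f -> Ck k A g.
Proof.
move=> oA; elim: k f g => [|k IH] f g fg [H1 H2].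
  split=> // x Ax.
  have nfg : \forall y \near x, f y = g y by apply: filterS (open_nbhs_nbhs (conj oA Ax)).
  rewrite /prop_for /continuous_at -(nbhs_singleton nfg).
  exact: cvg_trans (near_eq_cvg nfg) (H1 _ Ax).
have nfg x : A x -> \forall y \near x, f y = g y.
  by move=> Ax; apply: filterS (open_nbhs_nbhs (conj oA Ax)).
split=> [x Ax|v].
  rewrite /prop_for /continuous_at -(fg x Ax).
  exact: cvg_trans (near_eq_cvg (nfg x Ax)) (H1 _ Ax).
have [H3 H4] := H2 v; split=> [x Ax|].
  by apply: near_eq_derivable (H3 x Ax); exact: nfg.
by apply: IH H4 => x Ax; apply: near_eq_derive; exact: nfg.
Qed.

(** Every clause of [Ck] speaks of single points of the set, so [B] may vary with the point and
    carries no openness condition. *)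
Lemma Ck_local k A f :
  (forall x, A x -> exists2 B, B x & Ck k B f) -> Ck k A f.
Proof.
elim: k f => [|k IH] f H.
  by split=> // x /H [B Bx [+ _]]; apply.
split; first by move=> x /H [B Bx [+ _]]; apply.
move=> v; split; first by move=> x /H [B Bx [_ /(_ v) [+ _]]]; apply.
by apply: IH => x /H [B Bx [_ /(_ v) [_ ?]]]; exists B.
Qed.

Lemma Ck_cst k A (c : W) : open A -> Ck k A (fun=> c).
Proof.
move=> oA; elim: k c => [|k IH] c; split=> //; try by move=> x _; exact: cst_continuous.
move=> v; split=> [x _|]; first exact: derivable_cst.
by apply: (Ck_eq oA _ (IH 0)) => x _; rewrite derive_cst.
Qed.

Lemma CkD k A f g : open A -> Ck k A f -> Ck k A g -> Ck k A (fun x => f x + g x).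
Proof.
move=> oA; elim: k f g => [|k IH] f g [f1 f2] [g1 g2].
  by split=> // x Ax; apply: cvgD; [exact: f1|exact: g1].
split=> [x Ax|v]; first by apply: cvgD; [exact: f1|exact: g1].
have [f3 f4] := f2 v; have [g3 g4] := g2 v.
split=> [x Ax|]; first by apply: derivableD; [exact: f3|exact: g3].
apply: (Ck_eq oA _ (IH _ _ f4 g4)) => x Ax.
by rewrite -deriveD //; [exact: f3|exact: g3].
Qed.

Lemma Ck_sum (I : Type) (r : seq I) k A (f : I -> V -> W) : open A ->
  (forall i, Ck k A (f i)) -> Ck k A (fun x => \sum_(i <- r) f i x).
Proof.
move=> oA fi; elim: r => [|i r IH].
  by apply: (Ck_eq oA _ (Ck_cst k 0 oA)) => x _; rewrite big_nil.
by apply: (Ck_eq oA _ (CkD oA (fi i) IH)) => x _; rewrite big_cons.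
Qed.

End CkBasic.

Section CkOps.
Context {R : realType} {V W : normedModType R}.

Lemma Ck_lin_comp (W' : normedModType R) (L : {linear W -> W'}) k A f :
  continuous L -> open A -> Ck k A (f : V -> W) -> Ck k A (fun x => L (f x)).
Proof.
move=> cL oA; elim: k f => [|k IH] f [f1 f2].
  by split=> // x Ax; apply: (continuous_comp (f1 x Ax)); exact: cL.
split=> [x Ax|v]; first by apply: (continuous_comp (f1 x Ax)); exact: cL.
have [f3 f4] := f2 v; split=> [x Ax|].
  by have [] := derivable_lin cL (f3 x Ax).
apply: (Ck_eq oA _ (IH _ f4)) => x Ax.
by have [_] := derivable_lin cL (f3 x Ax).
Qed.

Lemma Ck_id k (A : set V) : open A -> Ck k A (@id V).
Proof.
move=> oA; case: k => [|k]; split=> //; try by move=> x _; exact: cvg_id.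
move=> v; split=> [x _|]; first exact: derivable_id.
by apply: (Ck_eq oA _ (Ck_cst k v oA)) => x _; rewrite derive_id.
Qed.

Lemma Ck_lin (L : {linear V -> W}) k A : continuous L -> open A -> Ck k A L.
Proof.
move=> cL oA; case: k => [|k]; split=> //; try by move=> x _; exact: cL.
move=> v; split=> [x _|].
  by have [] := derivable_lin cL (@derivable_id _ _ x v).
apply: (Ck_eq oA _ (Ck_cst k (L v) oA)) => x _.
by have [_] := derivable_lin cL (@derivable_id _ _ x v); rewrite derive_id.
Qed.

Lemma CkM k A (f g : V -> R^o) : open A -> Ck k A f -> Ck k A g ->
  Ck k A (fun x => f x * g x : R^o).
Proof.
move=> oA; elim: k f g => [|k IH] f g Cf Cg.
  by split=> // x Ax; apply: cvgM; [exact: Ck_continuous Cf Ax|exact: Ck_continuous Cg Ax].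
split=> [x Ax|v].
  by apply: cvgM; [exact: Ck_continuous Cf Ax|exact: Ck_continuous Cg Ax].
split=> [x Ax|].
  by apply: derivableM; [exact: Ck_derivable Cf Ax|exact: Ck_derivable Cg Ax].
have H1 := IH _ _ (Ck_pred Cf) (Ck_D v Cg).
have H2 := IH _ _ (Ck_pred Cg) (Ck_D v Cf).
apply: (Ck_eq oA _ (CkD oA H1 H2)) => x Ax.
by rewrite [RHS](deriveM (Ck_derivable (v:=v) Cf Ax) (Ck_derivable (v:=v) Cg Ax)).
Qed.

Lemma CkV k A (f : V -> R^o) : open A -> (forall x, A x -> f x != 0) ->
  Ck k A f -> Ck k A (fun x => (f x)^-1 : R^o).
Proof.
move=> oA f0; elim: k => [|k IH] Cf.
  by split=> // x Ax; apply: cvgV; [exact: f0|exact: Ck_continuous Cf Ax].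
split=> [x Ax|v].
  by apply: cvgV; [exact: f0|exact: Ck_continuous Cf Ax].
split=> [x Ax|].
  by apply: derivableV; [exact: f0|exact: Ck_derivable Cf Ax].
have H := IH (Ck_pred Cf).
have H1 := CkM oA (CkM oA H H) (CkM oA (Ck_cst k (-1 : R^o) oA) (Ck_D v Cf)).
apply: (Ck_eq oA _ H1) => x Ax /=.
rewrite [RHS](deriveV (f0 _ Ax) (Ck_derivable (v:=v) Cf Ax)) /GRing.scale /= expr2 invfM.
ring.
Qed.

End CkOps.

Section CkScale.
Context {R : realType} {W : normedModType R}.
Definition rscale (w : W) (t : R^o) : W := t *: w.
Lemma rscale_is_linear w : linear (rscale w).
Proof. by move=> k x y; rewrite /rscale scalerDl scalerA. Qed.
HB.instance Definition _ w :=
  GRing.isLinear.Build R R^o W *:%R (rscale w) (rscale_is_linear w).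
Lemma rscale_cont w : continuous (rscale w).
Proof. exact: scalel_continuous. Qed.
End CkScale.

Section CkComp.
Context {R : realType} {V W : normedModType R}.

Lemma Ck_coords {cW : coords W} k (A : set V) (f : V -> W) : open A ->
  (forall i, Ck k A (fun x => cfun i (f x))) -> Ck k A f.
Proof.
move=> oA H.
have Hi i : Ck k A (fun x => cfun i (f x) *: cvec i).
  exact: (Ck_lin_comp (L := rscale (cvec i)) (@rscale_cont _ _ _) oA (H i)).
by apply: (Ck_eq oA _ (Ck_sum _ oA Hi)) => x _; rewrite [RHS]cE.
Qed.

Lemma Ck_differentiable {cV : coords V} {cW : coords W} k (A : set V) (f : V -> W) x :
  open A -> Ck k.+1 A f -> A x -> differentiable f x.
Proof.
move=> oA Cf Ax; apply: C1_differentiable => v.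
  apply: filterS (open_nbhs_nbhs (conj oA Ax)) => y Ay.
  exact: Ck_derivable Cf Ay.
exact: Ck_continuous (Ck_D v Cf) Ax.
Qed.

End CkComp.

Section CkComp2.
Context {R : realType} {U V W : normedModType R}.

(** The composite is differentiated in the direction ['D_v g x], which varies with [x]; expanding it
    in the basis leaves the fixed directions [cvec j], to which the induction hypothesis applies. *)
Lemma Ck_comp_real {cV : coords V} k (A : set U) (B : set V)
    (f : V -> R^o) (g : U -> V) :
  open A -> open B -> Ck k B f -> Ck k A g -> (forall x, A x -> B (g x)) ->
  Ck k A (fun x => f (g x)).
Proof.
move=> oA oB; elim: k f g => [|k IH] f g Cf Cg AB.
  split=> // x Ax; apply: continuous_comp; first exact: Ck_continuous Cg Ax.
  by apply: Ck_continuous Cf _; exact: AB.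
split=> [x Ax|v].
  apply: continuous_comp; first exact: Ck_continuous Cg Ax.
  by apply: Ck_continuous Cf _; exact: AB.
have H x : A x -> is_derive x v (fun x => f (g x)) ('D_('D_v g x) f (g x)).
  move=> Ax; apply: is_derive_chain; last exact: Ck_derivable Cg Ax.
  by apply: Ck_differentiable Cf _ => //; exact: AB.
split=> [x /H[]//|].
have H2 j : Ck k A (fun x => cfun j ('D_v g x) * 'D_(cvec j) f (g x) : R^o).
  apply: CkM => //.
    apply: Ck_lin_comp => //; first exact: cfun_cont.
    exact: Ck_D.
  by apply: (IH (fun y => 'D_(cvec j) f y)) => //; [exact: Ck_D|exact: Ck_pred].
apply: (Ck_eq oA _ (Ck_sum _ oA H2)) => x Ax.
have [_ ->] := H x Ax; rewrite [RHS]derive_coords //.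
by apply: Ck_differentiable Cf _ => //; exact: AB.
Qed.

Lemma Ck_comp {cV : coords V} {cW : coords W} k (A : set U) (B : set V)
    (f : V -> W) (g : U -> V) :
  open A -> open B -> Ck k B f -> Ck k A g -> (forall x, A x -> B (g x)) ->
  Ck k A (fun x => f (g x)).
Proof.
move=> oA oB Cf Cg AB; apply: Ck_coords => // i.
apply: (Ck_comp_real (f := fun y => cfun i (f y)) oA oB) => //.
by apply: Ck_lin_comp => //; exact: cfun_cont.
Qed.

End CkComp2.

Section CkPair.
Context {R : realType} {U V W : normedModType R}.
Definition inl_lin (v : V) : V * W := (v, 0).
Definition inr_lin (w : W) : V * W := (0, w).
Lemma inl_is_linear : linear inl_lin.
Proof. by move=> k x y; apply/pair_equal_spec; rewrite /= scaler0 addr0. Qed.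
Lemma inr_is_linear : linear inr_lin.
Proof. by move=> k x y; apply/pair_equal_spec; rewrite /= scaler0 addr0. Qed.
HB.instance Definition _ := GRing.isLinear.Build R V (V * W)%type *:%R inl_lin inl_is_linear.
HB.instance Definition _ := GRing.isLinear.Build R W (V * W)%type *:%R inr_lin inr_is_linear.
Lemma inl_cont : continuous inl_lin.
Proof. by move=> x; apply: cvg_pair; [exact: cvg_id|exact: cvg_cst]. Qed.
Lemma inr_cont : continuous inr_lin.
Proof. by move=> x; apply: cvg_pair; [exact: cvg_cst|exact: cvg_id]. Qed.

Lemma Ck_pair k (A : set U) (f : U -> V) (g : U -> W) : open A ->
  Ck k A f -> Ck k A g -> Ck k A (fun x => (f x, g x)).
Proof.
move=> oA Cf Cg.
have := CkD oA (Ck_lin_comp (L := inl_lin) inl_cont oA Cf) (Ck_lin_comp (L := inr_lin) inr_cont oA Cg).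
by apply: Ck_eq => // x _; apply/pair_equal_spec; rewrite /= addr0 add0r.
Qed.
End CkPair.

(** * Symmetry of second derivatives *)

Section Schwarz.
Context {R : realType} {V : normedModType R}.

Lemma is_derive_translate {W : normedModType R} (f : V -> W) x w v df :
  is_derive (x + w) v f df -> is_derive x v (fun y => f (y + w)) df.
Proof.
move=> /is_derive_lineP H; apply/is_derive_lineP.
by under eq_fun do rewrite addrAC.
Qed.

(** The mean value theorem is used along [u] for the difference [h], then along [v] for ['D_u f].
    The second difference is symmetric in [u] and [v], whence Schwarz's theorem. *)
Lemma second_difference (A : set V) (f : V -> R^o) x u v (s : R) :
  Ck 2 A f ->
  (forall a b : R, `|a| <= `|s| -> `|b| <= `|s| -> A (x + a *: u + b *: v)) ->
  exists a b : R, [/\ `|a| <= `|s|, `|b| <= `|s| &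
   f (x + s *: u + s *: v) - f (x + s *: u) - f (x + s *: v) + f x =
   s * s * 'D_v ('D_u f) (x + a *: u + b *: v)].
Proof.
move=> Cf sA; pose h y : R^o := f (y + s *: v) - f y.
have hD (t : R) : `|t| <= `|s| -> is_derive (x + t *: u) u h
    ('D_u f (x + t *: u + s *: v) - 'D_u f (x + t *: u)).
  move=> ts; apply: is_deriveB; last first.
    apply: derivableP; apply: (Ck_derivable (A := A) (k := 1)) => //.
    by rewrite -[_ + _]addr0 -(scale0r v); apply: sA; rewrite ?normr0.
  apply/is_derive_translate/derivableP; apply: (Ck_derivable (A := A) (k := 1)) => //.
  exact: sA.
have [|a sa hE] := @dir_MVT R V h x u s; first by move=> t /hD [].
have [|b sb fE] := @dir_MVT R V ('D_u f) (x + a *: u) v s.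
  move=> t ts; apply: (Ck_derivable (A := A) (k := 0)); first exact: Ck_D.
  exact: sA.
exists a, b; split => //.
rewrite -mulrA -fE; have [_ <-] := hD a sa; rewrite -hE /h addrAC opprB addrCA.
ring.
Qed.

Lemma eq_of_close_values (p q : V -> R^o) x :
  {for x, continuous p} -> {for x, continuous q} ->
  (forall r : R, 0 < r -> exists y z, [/\ `|y - x| < r, `|z - x| < r & p y = q z]) ->
  p x = q x.
Proof.
move=> cp cq H; apply/eqP; rewrite -subr_eq0 -normr_le0.
apply/ler_addgt0Pl => e e0; rewrite addr0.
have e20 : 0 < e / 2 by rewrite divr_gt0.
move/cvgrPdist_lt: cp => /(_ _ e20) /nbhs_ballP[r1 /= r10 rP1].
move/cvgrPdist_lt: cq => /(_ _ e20) /nbhs_ballP[r2 /= r20 rP2].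
have [|y [z [yr zr E]]] := H (Num.min r1 r2); first by rewrite lt_min r10.
have H1 : `|p x - p y| < e / 2.
  apply: rP1; rewrite -ball_normE /= distrC (lt_le_trans yr) // ge_min lexx //.
have H2 : `|q x - q z| < e / 2.
  apply: rP2; rewrite -ball_normE /= distrC (lt_le_trans zr) // ge_min lexx orbT //.
rewrite [leRHS](splitr e) -(subrKA (p y)).
apply: (le_trans (ler_normD _ _)); apply: lerD; first exact: ltW.
by rewrite E distrC ltW.
Qed.

Lemma schwarz_real (A : set V) (f : V -> R^o) x u v :
  open A -> Ck 2 A f -> A x -> 'D_u ('D_v f) x = 'D_v ('D_u f) x.
Proof.
move=> oA Cf Ax; apply: (@eq_of_close_values ('D_u ('D_v f)) ('D_v ('D_u f)) x).
- exact: (Ck_continuous (Ck_D u (Ck_D v Cf)) Ax).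
- exact: (Ck_continuous (Ck_D v (Ck_D u Cf)) Ax).
move=> r r0.
have /nbhs_ballP[r1 /= r10 r1P] := open_nbhs_nbhs (conj oA Ax).
pose r' := Num.min r r1.
have r'0 : 0 < r' by rewrite lt_min r0.
(* The parallelogram spanned by [s u] and [s v] at [x] then stays in the ball of radius [r']. *)
pose s : R := r' / (1 + `|u| + `|v|).
have uv0 : 0 < 1 + `|u| + `|v| by rewrite -addrA ltr_pwDl // addr_ge0.
have s0 : 0 < s by rewrite divr_gt0.
have sB (a b : R) : `|a| <= `|s| -> `|b| <= `|s| -> `|(x + a *: u + b *: v) - x| < r'.
  rewrite (gtr0_norm s0) => sa sb; rewrite -[x + _ + _]addrA addrAC subrr add0r.
  apply: (le_lt_trans (ler_normD _ _)); rewrite !normrZ.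
  have -> : r' = s + (s * `|u| + s * `|v|).
    by rewrite -{1}(mulr1 s) -!mulrDr addrA /s mulfVK ?gt_eqF.
  by rewrite ltr_pwDl // lerD // ler_wpM2r.
have r'A y : `|y - x| < r' -> A y.
  move=> yr; apply: r1P; rewrite -ball_normE /= distrC (lt_le_trans yr) //.
  by rewrite ge_min lexx orbT.
have [|a [b [sa sb E1]]] := @second_difference A f x u v s Cf.
  by move=> a b sa sb; apply/r'A/sB.
have sB' (c d : R) : `|c| <= `|s| -> `|d| <= `|s| -> `|(x + c *: v + d *: u) - x| < r'.
  by move=> sc sd; rewrite (addrAC x); exact: sB.
have [|a' [b' [sa' sb' E2]]] := @second_difference A f x v u s Cf.
  by move=> c d sc sd; apply/r'A/sB'.
exists (x + a' *: v + b' *: u), (x + a *: u + b *: v); split.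
- by apply: (lt_le_trans (sB' _ _ sa' sb')); rewrite ge_min lexx.
- by apply: (lt_le_trans (sB _ _ sa sb)); rewrite ge_min lexx.
apply: (@mulfI _ (s * s)); first by rewrite mulf_neq0 // gt_eqF.
apply: etrans (esym E2) (etrans _ E1); rewrite [x + s *: v + s *: u]addrAC.
by rewrite -!addrA; congr (_ + _); rewrite !addrA; congr (_ + _); rewrite addrC.
Qed.

Lemma schwarz {W : normedModType R} {cW : coords W} (A : set V) (f : V -> W) x u v :
  open A -> Ck 2 A f -> A x -> 'D_u ('D_v f) x = 'D_v ('D_u f) x.
Proof.
move=> oA Cf Ax; apply: coords_ext => i.
have H a b : cfun i ('D_a ('D_b f) x) = 'D_a ('D_b (fun y => cfun i (f y))) x.
  have d1 y : A y -> derivable f y b by move=> Ay; exact: Ck_derivable Cf Ay.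
  have d2 : derivable ('D_b f) x a by apply: Ck_derivable (Ck_D b Cf) Ax.
  have [_ <-] := derivable_lin (@cfun_cont _ _ cW i) d2.
  apply: near_eq_derive; apply: filterS (open_nbhs_nbhs (conj oA Ax)) => y Ay.
  by case: (derivable_lin (@cfun_cont _ _ cW i) (d1 _ Ay)) => _ E; exact: (esym E).
have Cfi : Ck 2 A (fun y => cfun i (f y)).
  exact: (Ck_lin_comp (L := cfun i) (@cfun_cont _ _ cW i) oA Cf).
exact: etrans (H u v) (etrans (schwarz_real u v oA Cfi Ax) (esym (H v u))).
Qed.
End Schwarz.

(** * Ordinary differential equations *)

Section RVNorm.
Context {R : realType} {n : nat}.
Implicit Type x : 'rV[R]_n.

Lemma rV_norm_le x (K : R) : 0 <= K -> (forall i, `|x 0 i| <= K) -> `|x| <= K.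
Proof.
move=> K0 H; rewrite /Num.Def.normr /= mx_normrE; apply: bigmax_le => //= -[i j] _ /=.
by rewrite ord1; exact: H.
Qed.

Lemma rV_norm_coord x i : `|x 0 i| <= `|x|.
Proof.
rewrite [leRHS]/Num.Def.normr /= mx_normrE.
exact: (le_bigmax _ (fun ij : 'I_1 * 'I_n => `|x ij.1 ij.2|) (0, i)).
Qed.

Lemma is_derive_rVP (V : normedModType R) (f : V -> 'rV[R]_n) t v df :
  is_derive t v f df <-> forall i, is_derive t v (fun s => f s 0 i : R^o) (df 0 i).
Proof.
split=> [[d1 d2] i|H].
  split; first by move/derivable_mxP: d1; exact.
  by rewrite -d2 derive_mx // mxE.
have df1 : derivable f t v by apply/derivable_mxP => i j; rewrite ord1; case: (H j).
split=> //; rewrite derive_mx //; apply/rowP => i; rewrite mxE.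
by case: (H i).
Qed.

End RVNorm.

Section MeanValueRV.
Context {R : realType}.

Lemma mean_value_real (f : R -> R^o) (K s : R) :
  (forall t, `|t| <= `|s| -> derivable f t 1 /\ `|'D_1 f t| <= K) ->
  `|f s - f 0| <= K * `|s|.
Proof.
move=> H; have [|c cs] := @dir_MVT R R^o f 0 1 s.
  by move=> t ts; rewrite add0r [_ *: _]mulr1; case: (H t ts).
rewrite !add0r ![_ *: _]mulr1 => ->; rewrite normrM mulrC ler_wpM2r //.
by case: (H c cs).
Qed.

Lemma mean_value_rV n (f df : R -> 'rV[R]_n) (K s : R) :
  (forall t, `|t| <= `|s| -> is_derive t (1 : R) f (df t) /\ `|df t| <= K) ->
  `|f s - f 0| <= K * `|s|.
Proof.
move=> H.
have K0 : 0 <= K.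
  by have [|_] := H 0; [rewrite normr0|exact: le_trans].
apply: rV_norm_le; first exact: mulr_ge0.
move=> i; rewrite !mxE; apply: (@mean_value_real (fun s => f s 0 i)) => t /H[].
move=> /is_derive_rVP/(_ i)[d1 d2] dK; split=> //; rewrite d2.
exact: le_trans (rV_norm_coord _ _) dK.
Qed.

(** The integral starts at -2 and is considered up to 2, so that the times of interest are interior
    points; subtracting [F 0] normalises it. *)
Lemma antiderivative (f : R -> R) : continuous f ->
  exists F : R -> R^o, F 0 = 0 /\ forall t : R, `|t| < 1 -> is_derive t (1 : R) F (f t).
Proof.
move=> cf; pose F (x : R) : R := (\int[lebesgue_measure]_(t in `[(-2), x]) f t)%R.
exists (fun x => F x - F 0 : R^o); split; first by rewrite subrr.
move=> t; rewrite ltr_norml => /andP[t1 t2].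
have [||||d1 d2] := @continuous_FTC1_closed R f (-2) t 2.
- by rewrite (lt_trans t2) // ltr1n.
- apply: continuous_compact_integrable; first exact: segment_compact.
  exact: continuous_subspaceT.
- by rewrite (lt_trans _ t1) // ltrN2 ltr1n.
- exact: cf.
have dF : is_derive t (1 : R) (F : R -> R^o) (f t).
  by apply: DeriveDef d1 _; exact: etrans (esym (derive1E _ _)) d2.
have := is_deriveB dF (is_derive_cst (F 0 : R^o) t (1 : R)).
by rewrite subr0.
Qed.

Lemma antiderivative_rV n (f : R -> 'rV[R]_n) (x0 : 'rV[R]_n) : continuous f ->
  exists F : R -> 'rV[R]_n,
    F 0 = x0 /\ forall t : R, `|t| < 1 -> is_derive t (1 : R) F (f t).
Proof.
move=> cf.
have H i : exists F : R -> R^o, F 0 = 0 /\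
    forall t : R, `|t| < 1 -> is_derive t (1 : R) F (f t 0 i).
  apply: (antiderivative (f := fun t => f t 0 i)) => t.
  exact: (@continuous_comp _ _ _ f (fun M : 'rV[R]_n => M 0 i) t (cf t) (@coord_continuous _ _ _ 0 i (f t))).
pose F i := sval (cid (H i)).
exists (fun t => \row_i (x0 0 i + F i t)); split.
  by apply/rowP => i; rewrite mxE /F; case: cid => G [/= -> _]; rewrite addr0.
move=> t t1; apply/(@is_derive_rVP R n R^o) => i.
under eq_fun do rewrite mxE.
rewrite /F; case: cid => G [/= _ /(_ t t1) dG].
have := is_deriveD (is_derive_cst (x0 0 i : R^o) t (1 : R)) dG.
by rewrite add0r.
Qed.

End MeanValueRV.

Section Clamp.
Context {R : realType}.
(** Being 1-Lipschitz, this truncation extends maps from an interval or a box to the whole space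
    without spoiling Lipschitz bounds. *)
Definition clamp (a b t : R) : R := Num.max a (Num.min b t).

Lemma clamp_lip a b t s : `|clamp a b t - clamp a b s| <= `|t - s|.
Proof.
rewrite ler_norml /clamp; have := ler_norm (t - s); have := ler_norm (s - t).
rewrite (distrC s t) => h1 h2; have h0 := normr_ge0 (t - s).
move: h1 h2 h0; set D := `|_| => h1 h2 h0.
by case: (leP b t); case: (leP b s) => ? ?; case: (leP a) => ?; try case: (leP a) => ?; apply/andP; split; lra.
Qed.

Lemma clamp_itv a b t : a <= b -> a <= clamp a b t <= b.
Proof.
by move=> ab; rewrite /clamp le_max lexx ge_max ab ge_min lexx.
Qed.

Lemma clamp_id a b t : a <= t <= b -> clamp a b t = t.
Proof.
by move=> /andP[ta tb]; rewrite /clamp (min_idPr tb) (max_idPr ta).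
Qed.

Lemma lip_continuous (V W : normedModType R) (f : V -> W) (L : R) :
  (forall x y, `|f x - f y| <= L * `|x - y|) -> continuous f.
Proof.
move=> H x; apply/cvgrPdist_lt => e e0.
have L0 : 0 < `|L| + 1 by rewrite ltr_wpDl.
near=> y; apply: (le_lt_trans (H _ _)).
have xy : `|x - y| < e / (`|L| + 1).
  near: y; apply/nbhs_ballP; exists (e / (`|L| + 1)); first by rewrite /= divr_gt0.
  by move=> z; rewrite -ball_normE.
apply: (@le_lt_trans _ _ ((`|L| + 1) * `|x - y|)).
  by rewrite ler_wpM2r // (le_trans (ler_norm L)) // lerDl.
by rewrite mulrC -ltr_pdivlMr.
Unshelve. all: by end_near. Qed.

End Clamp.

(** * Picard iteration *)

Section Picard.
Context {R : realType} {n : nat}.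
Variables (F : 'rV[R]_n -> 'rV[R]_n) (L : R) (x0 : 'rV[R]_n).
Hypothesis L0 : 0 < L.
Hypothesis FL : forall x y, `|F x - F y| <= L * `|x - y|.

(** [h <= 1/2] keeps times in [|t| < 1], where antiderivatives are available, and [L h <= 1/2] makes
    the iteration contract by one half. *)
Let h : R := Num.min 2^-1 (2 * L)^-1.
Let h0 : 0 < h. Proof. by rewrite lt_min !invr_gt0 ?mulr_gt0 // !ltr0n. Qed.
Let h1 : h < 1.
Proof. by apply: (@le_lt_trans _ _ 2^-1); [rewrite ge_min lexx|rewrite invf_lt1 ?ltr1n ?ltr0n]. Qed.
Let Lh : L * h <= 2^-1.
Proof.
apply: (@le_trans _ _ (L * (2 * L)^-1)).
  by rewrite ler_pM2l // ge_min lexx orbT.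
by rewrite invfM mulrCA divff ?gt_eqF // mulr1.
Qed.
(** Time is frozen outside [[-h, h]], so that the iterates are continuous on all of [R] and can be
    compared at every [t]. *)
Let tau (t : R) : R := clamp (- h) h t.
Let tauh t : `|tau t| <= h.
Proof. by rewrite ler_norml; apply: clamp_itv; have := h0; lra. Qed.
Let tau1 t : `|tau t| < 1. Proof. exact: le_lt_trans (tauh t) h1. Qed.

Let step (y z : R -> 'rV[R]_n) := exists Phi : R -> 'rV[R]_n,
  [/\ Phi 0 = x0, forall t : R, `|t| < 1 -> is_derive t (1 : R) Phi (F (y t)) &
      forall t, z t = Phi (tau t)].

Let step_ex y : continuous y -> exists z, step y z.
Proof.
move=> cy; have cF : continuous (fun t => F (y t)).
  by move=> t; apply: (@continuous_comp _ _ _ y F t (cy t)); exact: (lip_continuous FL).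
have [Phi [P0 PD]] := antiderivative_rV x0 cF.
by exists (fun t => Phi (tau t)), Phi; split.
Qed.

Let step_cont y z : step y z -> continuous z.
Proof.
move=> [Phi [P0 PD zE]] t.
have -> : z = Phi \o tau by apply/funext.
apply: continuous_comp.
  by apply: (@lip_continuous R R^o R^o tau 1) => a b; rewrite mul1r; exact: clamp_lip.
have [/derivable1_diffP/differentiable_continuous//] := PD _ (tau1 t).
Qed.

Let step_lip y z y' z' (K : R) : step y z -> step y' z' ->
  (forall t, `|y t - y' t| <= K) -> forall t, `|z t - z' t| <= K / 2.
Proof.
move=> [P [P0 PD zE]] [P' [P'0 PD' zE']] yK t.
have K0 : 0 <= K := le_trans (normr_ge0 _) (yK 0).
rewrite zE zE'.
have := @mean_value_rV R n (P \- P') (fun t => F (y t) - F (y' t)) (L * K) (tau t).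
rewrite /= P0 P'0 subrr subr0 => H; apply: le_trans (H _) _ => [s st|].
  have s1 := le_lt_trans st (tau1 t); split.
    exact: is_deriveB (PD _ s1) (PD' _ s1).
  by apply: (le_trans (FL _ _)); rewrite ler_pM2l.
rewrite -mulrA (mulrC K) mulrA mulrC ler_wpM2l //.
by apply: le_trans Lh; rewrite ler_pM2l.
Qed.

Let T y := xget (fun=> x0) [set z | step y z].
Let xs k := iter k T (fun=> x0).
Let T_step y : continuous y -> step y (T y).
Proof. by move=> /step_ex [z sz]; exact: (@xgetI _ _ _ z). Qed.
Let xs_cont k : continuous (xs k).
Proof.
elim: k => [|k IH] /=; first by move=> t; exact: cst_continuous.
exact: step_cont (T_step IH).
Qed.
Let xs_step k : step (xs k) (xs k.+1). Proof. exact: (@T_step (xs k) (@xs_cont k)). Qed.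
Let K0 : R := `|F x0|.

Let xs_close k t : `|xs k.+1 t - xs k t| <= K0 / 2 ^+ k.
Proof.
elim: k t => [|k IH] t.
  have [P [P0 PD zE]] := xs_step 0.
  rewrite zE /= expr0 divr1 -P0.
  apply: (@le_trans _ _ (K0 * `|tau t|)).
    apply: mean_value_rV => s st; split; last exact: lexx.
    by apply: PD; apply: le_lt_trans st (tau1 t).
  by apply: ler_piMr; [exact: normr_ge0|exact/ltW/tau1].
by rewrite exprSr invfM mulrA; exact: step_lip (xs_step k.+1) (xs_step k) IH t.
Qed.

(** The bound is the exact partial sum of the geometric series, a form that the induction on [m]
    reproduces. *)
Let xs_far k m t : `|xs (k + m) t - xs k t| <= 2 * K0 / 2 ^+ k - 2 * K0 / 2 ^+ (k + m).
Proof.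
elim: m => [|m IH]; first by rewrite addn0 !subrr normr0.
rewrite addnS -(subrKA (xs (k + m) t)).
apply: le_trans (ler_normD _ _) _; have := xs_close (k + m) t.
rewrite exprSr invfM; move: IH; set A := 2 ^- (k + m); set B := 2 ^- k; set a := `|_|; set b := `|_|; lra.
Qed.

Let xs_far2 k m t : `|xs (k + m) t - xs k t| <= 2 * K0 / 2 ^+ k.
Proof.
apply: le_trans (xs_far k m t) _; rewrite gerBl.
by apply: divr_ge0; [apply: mulr_ge0 => //; exact: normr_ge0|exact: exprn_ge0].
Qed.

Let geo (C e : R) : 0 < e -> exists k, C / 2 ^+ k < e.
Proof.
move=> e0; have z1 : `|2^-1 : R| < 1 by rewrite ger0_norm ?invf_lt1 ?ltr1n ?ltr0n.
have /cvgrPdist_lt/(_ e e0) [k _ /(_ k (leqnn k))] := @cvg_geometric R C _ z1.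
rewrite /= sub0r normrN => H; exists k; apply: le_lt_trans H.
by rewrite exprVn ler_norm.
Qed.

Let xs_cvg t : cvg (xs k t @[k --> \oo]).
Proof.
apply/cauchy_cvgP/cauchy_exP => e e0.
have [k kP] := geo (2 * K0) e0; exists (xs k t).
exists k => // m /= km; rewrite -ball_normE /= distrC -(subnKC km).
exact: le_lt_trans (xs_far2 _ _ _) kP.
Qed.

Let x t : 'rV[R]_n := lim (xs k t @[k --> \oo]).

Let x_close k t : `|x t - xs k t| <= 2 * K0 / 2 ^+ k.
Proof.
apply/ler_addgt0Pr => e e0.
have /cvgrPdist_lt/(_ e e0) [m _ mP] := @xs_cvg t.
rewrite -(subrKA (xs (k + m) t)) addrC; apply: le_trans (ler_normD _ _) _.
by apply: lerD; [exact: xs_far2|apply/ltW/mP; exact: leq_addl].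
Qed.

Let x_cont : continuous x.
Proof.
move=> t; apply/cvgrPdist_lt => e e0.
have e3 : 0 < e / 3 by rewrite divr_gt0 // ltr0n.
have [k kP] := geo (2 * K0) e3.
have /cvgrPdist_lt/(_ _ e3) := @xs_cont k t.
apply: filterS => s xts.
have := le_lt_trans (x_close k t) kP; have := le_lt_trans (x_close k s) kP.
rewrite distrC => h2 h3.
rewrite -(subrKA (xs k t)) -(subrKA (xs k s) (xs k t)).
apply: le_lt_trans (ler_normD _ _) _.
have := ler_normD (xs k t - xs k s) (xs k s - x s).
move: h2 h3 xts; set a := `|_|; set b := `|_|; set c := `|_|; set d := `|_ + _|.
lra.
Qed.

Lemma picard_global : exists (d : R) (y : R -> 'rV[R]_n), [/\ 0 < d, y 0 = x0 &
  forall t, `|t| < d -> is_derive t (1 : R) y (F (y t))].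
Proof.
have [z sz] := step_ex x_cont.
have zx t : z t = x t.
  apply/eqP; rewrite -subr_eq0 -normr_le0; apply/ler_addgt0Pl => e e0; rewrite addr0.
  have e20 : 0 < e / 2 by rewrite divr_gt0.
  have [k kP] := geo (2 * K0) e20.
  have H1 := step_lip sz (xs_step k) (x_close k) t.
  have H2 := x_close k.+1 t.
  rewrite exprSr invfM mulrA in H2.
  rewrite -(subrKA (xs k.+1 t)); apply: le_trans (ler_normD _ _) _.
  rewrite (distrC (xs _ _)); move: kP H1 H2; set a := `|_|; set b := `|_|; lra.
case: sz => P [P0 PD zE].
exists h, P; split=> // t th.
have xP : x t = P t.
  by rewrite -zx zE /tau clamp_id // -ler_norml ltW.
by rewrite -xP; apply: PD; apply: lt_trans th h1.
Qed.

End Picard.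

Section LocalODE.
Context {R : realType} {n : nat}.

(** [strict_diff] with tolerance 1 gives each coordinate of [F] the Lipschitz constant [1] plus the
    absolute values of its partial derivatives at [x0]. *)
Lemma Ck_lipschitz (Omega : set 'rV[R]_n) (F : 'rV[R]_n -> 'rV[R]_n) x0 :
  open Omega -> Ck 1 Omega F -> Omega x0 ->
  exists r L : R, [/\ 0 < r, 0 < L, forall y, `|y - x0| < r -> Omega y &
    forall y z, `|y - x0| < r -> `|z - x0| < r -> `|F y - F z| <= L * `|y - z|].
Proof.
move=> oO CF O0.
have H i : exists2 d : R, 0 < d & exists2 L : R, 0 <= L & forall y z,
    `|y - x0| < d -> `|z - x0| < d -> `|F y 0 i - F z 0 i| <= L * `|y - z|.
  have Ci : Ck 1 Omega (fun x => F x 0 i : R^o).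
    exact: (Ck_lin_comp (L := rV_coord i) (@coord_continuous _ _ _ 0 i) oO CF).
  have [||d d0 dP] := @strict_diff R _ (rV_coords n) (fun x => F x 0 i : R^o) x0 _ _ 1 ltr01.
  - move=> v; apply: filterS (open_nbhs_nbhs (conj oO O0)) => y Oy.
    exact: Ck_derivable Ci Oy.
  - move=> v; exact: Ck_continuous (Ck_D v Ci) O0.
  pose c j := 'D_(@cvec R _ (rV_coords n) j) (fun x => F x 0 i : R^o) x0.
  exists d => //; exists (1 + \sum_j `|c j|); first by rewrite addr_ge0 // sumr_ge0.
  move=> y z yd zd; have := dP z y zd yd; rewrite mul1r -/(c _) => E.
  rewrite -(subrK (\sum_j cfun j (y - z) * c j) (_ - _)).
  apply: (le_trans (ler_normD _ _)); rewrite mulrDl mul1r; apply: lerD => //.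
  rewrite mulr_suml; apply: (le_trans (ler_norm_sum _ _ _)); apply: ler_sum => j _.
  rewrite normrM mulrC ler_wpM2l //; exact: rV_norm_coord.
pose d i := s2val (cid2 (H i)).
have d0 i : 0 < d i by rewrite /d; case: cid2.
have dP i : exists2 L : R, 0 <= L & forall y z,
    `|y - x0| < d i -> `|z - x0| < d i -> `|F y 0 i - F z 0 i| <= L * `|y - z|.
  by rewrite /d; case: cid2.
pose L i := s2val (cid2 (dP i)).
have L0 i : 0 <= L i by rewrite /L; case: cid2.
have LP i y z : `|y - x0| < d i -> `|z - x0| < d i -> `|F y 0 i - F z 0 i| <= L i * `|y - z|.
  by rewrite /L; case: cid2 => ? ? /=; exact.
have /nbhs_ballP[r1 /= r10 r1P] := open_nbhs_nbhs (conj oO O0).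
have : \forall r \near (0 : R)^'+, [/\ 0 < r, r < r1 & forall i, r < d i].
  near=> r; split; near: r.
  - exact: nbhs_right_gt.
  - exact: nbhs_right_lt.
  - by apply: filter_forall => i; exact: nbhs_right_lt.
move=> /filter_ex [r [r0 rr1 rd]].
exists r, (1 + \sum_i L i); split => //.
- by rewrite ltr_pwDl // sumr_ge0.
- by move=> y yr; apply: r1P; rewrite -ball_normE /= distrC (lt_trans yr).
move=> y z yr zr; apply: rV_norm_le.
  by rewrite mulr_ge0 // addr_ge0 // sumr_ge0.
move=> i; rewrite !mxE.
have := LP i y z (lt_trans yr (rd i)) (lt_trans zr (rd i)).
move=> /le_trans; apply; rewrite ler_wpM2r // (bigD1 i) //= addrCA lerDl.
by rewrite addr_ge0 // sumr_ge0.
Unshelve. all: by end_near. Qed.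

(** [F] is controlled only near [x0]. Truncating coordinates to a box of half-width [r / 2] makes it
    globally Lipschitz; the solution stays in the box for a short time and there solves the original
    equation. *)
Lemma ode_exists (Omega : set 'rV[R]_n) (F : 'rV[R]_n -> 'rV[R]_n) x0 :
  open Omega -> Ck 1 Omega F -> Omega x0 ->
  exists (d : R) (x : R -> 'rV[R]_n), [/\ 0 < d, x 0 = x0 &
    forall t, `|t| < d -> Omega (x t) /\ is_derive t (1 : R) x (F (x t))].
Proof.
move=> oO CF O0; have [r [L [r0 L0 rO FL]]] := Ck_lipschitz oO CF O0.
pose c (y : 'rV[R]_n) : 'rV[R]_n :=
  \row_i clamp (x0 0 i - r / 2) (x0 0 i + r / 2) (y 0 i).
have r20 : 0 < r / 2 by rewrite divr_gt0.
have cr y : `|c y - x0| < r.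
  apply: (@le_lt_trans _ _ (r / 2)); last by lra.
  apply: rV_norm_le => [|i]; first exact: ltW.
  rewrite !mxE ler_norml.
  have /(@clamp_itv _ _ _ (y 0 i)) : x0 0 i - r / 2 <= x0 0 i + r / 2 by lra.
  by move=> /andP[? ?]; apply/andP; split; lra.
have cl y z : `|c y - c z| <= `|y - z|.
  apply: rV_norm_le => // i; rewrite !mxE; apply: le_trans (clamp_lip _ _ _ _) _.
  by have := rV_norm_coord (y - z) i; rewrite !mxE.
have [|d [x [d0 x00 xD]]] := @picard_global R n (F \o c) L x0 L0.
  by move=> y z; apply: le_trans (FL _ _ (cr _) (cr _)) _; rewrite ler_pM2l.
have cx : {for 0, continuous x}.
  have [|/derivable1_diffP/differentiable_continuous //] := xD 0.
  by rewrite normr0.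
move/cvgrPdist_lt: cx => /(_ _ r20) /nbhs_ballP [e /= e0 eP].
exists (Num.min d e), x; split=> //; first by rewrite lt_min d0.
move=> t; rewrite lt_min => /andP[td te].
have xr : `|x t - x0| < r / 2.
  by rewrite distrC -x00; apply: eP; rewrite -ball_normE /= sub0r normrN.
have cxt : c (x t) = x t.
  apply/rowP => i; rewrite mxE; apply: clamp_id.
  have := rV_norm_coord (x t - x0) i; rewrite !mxE => /le_lt_trans/(_ xr).
  by rewrite ltr_norml => /andP[? ?]; apply/andP; split; lra.
split; first by apply: rO; lra.
by rewrite -[in F _]cxt; exact: xD.
Qed.

(** Two solutions are at distance at most [2 r], and the mean value inequality halves any such bound
    because [L d <= 1/2]. *)
Lemma ode_unique (F : 'rV[R]_n -> 'rV[R]_n) x0 (r L d : R) (x y : R -> 'rV[R]_n) :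
  (forall y z, `|y - x0| < r -> `|z - x0| < r -> `|F y - F z| <= L * `|y - z|) ->
  0 <= L -> L * d <= 2^-1 ->
  (forall t, `|t| < d -> `|x t - x0| < r /\ is_derive t (1 : R) x (F (x t))) ->
  (forall t, `|t| < d -> `|y t - x0| < r /\ is_derive t (1 : R) y (F (y t))) ->
  x 0 = y 0 -> forall t, `|t| < d -> x t = y t.
Proof.
move=> FL L0 Ld xP yP xy0 t td.
have close k s : `|s| < d -> `|x s - y s| <= (2 * r) / 2 ^+ k.
  elim: k s => [|k IH] s sd.
    have [xr _] := xP s sd; have [yr _] := yP s sd.
    rewrite expr0 divr1 -(subrKA x0); apply: (le_trans (ler_normD _ _)).
    by rewrite (distrC x0); lra.
  have := @mean_value_rV R n (x \- y) (fun t => F (x t) - F (y t)) (L * (2 * r / 2 ^+ k)) s.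
  rewrite /= xy0 subrr subr0 => H; apply: le_trans (H _) _ => [u us|].
    have ud := le_lt_trans us sd.
    have [xr dx] := xP u ud; have [yr dy] := yP u ud.
    split; first exact: is_deriveB.
    by apply: (le_trans (FL _ _ xr yr)); rewrite ler_wpM2l //; exact: IH.
  have K0 : 0 <= 2 * r / 2 ^+ k by apply: le_trans (IH s sd).
  rewrite exprSr invfM [leRHS]mulrA; move: K0; set K := 2 * r / _ => K0.
  rewrite -mulrA (mulrC K) mulrA mulrC ler_wpM2l //.
  by apply: le_trans Ld; rewrite ler_wpM2l // ltW.
apply/eqP; rewrite -subr_eq0 -normr_le0; apply/ler_addgt0Pl => e e0; rewrite addr0.
have z1 : `|2^-1 : R| < 1 by rewrite ger0_norm ?invf_lt1 ?ltr1n ?ltr0n.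
have /cvgrPdist_lt/(_ e e0) [k _ /(_ k (leqnn k))] := @cvg_geometric R (2 * r) _ z1.
rewrite /= sub0r normrN exprVn => H; apply: le_trans (close k t td) _.
exact: le_trans (ler_norm _) (ltW H).
Qed.

(** Bootstrap: if [x] is C^k, so is [F \o x], which is the derivative of [x]. *)
Lemma ode_smooth (Omega : set 'rV[R]_n) (F : 'rV[R]_n -> 'rV[R]_n)
    (A : set R^o) (x : R^o -> 'rV[R]_n) :
  open Omega -> smooth_on Omega F -> open A ->
  (forall t, A t -> Omega (x t) /\ is_derive t (1 : R) x (F (x t))) ->
  smooth_on A x.
Proof.
move=> oO CF oA H; have dx t : A t -> differentiable x t.
  by move=> /H[_ [/derivable1_diffP]].
have cx t : A t -> {for t, continuous x} by move=> /dx/differentiable_continuous.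
elim=> [|k IH]; split=> // v; split=> [t /dx|]; first exact: diff_derivable.
have CFx : Ck k A (fun t => F (x t)).
  by apply: (Ck_comp oA oO (CF k) IH) => t /H[].
apply: (Ck_eq oA _ (Ck_lin_comp (L := *:%R v) (@scaler_continuous _ _ v) oA CFx)) => t At.
have [_ [_ <-]] := H t At.
rewrite !deriveE; [|exact: dx..].
transitivity ('d x t (v *: (1 : R^o))); first by rewrite [RHS]linearZ_LR.
by rewrite [_ *: _]mulr1.
Qed.

End LocalODE.

(** * Charts and differentials *)

Lemma open_preimage_on {X Y : topologicalType} (f : X -> Y) (A : set X) (B : set Y) :
  open A -> open B -> (forall x, A x -> {for x, continuous f}) ->
  open [set x | A x /\ B (f x)].
Proof.
rewrite !openE => oA oB cf x [Ax Bfx].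
have H1 := oA _ Ax; have H2 : nbhs x (f @^-1` B) := cf x Ax _ (oB _ Bfx).
by apply: filterS (filterI H1 H2) => y [].
Qed.

Section Charts.
Context {R : realType} {n : nat} {M : manifoldType R n}.
Implicit Types (p q r x : M) (u v w : 'rV[R]_n).

Definition cimg p : set 'rV[R]_n := chart p @` chart_dom p.

Lemma cimg_open p : open (cimg p). Proof. exact: chart_img_open. Qed.

Lemma cimg_chart p x : chart_dom p x -> cimg p (chart p x).
Proof. by exists x. Qed.

Lemma cimg_self p : cimg p (chart p p).
Proof. exact/cimg_chart/chart_dom_mem. Qed.

Lemma cimg_inv p u : cimg p u -> chart_dom p (chart_inv p u).
Proof. by move=> [x px <-]; rewrite chartK. Qed.

Lemma chart_invK p u : cimg p u -> chart p (chart_inv p u) = u.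
Proof. by move=> [x px <-]; rewrite chartK. Qed.

Lemma chart_inv_cont p u : cimg p u -> {for u, continuous (chart_inv p)}.
Proof. by move=> [x px <-]; exact: chart_inv_continuous. Qed.

Lemma chart_setE p (B : set M) :
  chart p @` (chart_dom p `&` B) = [set u | cimg p u /\ B (chart_inv p u)].
Proof.
apply/seteqP; split=> u /=; first by move=> [x [px Bx] <-]; rewrite chartK //; split=> //; exact: cimg_chart.
move=> [pu Bu]; exists (chart_inv p u); last exact: chart_invK.
by split=> //; exact: cimg_inv.
Qed.

Definition tdom p q : set 'rV[R]_n := [set u | cimg p u /\ chart_dom q (chart_inv p u)].
Definition trans p q : 'rV[R]_n -> 'rV[R]_n := chart q \o chart_inv p.

Lemma tdom_open p q : open (tdom p q).
Proof.
apply: open_preimage_on; [exact: cimg_open|exact: chart_dom_open|exact: chart_inv_cont].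
Qed.

Lemma tdom_chart p q x : chart_dom p x -> chart_dom q x -> tdom p q (chart p x).
Proof. by move=> px qx; split; [exact: cimg_chart|rewrite /= chartK]. Qed.

Lemma trans_smooth p q : smooth_on (tdom p q) (trans p q).
Proof. by have := @chart_smooth R n M p q; rewrite chart_setE. Qed.

Lemma trans_diff p q x : chart_dom p x -> chart_dom q x ->
  differentiable (trans p q) (chart p x).
Proof.
move=> px qx.
exact: (Ck_differentiable (k := 0) (@tdom_open p q) (@trans_smooth p q 1) (tdom_chart px qx)).
Qed.

End Charts.
Arguments cimg_open {R n M} p.
Arguments tdom_open {R n M} p q.
Arguments trans_smooth {R n M} p q.

(* Locked, here and below, because a failing conversion between two directional
   derivatives unfolds them down to limits of filters. *)
HB.lock Definition Jac {R : realType} {n : nat} {M : manifoldType R n} (p q : M)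
  (u v : 'rV[R]_n) : 'rV[R]_n := 'D_v (trans p q) u.

Section Jacobian.
Context {R : realType} {n : nat} {M : manifoldType R n}.
Implicit Types (p q r x : M) (u v w : 'rV[R]_n).

Lemma JacE p q u v : Jac p q u v = 'D_v (trans p q) u.
Proof. by rewrite Jac.unlock. Qed.

Lemma Jac_id p x v : chart_dom p x -> Jac p p (chart p x) v = v.
Proof.
move=> px; rewrite JacE -[RHS](derive_id (chart p x) v).
apply: near_eq_derive; apply: filterS (open_nbhs_nbhs (conj (cimg_open p) (cimg_chart px))).
by move=> u pu; exact: chart_invK.
Qed.

Lemma Jac_comp p q r x v : chart_dom p x -> chart_dom q x -> chart_dom r x ->
  Jac q r (chart q x) (Jac p q (chart p x) v) = Jac p r (chart p x) v.
Proof.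
move=> px qx rx.
have D : is_derive (chart p x) v (trans q r \o trans p q)
    ('D_('D_v (trans p q) (chart p x)) (trans q r) (trans p q (chart p x))).
  apply: is_derive_chain; last exact/diff_derivable/trans_diff.
  by rewrite /trans /= chartK //; exact: trans_diff.
have tE : trans p q (chart p x) = chart q x by rewrite /trans /= chartK.
rewrite tE in D; rewrite !JacE; case: D => _ <-; apply: near_eq_derive.
apply: filterS (open_nbhs_nbhs (conj (tdom_open p q) (tdom_chart px qx))) => u [pu qu].
by rewrite /trans /= chartK.
Qed.

Lemma JacK p q x v : chart_dom p x -> chart_dom q x ->
  Jac q p (chart q x) (Jac p q (chart p x) v) = v.
Proof. by move=> px qx; rewrite Jac_comp // Jac_id. Qed.

End Jacobian.

Section LocalRep.
Context {R : realType} {m n : nat} {M : manifoldType R m} {N : manifoldType R n}.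
Implicit Types (f : M -> N) (p x : M) (q : N).

Definition lrep f p q : 'rV[R]_m -> 'rV[R]_n := chart q \o f \o chart_inv p.
Definition ldom f p q : set 'rV[R]_m :=
  [set u | cimg p u /\ chart_dom q (f (chart_inv p u))].

Lemma ldom_open f p q : continuous f -> open (ldom f p q).
Proof.
move=> cf; apply: (open_preimage_on (f := f \o chart_inv p) (B := chart_dom q)).
- exact: cimg_open.
- exact: chart_dom_open.
- by move=> u pu; apply: continuous_comp; [exact: chart_inv_cont|exact: cf].
Qed.

Lemma ldom_chart f p q x : chart_dom p x -> chart_dom q (f x) -> ldom f p q (chart p x).
Proof. by move=> px qx; split; [exact: cimg_chart|rewrite /= chartK]. Qed.

Lemma lrep_smooth f p q : smooth_map f -> smooth_on (ldom f p q) (lrep f p q).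
Proof. by move=> [_ /(_ p q)]; rewrite chart_setE. Qed.

Lemma lrep_diff f p q x : smooth_map f -> chart_dom p x -> chart_dom q (f x) ->
  differentiable (lrep f p q) (chart p x).
Proof.
move=> sf px qx; exact: (Ck_differentiable (k := 0) (@ldom_open f p q (proj1 sf)) (@lrep_smooth f p q sf 1) (ldom_chart px qx)).
Qed.

(** [dmap] is tied to the charts attached to [x] and [f x]; this reads it in arbitrary charts [p]
    and [q], by writing the same map in two ways near [x]. *)
Lemma dmap_lrep f p q x v : smooth_map f -> chart_dom p x -> chart_dom q (f x) ->
  'D_(Jac x p (chart x x) v) (lrep f p q) (chart p x) =
  Jac (f x) q (chart (f x) (f x)) (dmap f x v).
Proof.
move=> sf px qx.
have xx := chart_dom_mem x; have fx := chart_dom_mem (f x).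
have E1 : is_derive (chart x x) v (lrep f p q \o trans x p)
    ('D_(Jac x p (chart x x) v) (lrep f p q) (chart p x)).
  have -> : chart p x = trans x p (chart x x) by rewrite /trans /= chartK.
  rewrite JacE.
  apply: is_derive_chain; last exact/diff_derivable/trans_diff.
  by rewrite /trans /= chartK //; exact: lrep_diff.
have E2 : is_derive (chart x x) v (trans (f x) q \o lrep f x (f x))
    (Jac (f x) q (chart (f x) (f x)) (dmap f x v)).
  have -> : chart (f x) (f x) = lrep f x (f x) (chart x x) by rewrite /lrep /= chartK.
  rewrite JacE.
  apply: is_derive_chain; last exact/diff_derivable/lrep_diff.
  by rewrite /lrep /= chartK //; exact: trans_diff.
case: E1 => _ <-; case: E2 => _ <-; apply: near_eq_derive.
have H1 := open_nbhs_nbhs (conj (tdom_open x p) (tdom_chart xx px)).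
have H2 := open_nbhs_nbhs (conj (@ldom_open f x (f x) (proj1 sf)) (ldom_chart xx fx)).
apply: filterS (filterI H1 H2) => u [[xu pu] [_ fu]].
by rewrite /lrep /trans /= !chartK.
Qed.

End LocalRep.
Arguments ldom_open {R m n M N} f p q.
Arguments lrep_smooth {R m n M N} f p q.

(** * The metric in a chart and the Euler-Lagrange expression *)

HB.lock Definition mform {R : realType} {n : nat} (A : 'M[R]_n) (v w : 'rV[R]_n) : R :=
  (v *m A *m w^T) 0 0.

Section MatrixForm.
Context {R : realType} {n : nat}.
Implicit Types (A : 'M[R]_n) (v w : 'rV[R]_n).

Lemma mformM A v w : mform A v w = (v *m A *m w^T) 0 0.
Proof. by rewrite mform.unlock. Qed.
Lemma mformE A v w : mform A v w = \sum_i \sum_j A i j * v 0 i * w 0 j.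
Proof.
rewrite mformM mxE exchange_big /=; apply: eq_bigr => j _.
rewrite !mxE mulr_suml; apply: eq_bigr => i _; by rewrite (mulrC (A i j)).
Qed.

Lemma mformDl A u v w : mform A (u + v) w = mform A u w + mform A v w.
Proof. by rewrite !mformM !mulmxDl mxE. Qed.
Lemma mformDr A u v w : mform A w (u + v) = mform A w u + mform A w v.
Proof. by rewrite !mformM linearD /= mulmxDr mxE. Qed.
Lemma mformZl A a v w : mform A (a *: v) w = a * mform A v w.
Proof. by rewrite !mformM -!scalemxAl mxE. Qed.
Lemma mformZr A a v w : mform A w (a *: v) = a * mform A w v.
Proof. by rewrite !mformM linearZ /= -scalemxAr mxE. Qed.
Lemma mformNr A v w : mform A w (- v) = - mform A w v.
Proof. by rewrite -scaleN1r mformZr mulN1r. Qed.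
Lemma mformBr A u v w : mform A w (u - v) = mform A w u - mform A w v.
Proof. by rewrite mformDr mformNr. Qed.
Lemma mform0l A w : mform A 0 w = 0.
Proof. by rewrite -(scale0r 0) mformZl mul0r. Qed.
Lemma mform0r A w : mform A w 0 = 0.
Proof. by rewrite -(scale0r 0) mformZr mul0r. Qed.
Lemma mform_sym A v w : A^T = A -> mform A v w = mform A w v.
Proof.
move=> AT; rewrite !mformM -[in LHS]AT.
have -> : v *m A^T *m w^T = (w *m A *m v^T)^T by rewrite !trmx_mul trmxK mulmxA.
by rewrite mxE.
Qed.
Lemma mform_addm A B v w : mform (A + B) v w = mform A v w + mform B v w.
Proof. by rewrite !mformM mulmxDr mulmxDl mxE. Qed.
Lemma mform_scalem a A v w : mform (a *: A) v w = a * mform A v w.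
Proof. by rewrite !mformM -scalemxAr -scalemxAl mxE. Qed.
Lemma is_derive_mform {V : normedModType R} (A : V -> 'M[R]_n) (v w : V -> 'rV[R]_n)
    (dA : 'M[R]_n) (dv dw : 'rV[R]_n) (x z : V) :
  (forall i j, is_derive x z (fun y => A y i j : R^o) (dA i j)) ->
  is_derive x z v dv -> is_derive x z w dw ->
  is_derive x z (fun y => mform (A y) (v y) (w y) : R^o)
    (mform dA (v x) (w x) + mform (A x) dv (w x) + mform (A x) (v x) dw).
Proof.
move=> hA /is_derive_rVP hv /is_derive_rVP hw.
have -> : (fun y => mform (A y) (v y) (w y) : R^o) =
    \sum_(i < n) \sum_(j < n) (fun y => A y i j * v y 0 i * w y 0 j : R^o).
  apply/funext => y; rewrite mformE fct_sumE; apply: eq_bigr => i _.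
  by rewrite fct_sumE.
rewrite !mformE -!big_split /=.
have H i j : is_derive x z (fun y => A y i j * v y 0 i * w y 0 j : R^o)
   (dA i j * v x 0 i * w x 0 j + A x i j * dv 0 i * w x 0 j + A x i j * v x 0 i * dw 0 j).
  apply: (is_derive_eq (is_deriveM (is_deriveM (hA i j) (hv i)) (hw j))).
  rewrite /GRing.scale /= -[X in X * dw 0 j]/(A x i j * v x 0 i); ring.
apply: is_derive_eq; last by apply: eq_bigr => i _; rewrite -!big_split.
Qed.

End MatrixForm.

Section LinearProps.
Context {R : realType} {V W : lmodType R} (f : V -> W).
Hypothesis lf : linear f.
Lemma linear_propD x y : f (x + y) = f x + f y.
Proof. by have := lf 1 x y; rewrite !scale1r. Qed.
Lemma linear_prop0 : f 0 = 0.
Proof. by have := linear_propD 0 0; rewrite addr0 -{1}[f 0]addr0 => /addrI. Qed.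
Lemma linear_propZ a x : f (a *: x) = a *: f x.
Proof. by have := lf a x 0; rewrite linear_prop0 !addr0. Qed.
Lemma linear_propN x : f (- x) = - f x.
Proof. by rewrite -(scaleN1r x) linear_propZ scaleN1r. Qed.
Lemma linear_propB x y : f (x - y) = f x - f y.
Proof. by rewrite linear_propD linear_propN. Qed.
Lemma linear_prop_sum I (r : seq I) (F : I -> V) :
  f (\sum_(i <- r) F i) = \sum_(i <- r) f (F i).
Proof.
by elim/big_rec2: _ => [|i a b _ <-]; [exact: linear_prop0|exact: linear_propD].
Qed.
End LinearProps.

Lemma linear_rV_delta {R : realType} {n : nat} (f : 'rV[R]_n -> R^o) :
  linear f -> forall w, f w = \sum_j w 0 j * f (delta_mx 0 j).
Proof.
move=> lf w; rewrite {1}(row_sum_delta w) (linear_prop_sum lf).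
by apply: eq_bigr => j _; rewrite (linear_propZ lf).
Qed.

HB.lock Definition dgram {R : realType} {n : nat} {M : manifoldType R n}
    (g : riemannian_metric M) (p : M) (u z : 'rV[R]_n) : 'M[R]_n :=
  \matrix_(i, j) 'D_z (fun w => gram g p w i j : R^o) u.

Section MetricCharts.
Context {R : realType} {n : nat} {M : manifoldType R n}.
Variable g : riemannian_metric M.
Implicit Types (p q x : M) (u v w z : 'rV[R]_n).

Lemma metricDl p u v w : g p (u + v) w = g p u w + g p v w.
Proof. by rewrite -[u]scale1r metric_linear mul1r scale1r. Qed.
Lemma metric0l p w : g p 0 w = 0.
Proof. by have := metricDl p 0 0 w; rewrite addr0; lra. Qed.
Lemma metricZl p a v w : g p (a *: v) w = a * g p v w.
Proof. by rewrite -[a *: v]addr0 metric_linear metric0l addr0. Qed.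
Lemma metric_suml p I (r : seq I) (f : I -> 'rV[R]_n) w :
  g p (\sum_(i <- r) f i) w = \sum_(i <- r) g p (f i) w.
Proof.
by elim/big_rec2: _ => [|i y1 y2 _ <-]; [exact: metric0l|exact: metricDl].
Qed.
Lemma metricDr p u v w : g p w (u + v) = g p w u + g p w v.
Proof. by rewrite !(Defs.metric_sym g p w) metricDl. Qed.
Lemma metricZr p a v w : g p w (a *: v) = a * g p w v.
Proof. by rewrite !(Defs.metric_sym g p w) metricZl. Qed.
Lemma metric_sumr p I (r : seq I) (f : I -> 'rV[R]_n) w :
  g p w (\sum_(i <- r) f i) = \sum_(i <- r) g p w (f i).
Proof.
by rewrite Defs.metric_sym metric_suml; apply: eq_bigr => i _; exact: Defs.metric_sym.
Qed.

Lemma metric_polarization p v w :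
  g p v w = 2^-1 * (g p (v + w) (v + w) - g p v v - g p w w).
Proof. by rewrite metricDl !metricDr (Defs.metric_sym g p w v); lra. Qed.

(** Expanding in coordinate fields shows that [gram], in whatever chart, is the pullback of the one
    form [g x] by the Jacobian. *)
Lemma gram_metric p x v w : chart_dom p x ->
  mform (gram g p (chart p x)) v w =
  g x (Jac p x (chart p x) v) (Jac p x (chart p x) w).
Proof.
move=> px; have xx := chart_dom_mem x.
have dJ := trans_diff px xx.
have JE y : Jac p x (chart p x) y = \sum_i y 0 i *: Jac p x (chart p x) (delta_mx 0 i).
  by rewrite JacE (derive_coords _ dJ); apply: eq_bigr => i _; rewrite JacE.
rewrite (JE v) (JE w) metric_suml mformE; apply: eq_bigr => i _.
rewrite metricZl metric_sumr mulr_sumr; apply: eq_bigr => j _.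
by rewrite metricZr [gram _ _ _ i j]mxE /coord_field chartK //= !JacE; ring.
Qed.

Lemma gram_change p q x v w : chart_dom p x -> chart_dom q x ->
  mform (gram g p (chart p x)) v w =
  mform (gram g q (chart q x)) (Jac p q (chart p x) v) (Jac p q (chart p x) w).
Proof.
move=> px qx; have xx := chart_dom_mem x.
by rewrite !gram_metric // !Jac_comp.
Qed.

Lemma metric_gram p x v w : chart_dom p x ->
  g x v w = mform (gram g p (chart p x)) (Jac x p (chart x x) v) (Jac x p (chart x x) w).
Proof.
move=> px; have xx := chart_dom_mem x.
by rewrite gram_metric // !JacK.
Qed.

Lemma gram_tr p u : (gram g p u)^T = gram g p u.
Proof. by apply/matrixP => i j; rewrite !mxE; exact: Defs.metric_sym. Qed.

Lemma gram_pos p u v : cimg p u -> v != 0 -> 0 < mform (gram g p u) v v.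
Proof.
move=> pu v0; have px := cimg_inv pu; have xx := chart_dom_mem (chart_inv p u).
rewrite -(chart_invK pu) gram_metric //; apply: Defs.metric_pos.
apply: contra_neq v0 => J0.
by have <- := JacK v px xx; rewrite J0 JacE derive0.
Qed.

Lemma gram_unit p u : cimg p u -> gram g p u \in unitmx.
Proof.
move=> pu; rewrite -row_free_unit -kermx_eq0; apply/eqP/row_matrixP => i.
apply/eqP; apply/negP => /negP; rewrite row0 => k0.
have := gram_pos pu k0; rewrite mformM.
have /sub_kermxP -> : (row i (kermx (gram g p u)) <= kermx (gram g p u))%MS by exact: row_sub.
by rewrite mul0mx mxE ltxx.
Qed.

Lemma gram_smooth p i j : smooth_on (cimg p) (fun u => gram g p u i j : R^o).
Proof. exact: metric_smooth. Qed.

Lemma dgramij p u z i j : dgram g p u z i j = 'D_z (fun w => gram g p w i j : R^o) u.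
Proof. by rewrite dgram.unlock mxE. Qed.

Lemma gram_diff p u i j : cimg p u -> differentiable (fun w => gram g p w i j : R^o) u.
Proof.
move=> pu; exact: (Ck_differentiable (k := 0) (@cimg_open _ _ _ p) (@gram_smooth p i j 1) pu).
Qed.

Lemma dgramE p u z i j : cimg p u ->
  dgram g p u z i j = \sum_k z 0 k * 'D_(delta_mx 0 k) (fun w => gram g p w i j : R^o) u.
Proof. by move=> pu; rewrite dgramij (derive_coords _ (gram_diff i j pu)). Qed.

Lemma dgram_linear p u i j : cimg p u ->
  linear (fun z => dgram g p u z i j : R^o).
Proof.
move=> pu.
have H := derive_linear (gram_diff i j pu).
have E : (fun z => dgram g p u z i j : R^o) = (fun z => 'D_z (fun w => gram g p w i j : R^o) u).
  by apply/funext => z; exact: dgramij.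
by rewrite E.
Qed.

Lemma dgramD p u y z : cimg p u -> dgram g p u (y + z) = dgram g p u y + dgram g p u z.
Proof.
move=> pu; apply/matrixP => i j; rewrite [RHS]mxE.
exact: (linear_propD (dgram_linear i j pu)).
Qed.
Lemma dgramZ p u a z : cimg p u -> dgram g p u (a *: z) = a *: dgram g p u z.
Proof.
move=> pu; apply/matrixP => i j; rewrite [RHS]mxE.
exact: (linear_propZ (dgram_linear i j pu)).
Qed.

Lemma is_derive_gram_chain (V : normedModType R) p (f : V -> 'rV[R]_n) (x z : V) df i j :
  cimg p (f x) -> is_derive x z f df ->
  is_derive x z (fun y => gram g p (f y) i j : R^o) (dgram g p (f x) df i j).
Proof.
move=> pf [df1 <-]; rewrite dgramij.
exact: (is_derive_chain (gram_diff i j pf) df1).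
Qed.

(* The Euler-Lagrange expression of the energy, paired with [w]. *)
Definition euler_lagrange p u (v a w : 'rV[R]_n) : R :=
  mform (gram g p u) a w + mform (dgram g p u v) v w - 2^-1 * mform (dgram g p u w) v v.

(** The vector [Gamma^k_ij v^i v^j], see [spray_christoffel], obtained from the Euler-Lagrange
    covector by raising the index. It is available at every point of the chart, whereas
    [christoffel] is defined only at the point the chart is attached to. *)
Definition spray p u v : 'rV[R]_n :=
  (\row_l (mform (dgram g p u v) v (delta_mx 0 l) -
           2^-1 * mform (dgram g p u (delta_mx 0 l)) v v)) *m invmx (gram g p u).

Lemma spray_gram p u v w : cimg p u ->
  mform (gram g p u) (spray p u v) w =
  mform (dgram g p u v) v w - 2^-1 * mform (dgram g p u w) v v.
Proof.
move=> pu; rewrite {1}mformM /spray mulmxKV ?gram_unit // mxE.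
have l1 : linear (fun w => mform (dgram g p u v) v w : R^o).
  by move=> a y z; rewrite mformDr mformZr.
have l2 : linear (fun w => mform (dgram g p u w) v v : R^o).
  by move=> a y z; rewrite dgramD // dgramZ // mform_addm mform_scalem.
have E1 := linear_rV_delta l1 w.
have E2 := linear_rV_delta l2 w.
cbv beta in E1, E2.
rewrite E1.
rewrite E2.
rewrite mulr_sumr -sumrB.
apply: eq_bigr => j _.
rewrite [X in X * _]mxE.
rewrite [w^T j 0]mxE.
by ring.
Qed.

(** After contraction with [v] twice, the terms [dg i j l] and [dg j i l] coincide, so the factor
    1/2 leaves one copy of them and minus half of the third term. *)
Lemma spray_christoffel p v :
  \row_k \sum_i \sum_j christoffel g p k i j * v 0 i * v 0 j =
  spray p (chart p p) v.
Proof.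
set u := chart p p; have pu : cimg p u by exact: cimg_self.
apply/rowP => k; rewrite mxE [RHS]mxE.
pose dg a b c := 'D_(delta_mx 0 a) (fun w => gram g p w b c : R^o) u.
have chE i j : christoffel g p k i j = 2^-1 * \sum_l invmx (gram g p u) k l *
   (dg i j l + dg j i l - dg l i j) by [].
have invT l : invmx (gram g p u) l k = invmx (gram g p u) k l.
  by rewrite -[in LHS](gram_tr p u) -trmx_inv mxE.
under eq_bigr => i _ do under eq_bigr => j _ do rewrite chE mulr_sumr !mulr_suml.
under eq_bigr => i _ do rewrite exchange_big /=.
rewrite exchange_big /=; apply: eq_bigr => l _; rewrite mxE invT.
rewrite !mformE.
have -> : \sum_i \sum_j dgram g p u v i j * v 0 i * (delta_mx 0 l : 'rV[R]_n) 0 j =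
   \sum_i \sum_j dg j i l * v 0 i * v 0 j.
  apply: eq_bigr => i _; rewrite (bigD1 l) //= big1 ?addr0; last first.
    by move=> j jl; rewrite mxE eqxx (negbTE jl) mulr0.
  rewrite mxE !eqxx mulr1 dgramE // mulr_suml; apply: eq_bigr => j _.
  by rewrite -/(dg j i l); ring.
have E : \sum_i \sum_j dg j i l * v 0 i * v 0 j = \sum_i \sum_j dg i j l * v 0 i * v 0 j.
  by rewrite exchange_big; do 2 apply: eq_bigr => ? _; ring.
rewrite mulrBl.
have -> : (\sum_i \sum_j dg j i l * v 0 i * v 0 j) =
   2^-1 * (\sum_i \sum_j dg j i l * v 0 i * v 0 j) + 2^-1 * (\sum_i \sum_j dg i j l * v 0 i * v 0 j).
  by rewrite -E; lra.
have -> : \sum_i \sum_j dgram g p u (delta_mx 0 l) i j * v 0 i * v 0 j =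
    \sum_i \sum_j dg l i j * v 0 i * v 0 j.
  by do 2 (apply: eq_bigr => ? _); rewrite dgramij.
rewrite -mulrDr -mulrBl -mulrBr -big_split -sumrB mulr_sumr mulr_suml.
apply: eq_bigr => i _; rewrite -big_split -sumrB mulr_sumr mulr_suml.
by apply: eq_bigr => j _ /=; ring.
Qed.

Lemma EL_spray p u v a w : cimg p u ->
  euler_lagrange p u v a w = mform (gram g p u) (a + spray p u v) w.
Proof. by move=> pu; rewrite mformDl spray_gram // addrA. Qed.

(** If nonzero, [a + spray p u v] would pair positively with itself. *)
Lemma EL_eq0 p u v a : cimg p u ->
  (forall w, euler_lagrange p u v a w = 0) -> a + spray p u v = 0.
Proof.
move=> pu H; apply/eqP; apply/negPn/negP => k0.
by have := gram_pos pu k0; rewrite -EL_spray // H ltxx.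
Qed.

End MetricCharts.

Section ScaleDerive.
Context {R : realType} {V : normedModType R} {n : nat}.

Lemma is_derive_scale (k : V -> R^o) (f : V -> 'rV[R]_n) x v dk df :
  is_derive x v k dk -> is_derive x v f df ->
  is_derive x v (fun y => k y *: f y) (k x *: df + dk *: f x).
Proof.
move=> hk /is_derive_rVP hf; apply/is_derive_rVP => i.
have -> : (fun s => (k s *: f s) 0 i : R^o) = (fun s => k s * f s 0 i).
  by apply/funext => s; rewrite mxE.
apply: (is_derive_eq (is_deriveM hk (hf i))).
by rewrite !mxE /GRing.scale /= [f x 0 i * _]mulrC.
Qed.

Lemma is_derive_sumE (I : Type) (r : seq I) (f : I -> V -> 'rV[R]_n) (df : I -> 'rV[R]_n) x v :
  (forall i, is_derive x v (f i) (df i)) ->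
  is_derive x v (fun y => \sum_(i <- r) f i y) (\sum_(i <- r) df i).
Proof.
move=> H; elim: r => [|i r IH].
  rewrite big_nil (_ : (fun _ => _) = cst 0); first exact: is_derive_cst.
  by apply/funext => y; rewrite big_nil.
rewrite big_cons (_ : (fun _ => _) = f i + (fun y => \sum_(i <- r) f i y)).
  exact: is_deriveD.
by apply/funext => y; rewrite big_cons.
Qed.

End ScaleDerive.

(** * Covariance of the Euler-Lagrange expression *)

HB.lock Definition Hess {R : realType} {n : nat} {M : manifoldType R n} (p q : M)
  (u z w : 'rV[R]_n) : 'rV[R]_n := 'D_z (fun u => Jac p q u w) u.

Section Covariance.
Context {R : realType} {n : nat} {M : manifoldType R n}.
Variable g : riemannian_metric M.
Implicit Types (p q x : M) (u v w z : 'rV[R]_n).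

Lemma HessE p q u z w : Hess p q u z w = 'D_z (fun u => Jac p q u w) u.
Proof. by rewrite Hess.unlock. Qed.

Lemma Jac_smooth p q w : smooth_on (tdom p q) (fun u => Jac p q u w).
Proof.
move=> k; have -> : (fun u => Jac p q u w) = (fun u => 'D_w (trans p q) u).
  by apply/funext => u; exact: JacE.
by apply: Ck_D; exact: trans_smooth.
Qed.

Lemma Jac_diff p q u w : tdom p q u -> differentiable (fun u => Jac p q u w) u.
Proof.
move=> pqu.
exact: (Ck_differentiable (k := 0) (tdom_open p q) (@Jac_smooth p q w 1) pqu).
Qed.

Lemma Hess_sym p q u z w : tdom p q u -> Hess p q u z w = Hess p q u w z.
Proof.
move=> pqu; have JE y : (fun u => Jac p q u y) = (fun u => 'D_y (trans p q) u).
  by apply/funext => u'; exact: JacE.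
rewrite !HessE (JE w) (JE z).
exact: (schwarz z w (tdom_open p q) (trans_smooth p q 2) pqu).
Qed.

Lemma Hess_linearl p q u w : tdom p q u -> linear (fun z => Hess p q u z w).
Proof.
move=> pqu; have -> : (fun z => Hess p q u z w) = (fun z => 'D_z (fun u => Jac p q u w) u).
  by apply/funext => z; exact: HessE.
exact: derive_linear (Jac_diff w pqu).
Qed.

Lemma Hess_linearr p q u w : tdom p q u -> linear (Hess p q u w).
Proof.
move=> pqu; have -> : Hess p q u w = (fun z => Hess p q u z w).
  by apply/funext => z; exact: Hess_sym.
exact: Hess_linearl.
Qed.

Lemma is_derive_Jac p q u z w : tdom p q u ->
  is_derive u z (fun u => Jac p q u w) (Hess p q u z w).
Proof.
move=> pqu; rewrite HessE; apply/derivableP/diff_derivable; exact: Jac_diff.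
Qed.

Lemma tdom_diff p q u : tdom p q u -> differentiable (trans p q) u.
Proof.
move=> pqu; exact: (Ck_differentiable (k := 0) (tdom_open p q) (@trans_smooth _ _ _ p q 1) pqu).
Qed.

Lemma Jac_linear_in p q u : tdom p q u -> linear (Jac p q u).
Proof.
move=> pqu a v w; rewrite !JacE; exact: (derive_linear (tdom_diff pqu) a v w).
Qed.

Lemma linear_rV_sum (W : lmodType R) (f : 'rV[R]_n -> W) : linear f ->
  forall w, f w = \sum_j w 0 j *: f (delta_mx 0 j).
Proof.
move=> lf w; rewrite {1}(row_sum_delta w) (linear_prop_sum lf).
by apply: eq_bigr => j _; rewrite (linear_propZ lf).
Qed.

(** Expanding [v s] in the fixed basis separates the motion of the base point from that of the
    vector. For [v] the velocity of [f], this is the transformation rule of second derivatives. *)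
Lemma is_derive_Jac_curve p q (f v : R -> 'rV[R]_n) (t : R) df dv :
  tdom p q (f t) -> is_derive t (1 : R) f df -> is_derive t (1 : R) v dv ->
  (\forall s \near t, tdom p q (f s)) ->
  is_derive t (1 : R) (fun s => Jac p q (f s) (v s))
    (Jac p q (f t) dv + Hess p q (f t) df (v t)).
Proof.
move=> pqf hf hv nf.
have H j : is_derive t (1 : R) (fun s => v s 0 j *: Jac p q (f s) (delta_mx 0 j))
    (v t 0 j *: Hess p q (f t) df (delta_mx 0 j) + dv 0 j *: Jac p q (f t) (delta_mx 0 j)).
  apply: (@is_derive_scale R R^o n (fun s => v s 0 j)).
    by move/is_derive_rVP: hv; exact.
  have [df1 dfE] := hf; rewrite -dfE HessE.
  exact: (is_derive_chain (Jac_diff (delta_mx 0 j) pqf) df1).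
have D := is_derive_sumE (index_enum 'I_n) H.
rewrite big_split /= -(linear_rV_sum (Hess_linearr df pqf)) in D.
rewrite -(linear_rV_sum (Jac_linear_in pqf)) addrC in D.
apply: near_eq_is_derive D.
by apply: filterS nf => s pqs; rewrite -(linear_rV_sum (Jac_linear_in pqs)).
Qed.

(** Differentiate [gram_change] along [s]; the Hessian terms record that the Jacobian depends on the
    point. *)
Lemma dgram_change p q x s y z : chart_dom p x -> chart_dom q x ->
  let u := chart p x in let J := Jac p q u in let G := gram g q (chart q x) in
  mform (dgram g p u s) y z = mform (dgram g q (chart q x) (J s)) (J y) (J z)
    + mform G (Hess p q u s y) (J z) + mform G (J y) (Hess p q u s z).
Proof.
move=> px qx u J G; have pqu : tdom p q u := tdom_chart px qx.
have tu : trans p q u = chart q x by rewrite /u /trans /= chartK.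
rewrite /G -tu.
have D1 : is_derive u s (fun w => mform (gram g p w) y z : R^o) (mform (dgram g p u s) y z).
  have -> : mform (dgram g p u s) y z =
      mform (dgram g p u s) y z + mform (gram g p u) 0 z + mform (gram g p u) y 0.
    by rewrite mform0l mform0r !addr0.
  apply: (@is_derive_mform R n 'rV[R]_n (fun w => gram g p w) (fun=> y) (fun=> z)).
  by move=> i j; apply: (@is_derive_gram_chain _ _ _ g _ p id u s s); exact: cimg_chart.
have dt : is_derive u s (trans p q) (J s).
  by rewrite /J JacE; apply/derivableP/diff_derivable; exact: tdom_diff.
have D2 : is_derive u s (fun w => mform (gram g q (trans p q w)) (Jac p q w y) (Jac p q w z) : R^o)
    (mform (dgram g q (trans p q u) (J s)) (J y) (J z)
    + mform (gram g q (trans p q u)) (Hess p q u s y) (J z)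
    + mform (gram g q (trans p q u)) (J y) (Hess p q u s z)).
  apply: (@is_derive_mform R n 'rV[R]_n (fun w => gram g q (trans p q w))
     (fun w => Jac p q w y) (fun w => Jac p q w z)).
  - move=> i j; apply: is_derive_gram_chain => //.
    by rewrite tu; exact: cimg_chart.
  - exact: is_derive_Jac.
  - exact: is_derive_Jac.
case: D1 => _ <-; case: D2 => _ <-; apply: near_eq_derive.
apply: filterS (open_nbhs_nbhs (conj (tdom_open p q) pqu)) => w [pw qw].
have := gram_change g y z (cimg_inv pw) qw; by rewrite chart_invK.
Qed.

(** The Hessian terms from the derivatives of the metric along [v] and along [w] cancel by symmetry,
    except the one in [Hess v v], which is matched by the correction to the acceleration. *)
Lemma EL_change p q x v a w : chart_dom p x -> chart_dom q x ->
  let J := Jac p q (chart p x) in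
  euler_lagrange g q (chart q x) (J v) (J a + Hess p q (chart p x) v v) (J w) =
  euler_lagrange g p (chart p x) v a w.
Proof.
move=> px qx J; have pqu := tdom_chart px qx.
rewrite /euler_lagrange (gram_change g _ _ px qx) !(dgram_change _ _ _ px qx) /=.
rewrite -/J (Hess_sym w v pqu) mformDl.
set Q := gram _ _ _.
rewrite (mform_sym (Hess _ _ _ v w) (J v) (gram_tr g q _)) -/Q.
lra.
Qed.

End Covariance.

(** * Existence of geodesics *)

Section MatrixSmooth.
Context {R : realType} {V : normedModType R}.

Lemma Ck_prod (I : Type) (r : seq I) k (A : set V) (f : I -> V -> R^o) : open A ->
  (forall i, Ck k A (f i)) -> Ck k A (fun x => \prod_(i <- r) f i x : R^o).
Proof.
move=> oA fi; elim: r => [|i r IH].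
  by apply: (Ck_eq oA _ (Ck_cst k (1 : R^o) oA)) => x _; rewrite big_nil.
by apply: (Ck_eq oA _ (CkM oA (fi i) IH)) => x _; rewrite big_cons.
Qed.

Lemma Ck_det n k (A : set V) (f : V -> 'M[R]_n) : open A ->
  (forall i j, Ck k A (fun x => f x i j : R^o)) -> Ck k A (fun x => \det (f x) : R^o).
Proof.
move=> oA fi; rewrite /determinant.
apply: (Ck_sum _ oA) => s; apply: CkM => //; first exact: Ck_cst.
exact: Ck_prod.
Qed.

(** The inverse is the adjugate divided by the determinant, hence rational in the entries. *)
Lemma Ck_invmx n k (A : set V) (f : V -> 'M[R]_n) i j : open A ->
  (forall x, A x -> f x \in unitmx) ->
  (forall i j, Ck k A (fun x => f x i j : R^o)) ->
  Ck k A (fun x => invmx (f x) i j : R^o).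
Proof.
move=> oA fu fi.
have Cd : Ck k A (fun x => (\det (f x))^-1 : R^o).
  apply: CkV => //; last exact: Ck_det.
  by move=> x /fu; rewrite unitmxE unitfE.
have Cc : Ck k A (fun x => cofactor (f x) j i : R^o).
  rewrite /cofactor; apply: CkM => //; first exact: Ck_cst.
  apply: Ck_det => // a b.
  by apply: (Ck_eq oA _ (fi (lift j a) (lift i b))) => x _; rewrite !mxE.
apply: (Ck_eq oA _ (CkM oA Cd Cc)) => x Ax.
by rewrite /invmx fu // !mxE.
Qed.

Lemma Ck_mform n k (A : set V) (f : V -> 'M[R]_n) (v w : V -> 'rV[R]_n) : open A ->
  (forall i j, Ck k A (fun x => f x i j : R^o)) -> Ck k A v -> Ck k A w ->
  Ck k A (fun x => mform (f x) (v x) (w x) : R^o).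
Proof.
move=> oA Cf Cv Cw.
have cv i : Ck k A (fun x => v x 0 i : R^o).
  exact: (Ck_lin_comp (L := rV_coord i) (@coord_continuous _ _ _ 0 i) oA Cv).
have cw i : Ck k A (fun x => w x 0 i : R^o).
  exact: (Ck_lin_comp (L := rV_coord i) (@coord_continuous _ _ _ 0 i) oA Cw).
have C : Ck k A (fun x => \sum_i \sum_j f x i j * v x 0 i * w x 0 j : R^o).
  apply: (Ck_sum _ oA) => i; apply: (Ck_sum _ oA) => j.
  by apply: CkM => //; exact: CkM.
by apply: (Ck_eq oA _ C) => x _; rewrite mformE.
Qed.

Lemma Ck_rV n k (A : set V) (f : V -> 'rV[R]_n) : open A ->
  (forall i, Ck k A (fun x => f x 0 i : R^o)) -> Ck k A f.
Proof. by move=> oA H; apply: (Ck_coords (cW := rV_coords n)). Qed.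

End MatrixSmooth.

Section Spray.
Context {R : realType} {n : nat} {M : manifoldType R n}.
Variable g : riemannian_metric M.
Implicit Types (p q x : M) (u v w z : 'rV[R]_n).

(** Phase space of the chart: a row of length [n + n] holds a position followed by an unrestricted
    velocity. *)
Definition pdom p : set 'rV[R]_(n + n) := [set X | cimg p (lsubmx X)].

Lemma lsub_cont : continuous (@lsubmx R 1 n n).
Proof. by move=> X; apply: differentiable_continuous; exact: differentiable_lsubmx. Qed.
Lemma rsub_cont : continuous (@rsubmx R 1 n n).
Proof. by move=> X; apply: differentiable_continuous; exact: differentiable_rsubmx. Qed.

Lemma pdom_open p : open (pdom p).
Proof.
have -> : pdom p = [set X | setT X /\ cimg p (lsubmx X)] by apply/seteqP; split=> X /=; [split|case].
apply: open_preimage_on; [exact: openT|exact: cimg_open|by move=> X _; exact: lsub_cont].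
Qed.

Lemma Ck_lsub k p : Ck k (pdom p) (@lsubmx R 1 n n).
Proof. exact: (Ck_lin _ lsub_cont (@pdom_open p)). Qed.
Lemma Ck_rsub k p : Ck k (pdom p) (@rsubmx R 1 n n).
Proof. exact: (Ck_lin _ rsub_cont (@pdom_open p)). Qed.

Lemma Ck_gram_lsub k p i j : Ck k (pdom p) (fun X => gram g p (lsubmx X) i j : R^o).
Proof.
exact: (Ck_comp (@pdom_open p) (cimg_open p) (gram_smooth g p i j k) (@Ck_lsub k p)).
Qed.

Lemma Ck_dgram_lsub k p (f : 'rV[R]_(n + n) -> 'rV[R]_n) i j : Ck k (pdom p) f ->
  Ck k (pdom p) (fun X => dgram g p (lsubmx X) (f X) i j : R^o).
Proof.
move=> Cf; have oP := @pdom_open p.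
have H a : Ck k (pdom p) (fun X => f X 0 a *
    'D_(delta_mx 0 a) (fun w => gram g p w i j : R^o) (lsubmx X) : R^o).
  apply: CkM => //.
    exact: (Ck_lin_comp (L := rV_coord a) (@coord_continuous _ _ _ 0 a) oP Cf).
  exact: (Ck_comp oP (cimg_open p) (Ck_D _ (gram_smooth g p i j k.+1)) (@Ck_lsub k p)).
apply: (Ck_eq oP _ (Ck_sum _ oP H)) => X pX.
by rewrite dgramE.
Qed.

Lemma Ck_spray k p :
  Ck k (pdom p) (fun X : 'rV[R]_(n + n) => spray g p (lsubmx X) (rsubmx X)).
Proof.
have oP := @pdom_open p.
pose C (l : 'I_n) (X : 'rV[R]_(n + n)) : R^o :=
  mform (dgram g p (lsubmx X) (rsubmx X)) (rsubmx X) (delta_mx 0 l) +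
   - 2^-1 * mform (dgram g p (lsubmx X) (delta_mx 0 l)) (rsubmx X) (rsubmx X).
have CC l : Ck k (pdom p) (C l).
  apply: CkD => //.
    apply: Ck_mform => //; [|exact: Ck_rsub|exact: Ck_cst].
    by move=> i j; apply: Ck_dgram_lsub; exact: Ck_rsub.
  apply: CkM => //; first exact: Ck_cst.
  apply: Ck_mform => //; [|exact: Ck_rsub|exact: Ck_rsub].
  by move=> i j; apply: Ck_dgram_lsub; exact: Ck_cst.
apply: Ck_rV => // j.
have CI l : Ck k (pdom p) (fun X => C l X * invmx (gram g p (lsubmx X)) l j : R^o).
  apply: CkM => //; apply: Ck_invmx => //; last by move=> *; exact: Ck_gram_lsub.
  by move=> X pX; exact: gram_unit.
apply: (Ck_eq oP _ (Ck_sum _ oP CI)) => X pX.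
rewrite /spray mxE; apply: eq_bigr => l _.
by rewrite mxE /C mulNr.
Qed.

End Spray.

Section GeodesicExistence.
Context {R : realType} {n : nat} {M : manifoldType R n}.
Variable g : riemannian_metric M.
Implicit Types (p q x : M) (u v w z : 'rV[R]_n).

Definition spray_field p (X : 'rV[R]_(n + n)) : 'rV[R]_(n + n) :=
  row_mx (rsubmx X) (- spray g p (lsubmx X) (rsubmx X)).

Lemma spray_field_smooth p : smooth_on (pdom p) (spray_field p).
Proof.
move=> k; have oP := @pdom_open _ _ _ p; apply: Ck_rV => // i.
have Cr : Ck k (pdom p) (fun X => - 1 *: spray g p (lsubmx X) (rsubmx X)).
  exact: (Ck_lin_comp (L := *:%R (-1)) (@scaler_continuous _ _ _) oP (Ck_spray g k p)).
case: (split_ordP i) => j ->.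
  have C := Ck_lin_comp (L := rV_coord j) (@coord_continuous _ _ _ 0 j) oP (@Ck_rsub _ _ _ k p).
  by apply: (Ck_eq oP _ C) => X _; rewrite /spray_field row_mxEl.
have C := Ck_lin_comp (L := rV_coord j) (@coord_continuous _ _ _ 0 j) oP Cr.
by apply: (Ck_eq oP _ C) => X _; rewrite /spray_field row_mxEr scaleN1r.
Qed.

(* In the single chart [p], the geodesic equation is the flow of [spray_field p]. *)
Lemma geodesic_ode p (d : R) (X : R -> 'rV[R]_(n + n)) :
  (forall t, `|t| < d -> pdom p (X t) /\ is_derive t (1 : R) X (spray_field p (X t))) ->
  geodesic g [set t | `|t| < d] (fun t => chart_inv p (lsubmx (X t))).
Proof.
move=> XD; set A := [set t : R | `|t| < d].
pose u t := lsubmx (X t); pose v t := rsubmx (X t); pose c t := chart_inv p (u t).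
have oA : open (A : set R^o).
  rewrite openE => t /= td; rewrite /A; near=> s.
  have : `|s - t| < d - `|t|.
    near: s; apply/nbhs_ballP; exists (d - `|t|); first by rewrite /= subr_gt0.
    by move=> s; rewrite -ball_normE /= distrC.
  have := ler_normD (s - t) t; rewrite subrK; move=> /=; lra.
have sX : smooth_on (V := R^o) A X.
  exact: (ode_smooth (@pdom_open _ _ _ p) (@spray_field_smooth p) oA).
have su : smooth_on (V := R^o) A u.
  by move=> k; exact: (Ck_lin_comp (L := lsubmx) lsub_cont oA (sX k)).
have pu t : A t -> cimg p (u t) by move=> /XD[].
have du t : A t -> is_derive t (1 : R) u (v t).
  move=> /XD[_ [d1 dE]]; have := derivable_lin (@lsub_cont R n) d1.
  by rewrite dE /spray_field /= row_mxKl.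
have dv t : A t -> is_derive t (1 : R) v (- spray g p (u t) (v t)).
  move=> /XD[_ [d1 dE]]; have := derivable_lin (@rsub_cont R n) d1.
  by rewrite dE /spray_field /= row_mxKr.
have cu t : A t -> {for t, continuous u}.
  by move=> /du[/derivable1_diffP/differentiable_continuous].
have cc t : A t -> {for t, continuous c}.
  move=> At; apply: continuous_comp; first exact: cu.
  exact: chart_inv_cont (pu t At).
pose B q : set R^o := A `&` c @^-1` chart_dom q.
have oB q : open (B q).
  exact: (open_preimage_on oA (@chart_dom_open _ _ _ q) cc).
have Bt q t : B q t -> tdom p q (u t).
  by move=> [At qt]; split=> //; exact: pu.
split.
  split=> // q k.
  apply: (Ck_comp (oB q) (tdom_open p q) (trans_smooth p q k) _ (Bt q)).
  by apply: Ck_sub (su k) => t [].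
(* The acceleration at [t] lives in the chart attached to [c t], so the solution is transported
   there from the chart [p], and its second derivative acquires a Hessian term. *)
move=> t At; set q := c t.
have qt : B q t by split=> //; exact: chart_dom_mem.
have qq : chart_dom q (c t) by exact: chart_dom_mem.
have pc : chart_dom p (c t) by exact: cimg_inv (pu t At).
have uE : u t = chart p (c t) by rewrite /c chart_invK //; exact: pu.
have x1 s : B q s -> is_derive s (1 : R) (fun s => chart q (c s)) (Jac p q (u s) (v s)).
  move=> qs; have [d1 dE] := du s (proj1 qs); rewrite -dE.
  by rewrite JacE; exact: (is_derive_chain (tdom_diff (Bt q s qs)) d1).
have nB : \forall s \near t, B q s by exact: (open_nbhs_nbhs (conj (oB q) qt)).
have d1E s : B q s -> derive1 (fun s => chart q (c s)) s = Jac p q (u s) (v s).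
  by move=> /x1[_ E]; rewrite derive1E.
have d2E : derive1 (derive1 (fun s => chart q (c s))) t =
    Jac p q (u t) (- spray g p (u t) (v t)) + Hess p q (u t) (v t) (v t).
  rewrite derive1E.
  have nt : \forall s \near t, tdom p q (u s) by apply: filterS nB => s; exact: Bt.
  have [_ <-] := is_derive_Jac_curve (Bt q t qt) (du t At) (dv t At) nt.
  by apply: near_eq_derive; apply: filterS nB => s /d1E.
rewrite /acceleration -/(u t) -/(c t) -/q spray_christoffel d1E //.
rewrite [X in X + _]d2E.
apply: (EL_eq0 (cimg_self q)) => w.
(* Each [w] is the image of [Jac q p w], so covariance reduces the claim to the equation satisfied
   in the chart [p]. *)
have := EL_change g (v t) (- spray g p (u t) (v t)) (Jac q p (chart q (c t)) w) pc qq.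
rewrite /= JacK // -uE => ->.
by rewrite EL_spray ?addNr ?mform0l //; exact: pu.
Unshelve. all: by end_near. Qed.

Lemma geodesic_exists p v0 : exists (d : R) (c : R -> M), [/\ 0 < d,
  geodesic g [set t | `|t| < d] c, c 0 = p & velocity c 0 = v0].
Proof.
have oP := @pdom_open _ _ _ p.
have pX0 : pdom p (row_mx (chart p p) v0) by rewrite /pdom /= row_mxKl; exact: cimg_self.
have [d [X [d0 X0 XD]]] := ode_exists oP (@spray_field_smooth p 1) pX0.
exists d, (fun t => chart_inv p (lsubmx (X t))).
have c0 : chart_inv p (lsubmx (X 0)) = p.
  by rewrite X0 row_mxKl chartK //; exact: chart_dom_mem.
split=> //; first exact: geodesic_ode.
rewrite /velocity c0 derive1E.
have [|pX [d1 dE]] := XD 0; first by rewrite normr0.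
have [_] := derivable_lin (@lsub_cont R n) d1.
rewrite dE /spray_field /= row_mxKl X0 row_mxKr => <-.
apply: near_eq_derive.
have : \forall s \near (0 : R), `|s| < d.
  by apply/nbhs_ballP; exists d => // s; rewrite -ball_normE /= sub0r normrN.
by apply: filterS => s /XD[pXs _]; rewrite /= chart_invK.
Qed.

End GeodesicExistence.

(** * Lie groups and one-parameter subgroups *)

Section Partials.
Context {R : realType} {U V W : normedModType R}.
Implicit Types (Phi : U * V -> W).

Lemma is_derive_pairl (a : U) (b : V) z :
  is_derive a z (fun w => (w, b) : U * V) (z, 0).
Proof.
have E : (fun w => (w, b) : U * V) = inl_lin + cst (0, b).
  by apply/funext => w; rewrite -[RHS]/((w + 0, 0 + b)) addr0 add0r.
rewrite E; have [d1 dE] := derivable_lin (L := @inl_lin R U V) (@inl_cont R U V) (@derivable_id _ _ a z).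
apply: (is_derive_eq (is_deriveD (DeriveDef d1 dE) (is_derive_cst ((0, b) : U * V) a z))).
by rewrite addr0 derive_id.
Qed.

Lemma is_derive_pairr (a : U) (b : V) z :
  is_derive b z (fun w => (a, w) : U * V) (0, z).
Proof.
have E : (fun w => (a, w) : U * V) = inr_lin + cst (a, 0).
  by apply/funext => w; rewrite -[RHS]/((0 + a, w + 0)) addr0 add0r.
rewrite E; have [d1 dE] := derivable_lin (L := @inr_lin R U V) (@inr_cont R U V) (@derivable_id _ _ b z).
apply: (is_derive_eq (is_deriveD (DeriveDef d1 dE) (is_derive_cst ((a, 0) : U * V) b z))).
by rewrite addr0 derive_id.
Qed.

Lemma partial1 Phi a b z : differentiable Phi (a, b) ->
  is_derive a z (fun w => Phi (w, b)) ('D_(z, 0) Phi (a, b)).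
Proof.
move=> dP; have [d1 dE] := is_derive_pairl a b z; rewrite -dE.
exact: (is_derive_chain (g := fun w => (w, b)) dP d1).
Qed.

Lemma partial2 Phi a b z : differentiable Phi (a, b) ->
  is_derive b z (fun w => Phi (a, w)) ('D_(0, z) Phi (a, b)).
Proof.
move=> dP; have [d1 dE] := is_derive_pairr a b z; rewrite -dE.
exact: (is_derive_chain (g := fun w => (a, w)) dP d1).
Qed.

Lemma partial1_diff Phi a b : differentiable Phi (a, b) ->
  differentiable (fun w => Phi (w, b)) a.
Proof.
move=> dP; apply: (differentiable_comp (f := fun w => (w, b)) (g := Phi)) => //.
Qed.

Lemma partial2_diff Phi a b : differentiable Phi (a, b) ->
  differentiable (fun w => Phi (a, w)) b.
Proof.
move=> dP; apply: (differentiable_comp (f := fun w => (a, w)) (g := Phi)) => //.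
Qed.

Lemma partial1_chain (T : normedModType R) Phi (f : T -> U) b x v df :
  differentiable Phi (f x, b) -> is_derive x v f df ->
  is_derive x v (fun w => Phi (f w, b)) ('D_(df, 0) Phi (f x, b)).
Proof.
move=> dP [d1 <-]; have [_ <-] := partial1 ('D_v f x) dP.
exact: (is_derive_chain (partial1_diff dP) d1).
Qed.

Lemma partial2_chain (T : normedModType R) Phi (f : T -> V) a x v df :
  differentiable Phi (a, f x) -> is_derive x v f df ->
  is_derive x v (fun w => Phi (a, f w)) ('D_(0, df) Phi (a, f x)).
Proof.
move=> dP [d1 <-]; have [_ <-] := partial2 ('D_v f x) dP.
exact: (is_derive_chain (partial2_diff dP) d1).
Qed.

Lemma Ck_pairl k (b : V) (A : set U) : open A -> Ck k A (fun w => (w, b) : U * V).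
Proof. by move=> oA; apply: Ck_pair => //; [exact: Ck_id|exact: Ck_cst]. Qed.
Lemma Ck_pairr k (a : U) (A : set V) : open A -> Ck k A (fun w => (a, w) : U * V).
Proof. by move=> oA; apply: Ck_pair => //; [exact: Ck_cst|exact: Ck_id]. Qed.

End Partials.

Section LocalRep2.
Context {R : realType} {m n k : nat} {M : manifoldType R m} {N : manifoldType R n}
  {P : manifoldType R k}.
Variable f : M -> N -> P.
Hypothesis sf : smooth_map2 f.
Implicit Types (p x : M) (q y : N) (r : P).

Definition lrep2 p q r (z : 'rV[R]_m * 'rV[R]_n) : 'rV[R]_k :=
  chart r (f (chart_inv p z.1) (chart_inv q z.2)).

Definition ldom2 p q r : set ('rV[R]_m * 'rV[R]_n) :=
  [set z | [/\ cimg p z.1, cimg q z.2 & chart_dom r (f (chart_inv p z.1) (chart_inv q z.2))]].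

Lemma lrep2_smooth p q r : smooth_on (ldom2 p q r) (lrep2 p q r).
Proof. by case: sf => _ /(_ p q r). Qed.

Lemma ldom2_open p q r : open (ldom2 p q r).
Proof.
have -> : ldom2 p q r = [set z | [set z | cimg p z.1 /\ cimg q z.2] z /\
    chart_dom r (f (chart_inv p z.1) (chart_inv q z.2))].
  by apply/seteqP; split=> z /= [] => [? ? ?|[]].
apply: (open_preimage_on (f := fun z => f (chart_inv p z.1) (chart_inv q z.2))).
- have -> : [set z : 'rV[R]_m * 'rV[R]_n | cimg p z.1 /\ cimg q z.2] =
    [set z | [set z | setT z /\ cimg p z.1] z /\ cimg q z.2].
    by apply/seteqP; split=> z /= [] => [? ?|[]].
  apply: open_preimage_on; [|exact: cimg_open|by move=> z _; exact: cvg_snd].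
  by apply: open_preimage_on; [exact: openT|exact: cimg_open|by move=> z _; exact: cvg_fst].
- exact: chart_dom_open.
move=> z [pz qz].
have c1 : {for z, continuous (fun z => (chart_inv p z.1, chart_inv q z.2) : M * N)}.
  apply: (cvg_pair (f := fun z => chart_inv p z.1) (g := fun z => chart_inv q z.2)).
    apply: (continuous_comp (f := fst) (g := chart_inv p)); first exact: cvg_fst.
    exact: chart_inv_cont.
  apply: (continuous_comp (f := snd) (g := chart_inv q)); first exact: cvg_snd.
  exact: chart_inv_cont.
apply: (continuous_comp (g := fun xy => f xy.1 xy.2) c1).
exact: (proj1 sf).
Qed.

Lemma lrep2_diff p q r z : ldom2 p q r z -> differentiable (lrep2 p q r) z.
Proof.
move=> Hz; exact: (Ck_differentiable (k := 0) (@ldom2_open p q r) (@lrep2_smooth p q r 1) Hz).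
Qed.

Lemma lrep2E p q r x y : chart_dom p x -> chart_dom q y ->
  lrep2 p q r (chart p x, chart q y) = chart r (f x y).
Proof. by move=> px qy; rewrite /lrep2 /= !chartK. Qed.

Lemma smooth_map2_continuous x y : {for (x, y), continuous (fun xy => f xy.1 xy.2)}.
Proof. exact: (proj1 sf). Qed.

Lemma smooth_map_right x : smooth_map (f x).
Proof.
split.
  move=> y; apply: (continuous_comp (f := fun y => (x, y)) (g := fun xy => f xy.1 xy.2)).
    by apply: cvg_pair; [exact: cvg_cst|exact: cvg_id].
  exact: smooth_map2_continuous.
move=> q r j; rewrite chart_setE.
have xx := chart_dom_mem x.
have oA : open [set u | cimg q u /\ (f x @^-1` chart_dom r) (chart_inv q u)].
  apply: (open_preimage_on (f := f x \o chart_inv q) (B := chart_dom r)).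
  - exact: cimg_open.
  - exact: chart_dom_open.
  move=> u qu; apply: continuous_comp; first exact: chart_inv_cont.
  apply: (continuous_comp (f := fun y => (x, y)) (g := fun xy => f xy.1 xy.2)).
    by apply: cvg_pair; [exact: cvg_cst|exact: cvg_id].
  exact: smooth_map2_continuous.
have H u : cimg q u /\ (f x @^-1` chart_dom r) (chart_inv q u) ->
    ldom2 x q r (chart x x, u).
  by move=> [qu ru]; split=> //=; [exact: cimg_self|rewrite chartK].
apply: (Ck_eq oA _ (Ck_comp oA (@ldom2_open x q r) (@lrep2_smooth x q r j)
  (Ck_pairr j (chart x x) oA) H)) => u _.
by rewrite /lrep2 /= chartK.
Qed.

End LocalRep2.

Fact livf_key : unit. Proof. by []. Qed.

Section LieGroupChart.
Context {R : realType} {m : nat} {G : lieGroupType R m}.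
Implicit Types (U V w u : 'rV[R]_m).

Notation o := (1%g : G).
Definition egrp : 'rV[R]_m := chart o o.
Definition mu : 'rV[R]_m * 'rV[R]_m -> 'rV[R]_m := lrep2 (fun x y : G => (x * y)%g) o o o.
Definition mudom := ldom2 (fun x y : G => (x * y)%g) o o o.

Let sm : smooth_map2 (fun x y : G => (x * y)%g) := @mulg_smooth R m G.

Lemma mudom_open : open mudom. Proof. exact: ldom2_open. Qed.
Lemma mu_smooth : smooth_on mudom mu. Proof. exact: lrep2_smooth. Qed.
Lemma mu_diff z : mudom z -> differentiable mu z.
Proof. exact: (lrep2_diff sm). Qed.

Lemma cimg_egrp : cimg o egrp. Proof. exact: cimg_self. Qed.
Lemma inv_egrp : chart_inv o egrp = o.
Proof. by rewrite /egrp chartK //; exact: chart_dom_mem. Qed.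

Lemma mudom_er w : cimg o w -> mudom (w, egrp).
Proof.
move=> ow; split=> //=; first exact: cimg_egrp.
by rewrite inv_egrp mulg1; exact: cimg_inv.
Qed.
Lemma mudom_el w : cimg o w -> mudom (egrp, w).
Proof.
move=> ow; split=> //=; first exact: cimg_egrp.
by rewrite inv_egrp mul1g; exact: cimg_inv.
Qed.

Lemma mu_er w : cimg o w -> mu (w, egrp) = w.
Proof. by move=> ow; rewrite /mu /lrep2 /= inv_egrp mulg1 chart_invK. Qed.
Lemma mu_el w : cimg o w -> mu (egrp, w) = w.
Proof. by move=> ow; rewrite /mu /lrep2 /= inv_egrp mul1g chart_invK. Qed.

Lemma mu_cimg z : mudom z -> cimg o (mu z).
Proof. by move=> [? ? ?]; exact: cimg_chart. Qed.

Lemma inv_mu z : mudom z -> chart_inv o (mu z) = (chart_inv o z.1 * chart_inv o z.2)%g.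
Proof. by move=> [? ? ?]; rewrite /mu /lrep2 chartK. Qed.

(* The left-invariant field with value [U] at the identity, in the chart there. *)
Definition livf U w : 'rV[R]_m := locked_with livf_key ('D_(0, U) mu (w, egrp)).
Lemma livfE U w : livf U w = 'D_(0, U) mu (w, egrp).
Proof. by rewrite /livf unlock. Qed.

Lemma livf_smooth U : smooth_on (cimg o) (livf U).
Proof.
move=> k; have oc := cimg_open o.
apply: (Ck_eq oc _ (Ck_comp oc mudom_open (Ck_D (0, U) (mu_smooth k.+1))
  (Ck_pairl k egrp oc) mudom_er)) => w _.
by rewrite livfE.
Qed.

Lemma livf_e U : livf U egrp = U.
Proof.
rewrite livfE; have [_ <-] := partial2 U (mu_diff (mudom_er cimg_egrp)).
rewrite -[RHS](derive_id egrp U); apply: near_eq_derive.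
apply: filterS (open_nbhs_nbhs (conj (cimg_open o) cimg_egrp)) => w ow.
exact: mu_el.
Qed.

(** Links [lie], defined through [dmap] in charts that vary with the point, to a partial derivative
    of the multiplication in the single chart at 1. *)
Lemma left_invariant_field U w : cimg o w -> field_coord o (left_invariant (G := G) U) w = livf U w.
Proof.
move=> ow; set p := chart_inv o w.
have op : chart_dom o p := cimg_inv ow.
have pp1 : chart_dom o (p * 1)%g by rewrite mulg1.
have := dmap_lrep U (smooth_map_right sm p) (chart_dom_mem o) pp1.
rewrite Jac_id; last exact: chart_dom_mem.
rewrite JacE mulg1 => E; rewrite /field_coord -/p.
transitivity ('D_U (lrep (fun y => (p * y)%g) o o) egrp); first exact: (esym E).
by rewrite livfE; have [_ <-] := partial2 U (mu_diff (mudom_er ow)).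
Qed.

Lemma left_invariant1 U : left_invariant (G := G) U o = U.
Proof.
rewrite /left_invariant (_ : (fun b : G => (1 * b)%g) = id); last first.
  by apply/funext => b; rewrite mul1g.
have := Jac_id U (chart_dom_mem o); rewrite JacE; exact.
Qed.

Lemma lie_livf U V : lie (G := G) U V = 'D_U (livf V) egrp - 'D_V (livf U) egrp.
Proof.
rewrite /lie /vbracket !left_invariant1.
have E W Z : 'D_Z (field_coord o (left_invariant (G := G) W)) egrp = 'D_Z (livf W) egrp.
  apply: near_eq_derive.
  apply: filterS (open_nbhs_nbhs (conj (cimg_open o) cimg_egrp)) => w.
  exact: left_invariant_field.
have E1 := E V U; have E2 := E U V.
exact: (f_equal2 (fun a b => a - b) E1 E2).
Qed.

(* Left invariance of [livf U], from associativity. *)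
Lemma livf_mu U a b : mudom (a, b) -> 'D_(0, livf U b) mu (a, b) = livf U (mu (a, b)).
Proof.
move=> ab; have [/= oa ob _] := ab.
have obe := mudom_er ob.
have oab := mu_cimg ab.
have d1 : is_derive egrp U (fun w => mu (b, w)) (livf U b).
  by rewrite livfE; apply: partial2; exact: mu_diff.
have dab : differentiable mu (a, mu (b, egrp)) by rewrite (mu_er ob); exact: mu_diff.
have D1 := partial2_chain (f := fun w => mu (b, w)) dab d1; rewrite (mu_er ob) in D1.
have D2 : is_derive egrp U (fun w => mu (mu (a, b), w)) (livf U (mu (a, b))).
  by rewrite livfE; apply: partial2; apply: mu_diff; exact: mudom_er.
case: D1 => _ <-; case: D2 => _ <-.
apply: near_eq_derive.
have n1 : \forall w \near egrp, mudom (b, w).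
  apply: (cvg_pair (cvg_cst b) (@cvg_id _ (nbhs egrp)) _).
  exact: (open_nbhs_nbhs (conj mudom_open obe)).
have n2 : \forall w \near egrp, mudom (a, mu (b, w)).
  have c : {for egrp, continuous (fun w => mu (b, w))}.
    by apply: differentiable_continuous; apply: partial2_diff; exact: mu_diff.
  apply: (cvg_pair (cvg_cst a) c _); rewrite (mu_er ob).
  exact: (open_nbhs_nbhs (conj mudom_open ab)).
near=> w.
have bw : mudom (b, w) by near: w.
have abw : mudom (a, mu (b, w)) by near: w.
rewrite /= {1 3}/mu /lrep2 /= !inv_mu //= mulgA //.
Unshelve. all: by end_near. Qed.

End LieGroupChart.

(** * Extension of a local homomorphism to the whole line *)

Section HomExtension.
Context {R : realType} {G : groupType}.
Variables (gam : R -> G) (d : R).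
Hypothesis d0 : 0 < d.
Hypothesis hom : forall s t, `|s| < d -> `|t| < d -> gam (s + t) = (gam s * gam t)%g.

Let P (t : R) k := `|t / 2 ^+ k| < d.
(** The value at [t] must be the [2^k]-th power of the value at [t / 2^k]; once the latter time is
    below [d], the result no longer depends on [k]. *)
Let E (t : R) k := (gam (t / 2 ^+ k)%R ^+ (2 ^ k)%N)%g.

Let P_S t k : P t k -> P t k.+1.
Proof.
rewrite /P exprSr invfM mulrA => H; apply: le_lt_trans H.
by rewrite [leLHS]normrM; apply: ler_piMr => //; rewrite ger0_norm ?invr_ge0 // invf_le1 ?ltr0n // ler1n.
Qed.

Let P_le t k l : (k <= l)%N -> P t k -> P t l.
Proof.
by move=> /subnKC <-; elim: (l - k)%N => [|j IH] Pk; rewrite ?addn0 // addnS; apply/P_S/IH.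
Qed.

Let P_ex t : exists k, P t k.
Proof.
have z1 : `|2^-1 : R| < 1 by rewrite ger0_norm ?invf_lt1 ?ltr1n ?ltr0n.
have /cvgrPdist_lt/(_ d d0) [k _ /(_ k (leqnn k))] := @cvg_geometric R t _ z1.
by rewrite /= sub0r normrN exprVn => H; exists k.
Qed.

Let E_S t k : P t k -> E t k.+1 = E t k.
Proof.
move=> /P_S; rewrite /E /P; set x := t / 2 ^+ k.+1 => xd.
have -> : t / 2 ^+ k = x + x.
  rewrite /x exprSr invfM; set y := _^-1; lra.
by rewrite hom // expnS expgnA.
Qed.

Let E_le t k l : (k <= l)%N -> P t k -> E t l = E t k.
Proof.
move=> /subnKC <-; elim: (l - k)%N => [|j IH] Pk; first by rewrite addn0.
by rewrite addnS E_S ?IH //; apply: P_le Pk; exact: leq_addr.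
Qed.

Let c t := E t (sval (cid (P_ex t))).
Let cE t k : P t k -> c t = E t k.
Proof.
rewrite /c; case: cid => l /= Pl Pk.
by have [kl|/ltnW lk] := leqP k l; [exact: E_le|rewrite -(E_le lk)].
Qed.

(** At a depth [k] common to [s], [t] and [s + t], the values of [gam] commute because addition of
    times does, so the power of the product splits. *)
Lemma hom_extension : exists c : R -> G,
  (forall s t, c (s + t) = (c s * c t)%g) /\ (forall t, `|t| < d -> c t = gam t).
Proof.
exists c; split=> [s t|t td]; last first.
  by rewrite (@cE t 0) /E /P ?expr0 ?divr1 // expn0 expg1.
have [k1 P1] := P_ex s; have [k2 P2] := P_ex t; have [k3 P3] := P_ex (s + t).
pose k := maxn k1 (maxn k2 k3).
have Ps : P s k by apply: P_le P1; rewrite leq_maxl.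
have Pt : P t k by apply: P_le P2; rewrite /k !leq_max leqnn orbT.
have Pst : P (s + t) k by apply: P_le P3; rewrite /k !leq_max leqnn !orbT.
rewrite (cE Ps) (cE Pt) (cE Pst) /E mulrDl hom // expgMn //.
by rewrite /commute -!hom // addrC.
Qed.

End HomExtension.

Section OneParameter.
Context {R : realType} {m : nat} {G : lieGroupType R m}.
Implicit Types (U V w u : 'rV[R]_m).
Notation o := (1%g : G).
Notation e := (@egrp R m G).
Notation mu := (@mu R m G).
Notation mudom := (@mudom R m G).
Notation livf := (@livf R m G).

(** For fixed [s], both [u (s + t)] and [mu (u s, u t)] solve the equation of the left-invariant
    field, the second by [livf_mu], and they agree at [t = 0]. *)
Lemma local_subgroup U : exists (d : R) (u : R -> 'rV[R]_m), [/\ 0 < d, u 0 = e,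
  forall t, `|t| < d + d -> cimg o (u t) /\ is_derive t (1 : R) u (livf U (u t)) &
  forall s t, `|s| < d -> `|t| < d -> mudom (u s, u t) /\ u (s + t) = mu (u s, u t)].
Proof.
have oc := cimg_open o; have ce := @cimg_egrp R m G.
have [r [L [r0 L0 rO FL]]] := Ck_lipschitz oc (@livf_smooth R m G U 1) ce.
have [d0 [u [d00 u0 uD]]] := ode_exists oc (@livf_smooth R m G U 1) ce.
have cu : {for 0, continuous u}.
  have [|_ [/derivable1_diffP/differentiable_continuous //]] := uD 0.
  by rewrite normr0.
have mee : mudom (e, e) by exact: mudom_er.
have cmu : {for (e, e), continuous mu} by apply: differentiable_continuous; exact: mu_diff.
have : \forall z \near (e, e), mudom z /\ `|mu z - e| < r.
  near=> z; split; near: z; first exact: (open_nbhs_nbhs (conj (@mudom_open R m G) mee)).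
  move/cvgrPdist_lt: cmu => /(_ _ r0); rewrite mu_er //.
  by apply: filterS => z; rewrite distrC.
move=> /nbhs_ballP [eta /= eta0 etaP].
have re0 : 0 < Num.min r eta by rewrite lt_min r0.
move/cvgrPdist_lt: cu => /(_ _ re0) /nbhs_ballP [d1 /= d10 d1P].
(* The halves are there because [s + t] ranges over [|s + t| < 2 d]; the last bound is the one
   required by [ode_unique]. *)
pose d := Num.min (Num.min (d0 / 2) (d1 / 2)) (2 * L)^-1.
have dpos : 0 < d by rewrite !lt_min !divr_gt0 // invr_gt0 mulr_gt0 // ltr0n.
have dd0 : d + d <= d0.
  have : d <= d0 / 2 by rewrite /d !ge_min lexx.
  by lra.
have dd1 : d + d <= d1.
  have : d <= d1 / 2 by rewrite /d !ge_min lexx orbT.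
  by lra.
have dL : L * d <= 2^-1.
  apply: (@le_trans _ _ (L * (2 * L)^-1)).
    by rewrite ler_pM2l // /d !ge_min lexx orbT.
  by rewrite invfM mulrCA divff ?gt_eqF // mulr1.
have near_e t : `|t| < d + d -> `|u t - e| < Num.min r eta.
  move=> td; rewrite distrC -u0; apply: d1P; rewrite -ball_normE /= sub0r normrN.
  exact: lt_le_trans dd1.
have near_r t : `|t| < d + d -> `|u t - e| < r.
  by move=> /near_e; rewrite lt_min => /andP[].
have lt2 (t : R) : `|t| < d -> `|t| < d + d by lra.
have near_mu s t : `|s| < d -> `|t| < d -> mudom (u s, u t) /\ `|mu (u s, u t) - e| < r.
  move=> sd td; apply: etaP; split; rewrite /= -ball_normE /= distrC.
    by have := near_e s (lt2 _ sd); rewrite lt_min => /andP[].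
  by have := near_e t (lt2 _ td); rewrite lt_min => /andP[].
have uD2 t : `|t| < d + d -> cimg o (u t) /\ is_derive t (1 : R) u (livf U (u t)).
  by move=> td; apply: uD; exact: lt_le_trans dd0.
exists d, u; split=> // s t sd td; split; first by case: (near_mu s t sd td).
have := @ode_unique R m (livf U) e r L d (fun t => u (s + t)) (fun t => mu (u s, u t)) FL (ltW L0) dL.
apply=> //.
- move=> t' td'.
  have st : `|s + t'| < d + d by apply: le_lt_trans (ler_normD _ _) _; lra.
  split; first exact: near_r.
  have -> : (fun t => u (s + t)) = (fun t => u (t + s)) by apply/funext => y; rewrite addrC.
  rewrite addrC in st *; apply: (is_derive_translate (V := R^o)).
  by case: (uD2 _ st).
- move=> t' td'; have [Hm Hr] := near_mu s t' sd td'; split=> //.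
  rewrite -livf_mu //; apply: partial2_chain; first exact: mu_diff.
  by case: (uD2 _ (lt2 _ td')).
by rewrite addr0 u0 mu_er //; case: (uD2 _ (lt2 _ sd)).
Unshelve. all: by end_near. Qed.

End OneParameter.

Section Exponential.
Context {R : realType} {m : nat} {G : lieGroupType R m}.
Implicit Types (U V w u : 'rV[R]_m).
Notation o := (1%g : G).
Notation e := (@egrp R m G).

Lemma open_itv_center (a d : R) : open ([set t | `|t - a| < d] : set R^o).
Proof.
rewrite openE => t /= td; near=> s => /=.
have : `|s - t| < d - `|t - a|.
  near: s; apply/nbhs_ballP; exists (d - `|t - a|); first by rewrite /= subr_gt0.
  by move=> s; rewrite -ball_normE /= distrC.
have := ler_normD (s - t) (t - a); rewrite subrKA; lra.
Unshelve. all: by end_near. Qed.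

Arguments open_itv_center : clear implicits.

Let sm : smooth_map2 (fun x y : G => (x * y)%g) := @mulg_smooth R m G.

(** Near [t0] the curve is the left translate by [c t0] of its piece near 0, so smoothness near 0
    propagates to all times. *)
Lemma smooth_curve_hom (d : R) (u : R^o -> 'rV[R]_m) (c : R -> G) :
  0 < d -> smooth_on ([set t | `|t| < d] : set R^o) u ->
  (forall t, `|t| < d -> cimg o (u t) /\ c t = chart_inv o (u t)) ->
  (forall s t, c (s + t) = (c s * c t)%g) -> smooth_curve setT c.
Proof.
move=> d0 su cu hom.
pose I t0 : set R^o := [set t | `|t - t0| < d].
have oI t0 : open (I t0) by exact: open_itv_center.
pose f t0 : G -> G := fun x => (c t0 * x)%g.
have sf t0 : smooth_map (f t0) := smooth_map_right sm (c t0).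
have cE t0 t : I t0 t -> c t = f t0 (chart_inv o (u (t - t0))).
  by move=> It; rewrite /f -(proj2 (cu _ It)) -hom addrC subrK.
have us t0 k : Ck k (I t0) (fun t => u (t - t0)).
  have oA : open ([set t | `|t| < d] : set R^o).
    by have := open_itv_center 0 d; under eq_set do rewrite subr0.
  have Cs : Ck k (I t0) (fun t : R^o => t - t0 : R^o).
    by apply: CkD => //; [exact: Ck_id|exact: Ck_cst].
  exact: (Ck_comp (oI t0) oA (su k) Cs).
have It0 t0 : I t0 t0 by rewrite /I /= subrr normr0.
have cc t0 : {for t0, continuous c}.
  have cg : {for t0, continuous (fun t : R^o => f t0 (chart_inv o (u (t - t0))))}.
    apply: (continuous_comp (f := fun t : R^o => chart_inv o (u (t - t0))) (g := f t0)); last first.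
      exact: (proj1 (sf t0)).
    apply: (continuous_comp (f := fun t : R^o => u (t - t0)) (g := chart_inv o)).
      exact: (Ck_continuous (us t0 0) (It0 t0)).
    by apply: chart_inv_cont; case: (cu _ (It0 t0)).
  have nE : \forall t \near (t0 : R^o), f t0 (chart_inv o (u (t - t0))) = c t.
    apply: filterS (open_nbhs_nbhs (conj (oI t0) (It0 t0))) => t It.
    by rewrite -cE.
  rewrite /prop_for /continuous_at -(nbhs_singleton nE).
  exact: cvg_trans (near_eq_cvg nE) cg.
split=> // q k; apply: Ck_local => t0 [_ qt0].
pose B : set R^o := [set t | I t0 t /\ chart_dom q (c t)].
have oB : open B.
  exact: (open_preimage_on (oI t0) (@chart_dom_open _ _ _ q) (fun t _ => @cc t)).
exists B => //.
have HB t : B t -> ldom (f t0) o q (u (t - t0)).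
  move=> [It qt]; split; first by case: (cu _ It).
  by rewrite /= -cE.
have Cu : Ck k B (fun t => u (t - t0)) by apply: Ck_sub (us t0 k) => t [].
apply: (Ck_eq oB _ (Ck_comp oB (ldom_open (f t0) o q (proj1 (sf t0)))
  (lrep_smooth (f t0) o q (sf t0) k) Cu HB)) => t [It _].
by rewrite /lrep /= -cE.
Qed.

(** Existence is what gives the choice [xget] its meaning; the witness is the extension of the curve
    of [local_subgroup]. *)
Lemma exptP U : one_parameter_subgroup (expt (G := G) U) /\ velocity (expt (G := G) U) 0 = U.
Proof.
suff [c cP] : exists c : R -> G, one_parameter_subgroup c /\ velocity c 0 = U.
  exact: (@xgetI _ (fun=> 1%g)
    [set c : R -> G | one_parameter_subgroup c /\ velocity c 0 = U] c cP).
have [d [u [d0 u0 uD uhom]]] := @local_subgroup R m G U.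
have hom s t : `|s| < d -> `|t| < d ->
    chart_inv o (u (s + t)) = (chart_inv o (u s) * chart_inv o (u t))%g.
  by move=> sd td; have [Hm ->] := uhom s t sd td; rewrite inv_mu.
have [c [chom cE]] := hom_extension d0 hom.
have lt2 (t : R) : `|t| < d -> `|t| < d + d by lra.
have oA : open ([set t | `|t| < d] : set R^o).
  by have := open_itv_center 0 d; under eq_set do rewrite subr0.
have su : smooth_on ([set t | `|t| < d] : set R^o) u.
  by apply: (ode_smooth (cimg_open o) (@livf_smooth R m G U) oA) => t /lt2/uD.
exists c; split.
  split=> //; apply: (smooth_curve_hom d0 su) => // t td; split; last exact: cE.
  by case: (uD t (lt2 _ td)).
have c0 : c 0 = o by rewrite cE ?normr0 // u0 inv_egrp.
rewrite /velocity c0 derive1E.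
have [|_ [_ D]] := uD 0; first by rewrite normr0 addr_gt0.
rewrite u0 livf_e in D; rewrite -D; apply: near_eq_derive.
have : \forall s \near (0 : R), `|s| < d.
  by apply/nbhs_ballP; exists d => // s; rewrite -ball_normE /= sub0r normrN.
apply: filterS => s sd; rewrite cE // chart_invK //.
by case: (uD s (lt2 _ sd)).
Qed.

Lemma expt0 U : expt (G := G) U 0 = o.
Proof.
have [[_ hom] _] := exptP U; have := hom 0 0; rewrite addr0.
by move=> /(congr1 (fun x => (expt U 0)^-1 * x)%g); rewrite mulVg mulKg.
Qed.

Lemma exptD U s t : expt (G := G) U (s + t) = (expt U s * expt U t)%g.
Proof. by have [[_ hom] _] := exptP U. Qed.

Lemma expt_cont U t : {for t, continuous (expt (G := G) U)}.
Proof. by have [[[c _] _] _] := exptP U; exact: c. Qed.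

Lemma expt_deriv U :
  is_derive (0 : R) (1 : R) (fun t => chart o (expt (G := G) U t)) U.
Proof.
have [[[_ sc] _] v] := exptP U; rewrite /velocity expt0 derive1E in v.
apply: DeriveDef v.
have := sc o 1%N => -[_ /(_ 1) [+ _]]; apply.
by split=> //=; rewrite expt0; exact: chart_dom_mem.
Qed.

End Exponential.
Arguments open_itv_center {R} a d.

(** * Killing fields of the action *)

Section MovingDirection.
Context {R : realType} {T V : normedModType R} {n : nat} {cV : coords V}.

(** A product rule: expanding the direction [d y] in the basis separates its variation from that of
    the base point. *)
Lemma is_derive_moving (Omega : set V) (Phi : V -> 'rV[R]_n) (f d : T -> V) x v df dd :
  open Omega -> smooth_on Omega Phi -> (\forall y \near x, Omega (f y)) ->
  is_derive x v f df -> is_derive x v d dd ->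
  is_derive x v (fun y => 'D_(d y) Phi (f y))
    ('D_dd Phi (f x) + 'D_df (fun z => 'D_(d x) Phi z) (f x)).
Proof.
move=> oO sPhi nO hf hd; have Ofx := nbhs_singleton nO.
have dPhi z : Omega z -> differentiable Phi z.
  by move=> Oz; exact: (Ck_differentiable oO (sPhi 1%N) Oz).
have dDPhi w z : Omega z -> differentiable (fun z => 'D_w Phi z) z.
  by move=> Oz; exact: (Ck_differentiable oO (Ck_D w (sPhi 2%N)) Oz).
have H i : is_derive x v (fun y => cfun i (d y) *: 'D_(cvec i) Phi (f y))
    (cfun i (d x) *: 'D_df (fun z => 'D_(cvec i) Phi z) (f x) +
     cfun i dd *: 'D_(cvec i) Phi (f x)).
  apply: (@is_derive_scale R T n (fun y => cfun i (d y))).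
    have [d1 <-] := hd.
    exact: (derivable_lin (L := cfun i) (@cfun_cont _ _ cV i) d1).
  have [f1 <-] := hf.
  exact: (is_derive_chain (dDPhi (cvec i) (f x) Ofx) f1).
have D := is_derive_sumE (index_enum _) H.
rewrite big_split /= in D.
have E1 : \sum_i cfun i dd *: 'D_(cvec i) Phi (f x) = 'D_dd Phi (f x).
  by rewrite [RHS](derive_coords _ (dPhi _ Ofx)).
have E2 : \sum_i cfun i (d x) *: 'D_df (fun z => 'D_(cvec i) Phi z) (f x) =
    'D_df (fun z => 'D_(d x) Phi z) (f x).
  (* Linearity in [w] is not visible in this order of derivatives; Schwarz moves [w] outside, where
     the differential is linear. *)
  have S w : 'D_df (fun z => 'D_w Phi z) (f x) = 'D_w (fun z => 'D_df Phi z) (f x).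
    exact: (schwarz df w oO (sPhi 2%N) Ofx).
  rewrite [RHS]S [RHS](derive_coords _ (dDPhi df _ Ofx)).
  by apply: eq_bigr => i _; rewrite S.
have D' := is_derive_eq D (etrans (addrC _ _) (f_equal2 +%R E1 E2)).
apply: near_eq_is_derive D'.
apply: filterS nO => y Oy; exact: (esym (derive_coords _ (dPhi _ Oy))).
Qed.

End MovingDirection.

Fact kf_key : unit. Proof. by []. Qed.

Section Action.
Context {R : realType} {m n : nat} {G : lieGroupType R m} {H : set G}
  {M : manifoldType R n}.
Variable S : homogeneous_space H M.
Implicit Types (U V X Y : 'rV[R]_m) (p x : M) (u v w z : 'rV[R]_n).
Notation o := (1%g : G).
Notation e := (@egrp R m G).
Notation mu := (@mu R m G).
Notation mudom := (@mudom R m G).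
Notation act := (action S).

Lemma act1 x : act o x = x.
Proof. by have [a <-] := proj_surj S x; rewrite action_proj mul1g. Qed.
Lemma actM a b x : act (a * b)%g x = act a (act b x).
Proof. by have [c <-] := proj_surj S x; rewrite !action_proj mulgA. Qed.

Let sa : smooth_map2 act := action_smooth S.

Definition alpha p : 'rV[R]_m * 'rV[R]_n -> 'rV[R]_n := lrep2 act o p p.
Definition adom p := ldom2 act o p p.

Lemma adom_open p : open (adom p). Proof. exact: ldom2_open. Qed.
Lemma alpha_smooth p : smooth_on (adom p) (alpha p). Proof. exact: lrep2_smooth. Qed.
Lemma alpha_diff p (z : 'rV[R]_m * 'rV[R]_n) : adom p z -> differentiable (alpha p) z.
Proof. exact: (lrep2_diff sa). Qed.

Lemma adom_e p u : cimg p u -> adom p (e, u).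
Proof.
move=> pu; split=> //=; first exact: cimg_egrp.
by rewrite inv_egrp act1; exact: cimg_inv.
Qed.
Lemma alpha_e p u : cimg p u -> alpha p (e, u) = u.
Proof. by move=> pu; rewrite /alpha /lrep2 /= inv_egrp act1 chart_invK. Qed.

Lemma alpha_cimg p (z : 'rV[R]_m * 'rV[R]_n) : adom p z -> cimg p (alpha p z).
Proof. by move=> [? ? ?]; exact: cimg_chart. Qed.
Lemma inv_alpha p (z : 'rV[R]_m * 'rV[R]_n) : adom p z -> chart_inv p (alpha p z) = act (chart_inv o z.1) (chart_inv p z.2).
Proof. by move=> [? ? ?]; rewrite /alpha /lrep2 chartK. Qed.

(* The Killing field of [U] in the chart [p]. *)
Definition kf p U u : 'rV[R]_n := locked_with kf_key ('D_(U, 0) (alpha p) (e, u)).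
Lemma kfE p U u : kf p U u = 'D_(U, 0) (alpha p) (e, u).
Proof. by rewrite /kf unlock. Qed.

Lemma kf_smooth p U : smooth_on (cimg p) (kf p U).
Proof.
move=> k; have oc := cimg_open p.
apply: (Ck_eq oc _ (Ck_comp oc (@adom_open p) (Ck_D (U, 0) (@alpha_smooth p k.+1))
  (Ck_pairr k e oc) (@adom_e p))) => u _.
by rewrite kfE.
Qed.

Lemma kf_diff p U u : cimg p u -> differentiable (kf p U) u.
Proof. by move=> pu; exact: (Ck_differentiable (cimg_open p) (@kf_smooth p U 1%N) pu). Qed.

Lemma kf_linear p u : cimg p u -> linear (fun U => kf p U u).
Proof.
move=> pu a U V; rewrite !kfE.
rewrite -(derive_linear (alpha_diff (adom_e pu)) a); congr (derive (alpha p) (e, u) _).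
by rewrite -[RHS]/((a *: U + V, a *: 0 + 0)) scaler0 addr0.
Qed.

(** By the homomorphism property, the orbit near time [t] is the orbit of the point reached at [t]
    near time 0. *)
Lemma orbit_derive p U x t : chart_dom p (act (expt U t) x) ->
  is_derive t (1 : R) (fun s => chart p (act (expt U s) x))
    (kf p U (chart p (act (expt U t) x))).
Proof.
move=> pt; set y := act (expt U t) x; set u := chart p y.
have pu : cimg p u := cimg_chart pt.
have he := @expt_deriv R m G U.
have D : is_derive (0 : R) (1 : R) (fun s => alpha p (chart o (expt U s), u)) (kf p U u).
  rewrite kfE -{1}/e.
  have E0 : chart o (expt (G := G) U 0) = e by rewrite expt0.
  have := @partial1_chain R _ _ _ R^o (alpha p) (fun s => chart o (expt U s)) u 0 1 U.
  by rewrite E0; apply=> //; apply: alpha_diff; exact: adom_e.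
have D2 : is_derive (0 : R) (1 : R) (fun s => chart p (act (expt U (s + t)) x)) (kf p U u).
  apply: near_eq_is_derive D.
  have n1 : \forall s \near (0 : R), chart_dom o (expt (G := G) U s).
    apply: (@expt_cont R m G U 0); rewrite expt0.
    exact: (open_nbhs_nbhs (conj (@chart_dom_open _ _ _ _) (chart_dom_mem o))).
  apply: filterS n1 => s os.
  by rewrite /alpha lrep2E // exptD actM.
have := @is_derive_translate R R^o _ (fun s => chart p (act (expt U (s + t)) x)) t (- t) 1.
rewrite subrr => /(_ _ D2).
by under eq_fun do rewrite subrK.
Qed.

Lemma killingE U x : killing S U x = kf x U (chart x x).
Proof.
rewrite /killing /velocity expt0 act1 derive1E.
have := @orbit_derive x U x 0; rewrite expt0 act1 => /(_ (chart_dom_mem x)).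
by case.
Qed.

(** Both sides are the velocity at time 0 of the orbit of [x], seen in two charts. *)
Lemma kf_change p x U : chart_dom p x ->
  Jac x p (chart x x) (kf x U (chart x x)) = kf p U (chart p x).
Proof.
move=> px; have xx := chart_dom_mem x.
have := @orbit_derive x U x 0; rewrite expt0 act1 => /(_ xx) [d1 dE].
have := @orbit_derive p U x 0; rewrite expt0 act1 => /(_ px) [_ <-].
rewrite -dE JacE.
have dt : differentiable (trans x p) (chart x (act (expt U 0) x)).
  by rewrite expt0 act1; exact: trans_diff.
have [_] := is_derive_chain (g := fun s : R^o => chart x (act (expt U s) x)) dt d1.
rewrite expt0 act1 => <-; apply: near_eq_derive.
have ca : {for (0 : R), continuous (fun s => act (expt U s) x)}.
  apply: (continuous_comp (f := fun s => (expt U s, x)) (g := fun ax => act ax.1 ax.2)).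
    by apply: cvg_pair; [exact: expt_cont|exact: cvg_cst].
  exact: (smooth_map2_continuous sa).
have : \forall s \near (0 : R), chart_dom x (act (expt U s) x).
  apply: ca; rewrite expt0 act1.
  exact: (open_nbhs_nbhs (conj (@chart_dom_open _ _ _ _) xx)).
by apply: filterS => s xs; rewrite /trans /= chartK.
Qed.

End Action.

(** * Brackets of Killing fields and the Killing equation *)

Section KillingCalculus.
Context {R : realType} {m n : nat} {G : lieGroupType R m} {H : set G}
  {M : manifoldType R n}.
Variable S : homogeneous_space H M.
Implicit Types (U V X Y : 'rV[R]_m) (p x : M) (u v z : 'rV[R]_n).
Notation o := (1%g : G).
Notation e := (@egrp R m G).
Notation mu := (@mu R m G).
Notation mudom := (@mudom R m G).
Notation act := (action S).
Notation kf := (kf S).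
Notation alpha := (alpha S).
Notation adom := (adom S).

Lemma near_pairl (V W : topologicalType) (A : set (V * W)) a b : open A -> A (a, b) ->
  \forall w \near a, A (w, b).
Proof.
move=> oA Aab; apply: (cvg_pair (@cvg_id _ (nbhs a)) (cvg_cst b) _).
exact: (open_nbhs_nbhs (conj oA Aab)).
Qed.

Lemma near_pairr (V W : topologicalType) (A : set (V * W)) a b : open A -> A (a, b) ->
  \forall w \near b, A (a, w).
Proof.
move=> oA Aab; apply: (cvg_pair (cvg_cst a) (@cvg_id _ (nbhs b)) _).
exact: (open_nbhs_nbhs (conj oA Aab)).
Qed.

(* [w |-> 'D_(U, 0) mu (e, w)] is the right-invariant field of [U]. *)
Lemma kf_alpha p U (w : 'rV[R]_m) u : adom p (w, u) -> mudom (e, w) ->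
  kf p U (alpha p (w, u)) = 'D_('D_(U, 0) mu (e, w), 0) (alpha p) (w, u).
Proof.
move=> wu ew; have pwu := alpha_cimg wu; have [/= ow pu _] := wu.
have muw : mu (e, w) = w by exact: mu_el.
have D1 : is_derive e U (fun w' => mu (w', w)) ('D_(U, 0) mu (e, w)).
  by apply: partial1; exact: mu_diff.
have da : differentiable (alpha p) (mu (e, w), u) by rewrite muw; exact: alpha_diff.
have D2 := partial1_chain (f := fun w' => mu (w', w)) da D1; rewrite muw in D2.
have D3 : is_derive e U (fun w' => alpha p (w', alpha p (w, u))) (kf p U (alpha p (w, u))).
  by rewrite kfE; apply: partial1; apply: alpha_diff; exact: adom_e.
case: D2 => _ <-; case: D3 => _ <-; apply: near_eq_derive.
have n1 := near_pairl (@mudom_open R m G) ew.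
have n2 : \forall w' \near e, adom p (mu (w', w), u).
  have c : {for e, continuous (fun w' => mu (w', w))}.
    by apply: differentiable_continuous; apply: partial1_diff; exact: mu_diff.
  apply: (cvg_pair c (cvg_cst u) _); rewrite muw.
  exact: (open_nbhs_nbhs (conj (@adom_open _ _ _ _ _ _ S p) wu)).
near=> w'.
have H1 : mudom (w', w) by near: w'.
have H2 : adom p (mu (w', w), u) by near: w'.
by rewrite {1 3}/alpha /lrep2 /= inv_alpha //= inv_mu //= actM.
Unshelve. all: by end_near. Qed.

(** Differentiate [kf_alpha] at [w = e] along [Y]: on its right-hand side the moving direction gives
    the first term, the moving base point a second derivative symmetric in [U] and [Y]. *)
Let bracket_half p U Y u : cimg p u ->
  'D_(kf p Y u) (kf p U) u =
  kf p ('D_U (livf (G := G) Y) e) u +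
  'D_(Y, 0) (fun q => 'D_(U, 0) (alpha p) q) (e, u).
Proof.
move=> pu; have eu := adom_e S pu; have ae := alpha_e S pu.
have ee : mudom (e, e) by apply: mudom_el; exact: cimg_egrp.
have oa := @adom_open _ _ _ _ _ _ S p.
have D1 : is_derive e Y (fun w => alpha p (w, u)) (kf p Y u).
  by rewrite kfE; apply: partial1; exact: alpha_diff.
have dk : differentiable (kf p U) (alpha p (e, u)) by rewrite ae; exact: kf_diff.
have [d1 d1E] := D1.
have D2 := is_derive_chain (g := fun w => alpha p (w, u)) dk d1.
rewrite d1E ae in D2.
pose rho w := 'D_(U, 0) mu (e, w).
have rho_e : rho e = U.
  have [_ E] := partial1 U (mu_diff ee); rewrite /rho -E -[RHS](derive_id e U).
  apply: near_eq_derive.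
  apply: filterS (open_nbhs_nbhs (conj (cimg_open o) (@cimg_egrp R m G))) => w ow.
  exact: mu_er.
(* By Schwarz, the derivative along [Y] of the right-invariant field of [U] equals that along [U] of
   the left-invariant field of [Y], both being a mixed derivative of the multiplication. *)
have drho : is_derive e Y rho ('D_U (livf (G := G) Y) e).
  have oc := cimg_open o.
  have dr : differentiable (fun q => 'D_(U, 0) mu q) (e, e).
    exact: (Ck_differentiable (@mudom_open R m G) (Ck_D (U, 0) (@mu_smooth R m G 2)) ee).
  have dl : differentiable (fun q => 'D_(0, Y) mu q) (e, e).
    exact: (Ck_differentiable (@mudom_open R m G) (Ck_D (0, Y) (@mu_smooth R m G 2)) ee).
  have D := partial2 Y dr.
  have E1 : 'D_(0, Y) (fun q => 'D_(U, 0) mu q) (e, e) = 'D_(U, 0) (fun q => 'D_(0, Y) mu q) (e, e).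
    exact: (schwarz (0, Y) (U, 0) (@mudom_open R m G) (@mu_smooth R m G 2) ee).
  have [_ E2] := partial1 U dl.
  have E3 : livf (G := G) Y = (fun w => 'D_(0, Y) mu (w, e)) by apply/funext => w; exact: livfE.
  by rewrite E3 E2 -E1.
have dpl : is_derive e Y (fun w => (w, u) : 'rV[R]_m * 'rV[R]_n) (Y, 0).
  exact: is_derive_pairl.
have drp : is_derive e Y (fun w => (rho w, 0) : 'rV[R]_m * 'rV[R]_n) ('D_U (livf (G := G) Y) e, 0).
  have [r1 <-] := drho.
  have := derivable_lin (L := @inl_lin R 'rV[R]_m 'rV[R]_n) (@inl_cont R 'rV[R]_m 'rV[R]_n) r1.
  exact.
have nO : \forall w \near e, adom p ((w, u)) := near_pairl oa eu.
have D3 := is_derive_moving oa (@alpha_smooth _ _ _ _ _ _ S p) nO dpl drp.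
rewrite rho_e -kfE in D3.
case: D2 => _ <-; case: D3 => _ <-; apply: near_eq_derive.
have n2 := near_pairr (@mudom_open R m G) ee.
near=> w.
have H1 : adom p (w, u) by near: w.
have H2 : mudom (e, w) by near: w.
exact: kf_alpha.
Unshelve. all: by end_near. Qed.

(** Antisymmetrising [bracket_half] removes the second derivative of the action, and [lie_livf]
    recognises the rest. In this order it reads [[K_Y, K_U] = K_[U, Y]]. *)
Lemma kf_bracket p U Y u : cimg p u ->
  'D_(kf p Y u) (kf p U) u - 'D_(kf p U u) (kf p Y) u = kf p (lie (G := G) U Y) u.
Proof.
move=> pu.
have cancel (a b k1 k2 s1 s2 l : 'rV[R]_n) :
    a = k1 + s1 -> b = k2 + s2 -> s1 = s2 -> l = k1 - k2 -> a - b = l.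
  by move=> -> -> -> ->; rewrite opprD addrACA subrr addr0.
apply: (cancel _ _ _ _ _ _ _ (bracket_half U Y pu) (bracket_half Y U pu)).
  exact: (schwarz (Y, 0) (U, 0) (@adom_open _ _ _ _ _ _ S p)
    (@alpha_smooth _ _ _ _ _ _ S p 2) (adom_e S pu)).
by rewrite lie_livf; exact: (linear_propB (kf_linear S pu)).
Qed.

Variable g : riemannian_metric M.
Hypothesis invg : invariant_metric S g.

(** Invariance of the metric, transferred from the charts attached to a point and its image to the
    single chart [p]. *)
Let alpha_isometry p w' u v z : adom p (w', u) ->
  mform (gram g p (alpha p (w', u))) ('D_(0, v) (alpha p) (w', u)) ('D_(0, z) (alpha p) (w', u))
  = mform (gram g p u) v z.
Proof.
move=> Hw; have [/= ow pu pau] := Hw.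
set a := chart_inv o w'; set x := chart_inv p u.
have px : chart_dom p x := cimg_inv pu.
have uE : chart p x = u by exact: chart_invK.
have xx := chart_dom_mem x.
have sa : smooth_map (act a) := smooth_map_right (action_smooth S) a.
have pax : chart_dom p (act a x) by [].
have E y : 'D_(0, y) (alpha p) (w', u) =
    Jac (act a x) p (chart (act a x) (act a x)) (dmap (act a) x (Jac p x u y)).
  rewrite -(dmap_lrep _ sa px pax) -{2}uE JacK // uE.
  have [_ <-] := partial2 y (alpha_diff Hw).
  by [].
have -> : alpha p (w', u) = chart p (act a x) by [].
rewrite !E -metric_gram // invg (metric_gram g _ _ px) uE.
by rewrite -uE !JacK.
Qed.

(** The Killing equation in coordinates, obtained by differentiating [alpha_isometry] at the
    identity along [X]; Schwarz exchanges the derivatives in the group and in the manifold. *)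
Lemma kf_killing p X u v z : cimg p u ->
  mform (dgram g p u (kf p X u)) v z + mform (gram g p u) ('D_v (kf p X) u) z
  + mform (gram g p u) v ('D_z (kf p X) u) = 0.
Proof.
move=> pu; have eu := adom_e S pu; have ae := alpha_e S pu.
have oa := @adom_open _ _ _ _ _ _ S p.
have sal := @alpha_smooth _ _ _ _ _ _ S p.
have id_e y : 'D_(0, y) (alpha p) (e, u) = y.
  have [_ E] := partial2 y (alpha_diff eu); rewrite -E -[RHS](derive_id u y).
  apply: near_eq_derive.
  apply: filterS (open_nbhs_nbhs (conj (cimg_open p) pu)) => w pw.
  exact: alpha_e.
have dD y : is_derive e X (fun w => 'D_(0, y) (alpha p) (w, u)) ('D_y (kf p X) u).
  have d1 : differentiable (fun q => 'D_(0, y) (alpha p) q) (e, u).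
    exact: (Ck_differentiable oa (Ck_D (0, y) (sal 2)) eu).
  have d2 : differentiable (fun q => 'D_(X, 0) (alpha p) q) (e, u).
    exact: (Ck_differentiable oa (Ck_D (X, 0) (sal 2)) eu).
  have D := partial1 X d1.
  have E1 : 'D_(X, 0) (fun q => 'D_(0, y) (alpha p) q) (e, u) =
            'D_(0, y) (fun q => 'D_(X, 0) (alpha p) q) (e, u).
    exact: (schwarz (X, 0) (0, y) oa (sal 2) eu).
  have [_ E2] := partial2 y d2.
  have E3 : kf p X = (fun w => 'D_(X, 0) (alpha p) (e, w)) by apply/funext => w; exact: kfE.
  by rewrite E3 E2 -E1.
have D1 : is_derive e X (fun w => alpha p (w, u)) (kf p X u).
  by rewrite kfE; apply: partial1; exact: alpha_diff.
have Dm : is_derive e X (fun w => mform (gram g p (alpha p (w, u)))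
     ('D_(0, v) (alpha p) (w, u)) ('D_(0, z) (alpha p) (w, u)) : R^o)
  (mform (dgram g p (alpha p (e, u)) (kf p X u)) ('D_(0, v) (alpha p) (e, u)) ('D_(0, z) (alpha p) (e, u))
  + mform (gram g p (alpha p (e, u))) ('D_v (kf p X) u) ('D_(0, z) (alpha p) (e, u))
  + mform (gram g p (alpha p (e, u))) ('D_(0, v) (alpha p) (e, u)) ('D_z (kf p X) u)).
  apply: (@is_derive_mform R n _ (fun w => gram g p (alpha p (w, u)))
     (fun w => 'D_(0, v) (alpha p) (w, u)) (fun w => 'D_(0, z) (alpha p) (w, u))).
  - move=> i j; apply: (@is_derive_gram_chain _ _ _ g _ p (fun w => alpha p (w, u))) => //.
    by rewrite ae.
rewrite ae !id_e in Dm; case: Dm => _ <-.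
rewrite -[RHS](derive_cst (mform (gram g p u) v z : R^o) e X).
apply: near_eq_derive; apply: filterS (near_pairl oa eu) => w.
exact: alpha_isometry.
Qed.

End KillingCalculus.

(** * Geodesic orbits and the length of Killing fields *)

Section GeodesicOrbits.
Context {R : realType} {m n : nat} {G : lieGroupType R m} {H : set G}
  {M : manifoldType R n}.
Variable S : homogeneous_space H M.
Variable g : riemannian_metric M.
Hypothesis invg : invariant_metric S g.
Implicit Types (U V X Y W : 'rV[R]_m) (p x : M) (u v z : 'rV[R]_n).
Notation act := (action S).
Notation kf := (kf S).

(** Near time 0 the orbit is an integral curve of [K_U], so its second derivative is the derivative
    of [K_U] along itself. *)
Lemma orbit_acceleration x U (d : R) (c : R -> M) : 0 < d ->
  (forall t, `|t| < d -> c t = act (expt U t) x) ->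
  acceleration g c 0 =
    'D_(kf x U (chart x x)) (kf x U) (chart x x) + spray g x (chart x x) (kf x U (chart x x)).
Proof.
move=> d0 cE; have xx := chart_dom_mem x.
have c0 : c 0 = x by rewrite cE ?normr0 // expt0 act1.
have oA : open ([set t | `|t - 0| < d] : set R^o) := open_itv_center 0 d.
pose B : set R^o := [set t | `|t - 0| < d /\ chart_dom x (act (expt U t) x)].
have oB : open B.
  apply: (open_preimage_on oA (@chart_dom_open _ _ _ x)) => t _.
  apply: (continuous_comp (f := fun s => (expt U s, x)) (g := fun ax => act ax.1 ax.2)).
    by apply: cvg_pair; [exact: expt_cont|exact: cvg_cst].
  exact: (smooth_map2_continuous (action_smooth S)).
have B0 : B 0 by split; [rewrite subrr normr0|rewrite expt0 act1].
have BcE t : B t -> c t = act (expt U t) x by move=> [+ _]; rewrite subr0; exact: cE.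
pose y t := chart x (c t).
have yD t : B t -> is_derive t (1 : R) y (kf x U (y t)).
  move=> Bt; have [_ xt] := Bt; have D := orbit_derive xt.
  rewrite /y BcE //; apply: near_eq_is_derive D.
  by apply: filterS (open_nbhs_nbhs (conj oB Bt)) => s Bs; rewrite BcE.
have y0 : y 0 = chart x x by rewrite /y c0.
have d1E t : B t -> derive1 y t = kf x U (y t).
  by move=> /yD[_ E]; rewrite derive1E.
have d2E : derive1 (derive1 y) 0 = 'D_(kf x U (chart x x)) (kf x U) (chart x x).
  rewrite derive1E.
  have [d1 dE] := yD 0 B0; rewrite y0 in dE; rewrite -dE -y0.
  have dk : differentiable (kf x U) (y 0) by rewrite y0; apply: kf_diff; exact: cimg_self.
  have [_ <-] := is_derive_chain (g := y) dk d1.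
  by apply: near_eq_derive; apply: filterS (open_nbhs_nbhs (conj oB B0)) => s /d1E.
rewrite /acceleration c0 -/y spray_christoffel.
have E1 := d1E 0 B0; rewrite y0 in E1.
exact: (f_equal2 (fun a b => a + spray g x (chart x x) b) d2E E1).
Qed.

(** Here [k = K_U] and [w = K_W]; [A], [B] are the derivatives of the metric along [k], [w]; [a],
    [b], [c] are those of [K_U] along [k], of [K_U] along [w], of [K_W] along [k]. After the
    symmetry of [Q] come the geodesic equation paired with [w], the Killing equation of [U] on [k],
    [w], and that of [W] on [k], [k]. Eliminating [A] and [B] leaves [Q(k, b - c) = 0]. *)
Let geodesic_algebra (Q A B : 'M[R]_n) (k w a b c l : 'rV[R]_n) : Q^T = Q ->
  mform Q a w + mform A k w - 2^-1 * mform B k k = 0 ->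
  mform A k w + mform Q a w + mform Q k b = 0 ->
  mform B k k + mform Q c k + mform Q k c = 0 ->
  b - c = l -> mform Q k l = 0.
Proof. by move=> QT EL K1 K2 <-; rewrite (mform_sym c k QT) in K2; rewrite mformBr; lra. Qed.

Lemma orbit_geodesic_bracket x U W :
  'D_(kf x U (chart x x)) (kf x U) (chart x x) + spray g x (chart x x) (kf x U (chart x x)) = 0 ->
  mform (gram g x (chart x x)) (kf x U (chart x x)) (kf x (lie (G := G) U W) (chart x x)) = 0.
Proof.
move=> Hacc; have pu := cimg_self x.
have EL := EL_spray g (kf x U (chart x x)) ('D_(kf x U (chart x x)) (kf x U) (chart x x))
  (kf x W (chart x x)) pu.
rewrite Hacc mform0l in EL.
have K1 := kf_killing invg U (kf x U (chart x x)) (kf x W (chart x x)) pu.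
have K2 := kf_killing invg W (kf x U (chart x x)) (kf x U (chart x x)) pu.
have Br := kf_bracket S U W pu.
exact: (geodesic_algebra (gram_tr g x _) EL K1 K2 Br).
Qed.

Lemma killing_gram p x U V : chart_dom p x ->
  g x (killing S U x) (killing S V x) =
  mform (gram g p (chart p x)) (kf p U (chart p x)) (kf p V (chart p x)).
Proof.
move=> px; apply: etrans (metric_gram g _ _ px) _.
have E W : Jac x p (chart x x) (killing S W x) = kf p W (chart p x).
  exact: etrans (f_equal _ (killingE S W x)) (kf_change S W px).
exact: f_equal2 (E U) (E V).
Qed.

(** This is where the geodesic orbit property enters: the geodesic with velocity [z] is the orbit of
    [U], and the relation found in the chart attached to [x] is carried to the chart [p]. *)
Lemma killing_surj p x z : chart_dom p x -> geodesic_orbit S g ->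
  exists2 U, kf p U (chart p x) = z &
  forall W, mform (gram g p (chart p x)) z (kf p (lie (G := G) U W) (chart p x)) = 0.
Proof.
move=> px GO; have xx := chart_dom_mem x.
have [d [c [d0 gc c0 vc]]] := geodesic_exists g x (Jac p x (chart p x) z).
have oI : open [set t : R | `|t| < d].
  by have := open_itv_center 0 d; under eq_set do rewrite subr0.
have iI : is_interval [set t : R | `|t| < d].
  move=> a b /= ad bd t /andP[a_t t_b].
  by move: ad bd; rewrite !ltr_norml => /andP[? ?] /andP[? ?]; apply/andP; split; lra.
have [|U UE] := GO _ c oI iI _ gc; first by rewrite /= normr0.
rewrite c0 in UE.
have acc : acceleration g c 0 = 0 by apply: (proj2 gc); rewrite /= normr0.
rewrite (orbit_acceleration d0 UE) in acc.
have UW W := orbit_geodesic_bracket W acc.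
have Uz : kf x U (chart x x) = Jac p x (chart p x) z.
  rewrite -vc /velocity c0 derive1E.
  have := @orbit_derive _ _ _ _ _ _ S x U x 0; rewrite expt0 act1 => /(_ xx) [_ <-].
  apply: near_eq_derive.
  have : \forall t \near (0 : R), `|t| < d.
    by apply/nbhs_ballP; exists d => // s; rewrite -ball_normE /= sub0r normrN.
  by apply: filterS => t /UE ->.
have Upz : kf p U (chart p x) = z by rewrite -(kf_change S U px) Uz JacK.
exists U => // W.
by rewrite -[X in mform _ X _]Upz -killing_gram // (killing_gram _ _ xx); exact: UW.
Qed.

Definition klen p Y u : R^o := mform (gram g p u) (kf p Y u) (kf p Y u).

Lemma klen_smooth p Y : smooth_on (cimg p) (klen p Y).
Proof.
move=> k; apply: Ck_mform; [exact: cimg_open|move=> i j; exact: gram_smooth|exact: kf_smooth..].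
Qed.

Lemma klen_diff p Y u : cimg p u -> differentiable (klen p Y) u.
Proof. by move=> pu; exact: (Ck_differentiable (cimg_open p) (@klen_smooth p Y 1%N) pu). Qed.

(** With [y = K_Y] and [A] the derivative of the metric along [K_U], [b] is the derivative of [K_U]
    along [y] and [a] that of [K_Y] along [K_U]; the Killing equation of [U] on [y], [y] trades [A]
    for [b]. *)
Let klen_algebra (Q A : 'M[R]_n) (y a b l : 'rV[R]_n) : Q^T = Q ->
  mform A y y + mform Q b y + mform Q y b = 0 -> b - a = l ->
  mform A y y + mform Q a y + mform Q y a = - 2 * mform Q l y.
Proof.
move=> QT K1 <-; rewrite !(mform_sym _ y QT) in K1 *; rewrite mformBr.
lra.
Qed.

Lemma klen_derive p U Y u : cimg p u ->
  'D_(kf p U u) (klen p Y) u =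
  - 2 * mform (gram g p u) (kf p (lie (G := G) U Y) u) (kf p Y u).
Proof.
move=> pu.
have dY z : is_derive u z (kf p Y) ('D_z (kf p Y) u).
  by apply/derivableP/diff_derivable/kf_diff.
have Dm : is_derive u (kf p U u) (klen p Y)
   (mform (dgram g p u (kf p U u)) (kf p Y u) (kf p Y u)
   + mform (gram g p u) ('D_(kf p U u) (kf p Y) u) (kf p Y u)
   + mform (gram g p u) (kf p Y u) ('D_(kf p U u) (kf p Y) u)).
  apply: (@is_derive_mform R n _ (fun w => gram g p w) (kf p Y) (kf p Y)) => //.
  by move=> i j; apply: (@is_derive_gram_chain _ _ _ g _ p id u).
have [_ ->] := Dm.
have K1 := kf_killing invg U (kf p Y u) (kf p Y u) pu.
have Br := kf_bracket S U Y pu.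
exact: (klen_algebra (gram_tr g p u) K1 Br).
Qed.

End GeodesicOrbits.

(** * Constancy of the length *)

(** Gram-Schmidt along [s], carried out on the sources rather than the images, since [L], later the
    evaluation of Killing fields at a point, may have a kernel. *)
Lemma orthogonal_decomposition {R : realType} {m n : nat} (Q : 'M[R]_n)
    (L : 'rV[R]_m -> 'rV[R]_n) (s : seq 'rV[R]_m) :
  Q^T = Q -> (forall v, v != 0 -> 0 < mform Q v v) -> linear L ->
  forall z, exists2 Z, Z \in << s >>%VS &
    forall Y, Y \in << s >>%VS -> mform Q (z - L Z) (L Y) = 0.
Proof.
move=> QT Qpos lL; have LD := linear_propD lL; have LB := linear_propB lL.
have LZ := linear_propZ lL.
elim: s => [|a s IH] z.
  exists 0; first exact: mem0v.
  by move=> Y; rewrite span_nil memv0 => /eqP ->; rewrite (linear_prop0 lL) mform0r.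
have [Z0 sZ0 Z0P] := IH z; have [A0 sA0 A0P] := IH (L a).
pose b := a - A0.
have bP Y : Y \in << s >>%VS -> mform Q (L b) (L Y) = 0.
  by move=> /A0P; rewrite /b LB.
pose t := mform Q (z - L Z0) (L b) / mform Q (L b) (L b).
have tP : mform Q (z - L Z0) (L b) = t * mform Q (L b) (L b).
  (* When [L b = 0] the new vector contributes nothing, and both sides vanish whatever [t] is. *)
  have [->|b0] := eqVneq (L b) 0; first by rewrite !mform0r mulr0.
  by rewrite /t divfK // gt_eqF // Qpos.
have sub Y : Y \in << s >>%VS -> Y \in << a :: s >>%VS.
  by rewrite span_cons; apply: (subvP (addvSr _ _)).
have sa : a \in << a :: s >>%VS by rewrite memv_span // mem_head.
exists (Z0 + t *: b).
  by apply: memvD; [exact: sub|apply: memvZ; apply: memvB => //; exact: sub].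
move=> Y; rewrite span_cons => /memv_addP [_ /vlineP [k ->] [Y' sY' ->]].
(* Trade [a] for [b], whose image is orthogonal to that of the span of [s]; the difference [k A0]
   joins the part in that span. *)
pose Y2 := k *: A0 + Y'.
have sY2 : Y2 \in << s >>%VS by apply: memvD => //; exact: memvZ.
have -> : k *: a + Y' = k *: b + Y2 by rewrite /Y2 addrA -scalerDr subrK.
have E w : mform Q (z - L (Z0 + t *: b)) w = mform Q (z - L Z0) w - t * mform Q (L b) w.
  rewrite LD LZ opprD addrA (mform_sym _ _ QT) mformBr mformZr.
  by rewrite !(mform_sym w _ QT).
rewrite E LD LZ !mformDr !mformZr tP (Z0P _ sY2) (bP _ sY2).
ring.
Qed.

Section ConstantLength.
Context {R : realType} {m n : nat} {G : lieGroupType R m} {H : set G}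
  {M : manifoldType R n}.
Variable S : homogeneous_space H M.
Variable g : riemannian_metric M.
Variable a : {vspace 'rV[R]_m}.
Hypothesis connectedM : connected [set: M].
Hypothesis invg : invariant_metric S g.
Hypothesis GO : geodesic_orbit S g.
Hypothesis ideala : abelian_ideal G a.

Lemma klen_derive0 p Y u z : Y \in a -> cimg p u -> 'D_z (klen S g p Y) u = 0.
Proof.
move=> aY pu; have [aI aA] := ideala.
have dl : linear (fun z => 'D_z (klen S g p Y) u).
  by apply: derive_linear; exact: klen_diff.
have lk := kf_linear S pu.
have ab Z : Z \in a -> 'D_(kf S p Z u) (klen S g p Y) u = 0.
  by move=> aZ; rewrite klen_derive // aA // (linear_prop0 lk) mform0l mulr0.
have [Z] := orthogonal_decomposition (vbasis a) (gram_tr g p u) (fun v => gram_pos g pu) lk z.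
rewrite (span_basis (vbasisP a)) => aZ ZP.
set z1 := z - kf S p Z u.
have [U Uz UP] := killing_surj invg (z1 + kf S p Y u) (cimg_inv pu) GO.
rewrite chart_invK // in Uz UP.
have aUY := aI U Y aY.
have D1 : 'D_(z1 + kf S p Y u) (klen S g p Y) u = 0.
  rewrite -{1}Uz klen_derive //.
  have := UP Y; rewrite (mform_sym _ _ (gram_tr g p u)) mformDr.
  rewrite (mform_sym _ z1 (gram_tr g p u)) ZP // add0r => ->.
  by rewrite mulr0.
have zE : z = (z1 + kf S p Y u) - kf S p Y u + kf S p Z u by rewrite addrK subrK.
rewrite zE (linear_propD dl) (linear_propB dl).
apply: etrans (f_equal2 +%R (f_equal2 (fun b c => b - c) D1 (ab Y aY)) (ab Z aZ)) _.
by rewrite subrr addr0.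
Qed.

Let len Y x := g x (killing S Y x) (killing S Y x).

(** A ball in the chart contains the segments from its centre to its points, and along these the
    mean value theorem applies with zero derivative. *)
Lemma len_locally_constant Y x : Y \in a -> \forall y \near x, len Y y = len Y x.
Proof.
move=> aY; have xx := chart_dom_mem x; have px := cimg_self x.
have /nbhs_ballP [r /= r0 rP] := open_nbhs_nbhs (conj (cimg_open x) px).
have near_seg u t : ball (chart x x) r u -> `|t| <= `|1 : R| ->
    cimg x (chart x x + t *: (u - chart x x)).
  rewrite normr1 => ur t1; apply: rP.
  rewrite -ball_normE /= opprD addrA subrr sub0r normrN normrZ.
  apply: (le_lt_trans (ler_piMl (normr_ge0 _) t1)).
  by move: ur; rewrite -ball_normE /= distrC.
have K u : ball (chart x x) r u -> klen S g x Y u = klen S g x Y (chart x x).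
  move=> ur; have dk t : `|t| <= `|1 : R| ->
      derivable (klen S g x Y) (chart x x + t *: (u - chart x x)) (u - chart x x).
    by move=> t1; apply/diff_derivable/klen_diff/near_seg.
  have [t t1 E] := dir_MVT dk.
  rewrite scale1r (addrC _ (u - _)) subrK in E.
  rewrite (klen_derive0 _ aY (near_seg u t ur t1)) mulr0 in E.
  by apply/eqP; rewrite -subr_eq0 E.
have n1 : \forall y \near x, chart_dom x y.
  exact: (open_nbhs_nbhs (conj (@chart_dom_open _ _ _ x) xx)).
have n2 : \forall y \near x, ball (chart x x) r (chart x y).
  have cx : {for x, continuous (chart x)} by exact: chart_continuous.
  by apply: cx; exact: nbhsx_ballx.
apply: filterS (filterI n1 n2) => y [xy yr].
by rewrite /len (killing_gram _ _ _ _ xy) (killing_gram _ _ _ _ xx); exact: K.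
Qed.

(** A level set of a locally constant function and its complement are both open, and [M] is
    connected. *)
Lemma killing_length_constant Y : Y \in a -> constant_on (len Y).
Proof.
move=> aY; pose x0 := Defs.proj S 1%g; exists (len Y x0).
have lc x : \forall y \near x, len Y y = len Y x := len_locally_constant x aY.
pose A := [set x | len Y x = len Y x0].
have oA : open A.
  by rewrite openE => x Ax; apply: filterS (lc x) => y yx; rewrite /A /= yx.
have oC : open (~` A).
  by rewrite openE => x Ax; apply: filterS (lc x) => y yx Ay; apply: Ax; rewrite /A /= -yx.
have AT : A = [set: M].
  apply: connectedM; first by exists x0.
    by exists A => //; rewrite setTI.
  by exists A; [rewrite -[A]setCK; exact: open_closedC|rewrite setTI].
by move=> x; have : A x by rewrite AT.
Qed.

Lemma killing_linear x : linear (fun U => killing S U x).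
Proof.
have -> : (fun U => killing S U x) = (fun U => kf S x U (chart x x)).
  by apply/funext => U; exact: killingE.
exact: kf_linear (cimg_self x).
Qed.

Lemma killing_product_constant X Y : X \in a -> Y \in a ->
  constant_on (fun x => g x (killing S X x) (killing S Y x)).
Proof.
move=> aX aY; have [k1 E1] := killing_length_constant (memvD aX aY).
have [k2 E2] := killing_length_constant aX; have [k3 E3] := killing_length_constant aY.
exists (2^-1 * (k1 - k2 - k3)) => x; rewrite -(E1 x) -(E2 x) -(E3 x) /len.
have -> : killing S (X + Y) x = killing S X x + killing S Y x.
  exact: (linear_propD (killing_linear x)).
exact: metric_polarization.
Qed.

End ConstantLength.

Theorem theorem4 (R : realType) (m n : nat) (G : lieGroupType R m)
    (H : set G) (M : manifoldType R n) (S : homogeneous_space H M)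
    (g : riemannian_metric M) (a : {vspace 'rV[R]_m})
    (compactH : compact H)
    (connectedM : connected [set: M])
    (effectiveG : effective S)
    (invariantg : invariant_metric S g)
    (GO : geodesic_orbit S g)
    (ideala : abelian_ideal G a) :
  (forall X, X \in a ->
     constant_on (fun x : M => g x (killing S X x) (killing S X x))) /\
  (forall X Y, X \in a -> Y \in a ->
     constant_on (fun x : M => g x (killing S X x) (killing S Y x))).
Proof.
split=> [X aX|X Y aX aY].
  exact: killing_length_constant aX.
exact: killing_product_constant aX aY.
Qed.
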